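(* The problem $4$-SAT/2-FLIP with lexicographic payoffs is PLS-complete.
   Context: PLS (Polynomial Local Search) is the class of local optimization problems in which a starting feasible solution and the neighborhood of a solution are computable in polynomial time, feasibility is recognizable in polynomial time, and one must output a local optimum (a feasible solution with no strictly better neighbor). PLS-completeness is with respect to PLS-reductions: a pair of polynomial-time functions $(f,g)$ where $f$ maps instances $I$ of $P$ to instances $f(I)$ of $Q$ and $g$ maps any local optimum $s$ of $f(I)$ to a local optimum $g(I,s)$ of $I$. The problem $k$-SAT/$d$-FLIP with lexicographic payoffs: the input is a CNF formula $F=C_1\wedge\dots\wedge C_t$ in which every clause has at most $k$ literals, with clauses listed in order of priority; clause $C_i$ has weight $2^{t-i}$ (so comparing payoffs amounts to comparing the $0/1$ vectors of satisfied clauses lexicographically). The payoff of a truth assignment $\alpha$ is the total weight of the clauses it satisfies. The task is to find an assignment $\alpha$ that is locally optimal: no assignment obtained from $\alpha$ by changing the values of at most $d$ variables has strictly larger payoff. *)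

(* Defs.v *)
From HB Require Import structures.
From mathcomp Require Import all_boot.

Set Implicit Arguments.
Unset Strict Implicit.
Unset Printing Implicit Defensive.

Notation bits := (seq bool).

(** * Deterministic multi-tape Turing machines *)

(* [None] is the blank, [Some (inl b)] an input/output bit, and [Some (inr a)]
   an auxiliary symbol of the machine. *)
Definition symbol (A : finType) : finType := option (bool + A).

Inductive move := MoveLeft | Stay | MoveRight.

Record machine := Machine {
  aux : finType;
  state : finType;
  ntapes : nat;
  start : state;
  halting : pred state;
  delta : state -> {ffun 'I_ntapes.+1 -> symbol aux} ->
          state * {ffun 'I_ntapes.+1 -> symbol aux * move}
}.

(* A two-way infinite tape with finitely many non-blank cells.  [left_of] lists
   the cells left of the head, nearest first; cells beyond either list are
   blank. *)
Record tape (A : finType) := Tape {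
  left_of : seq (symbol A);
  scanned : symbol A;
  right_of : seq (symbol A)
}.

Definition blank_tape (A : finType) : tape A := Tape [::] None [::].

Definition input_tape (A : finType) (w : bits) : tape A :=
  if w is b :: w' then
    Tape [::] (Some (inl b)) [seq Some (inl b') | b' <- w']
  else blank_tape A.

Definition write_move (A : finType) (t : tape A) (am : symbol A * move) :
    tape A :=
  let: Tape l _ r := t in
  let: (a, m) := am in
  match m with
  | MoveLeft => Tape (behead l) (head None l) (a :: r)
  | Stay => Tape l a r
  | MoveRight => Tape (a :: l) (head None r) (behead r)
  end.

Fixpoint bit_prefix (A : finType) (s : seq (symbol A)) : bits :=
  if s is Some (inl b) :: s' then b :: bit_prefix s' else [::].

Definition output_of (A : finType) (t : tape A) : bits :=
  bit_prefix (scanned t :: right_of t).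

Definition config (M : machine) : Type :=
  (state M * {ffun 'I_(ntapes M).+1 -> tape (aux M)})%type.

Definition init (M : machine) (w : bits) : config M :=
  (start M,
   [ffun i => if i == ord0 then input_tape (aux M) w else blank_tape (aux M)]).

Definition step (M : machine) (c : config M) : config M :=
  let: (q, ts) := c in
  if halting q then c else
  let: (q', act) := delta q [ffun i => scanned (ts i)] in
  (q', [ffun i => write_move (ts i) (act i)]).

Definition computes_within (M : machine) (w v : bits) (T : nat) : Prop :=
  exists2 n, n <= T &
    let c := iter n (@step M) (init M w) in
    halting c.1 /\ output_of (c.2 ord0) = v.

Definition polytime (f : bits -> bits) : Prop :=
  exists (M : machine) (c k : nat),
    forall w, computes_within M w (f w) (c * size w ^ k + c).

(** * Encodings of pairs, finite sequences and numbers by bit strings *)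

Definition self_delim (x : bits) : bits :=
  flatten [seq [:: true; b] | b <- x] ++ [:: false].

Definition pair_code (x y : bits) : bits := self_delim x ++ y.

Definition seq_code (ss : seq bits) : bits := flatten (map self_delim ss).

(* Binary, least significant bit first, leading zeros allowed. *)
Definition nat_of_bits (x : bits) : nat :=
  foldr (fun (b : bool) n => b + n.*2) 0 x.

(** * Local search problems and the class PLS *)

(* Instances and solutions are bit strings.  In [feasible], [payoff] and
   [neighbor] the first argument is the instance; only their values on genuine
   instances and on feasible solutions matter. *)
Record local_search := LocalSearch {
  maximize : bool;
  instance : bits -> Prop;
  feasible : bits -> bits -> Prop;
  payoff : bits -> bits -> nat;
  neighbor : bits -> bits -> bits -> Prop
}.

(* [better P x s s']: [s'] is strictly better than [s]. *)
Definition better (P : local_search) (x s s' : bits) : Prop :=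
  if maximize P then payoff P x s < payoff P x s'
  else payoff P x s' < payoff P x s.

Definition local_opt (P : local_search) (x s : bits) : Prop :=
  feasible P x s /\
  forall s', feasible P x s' -> neighbor P x s s' -> ~ better P x s s'.

Record in_PLS (P : local_search) : Prop := InPLS {
  instance_recognizable :
    exists2 r, polytime r & forall x, r x = [:: true] <-> instance P x;
  feasible_size :
    exists c k, forall x s, instance P x -> feasible P x s ->
      size s <= c * size x ^ k + c;
  feasible_recognizable :
    exists2 r, polytime r &
      forall x s, instance P x ->
        (r (pair_code x s) = [:: true] <-> feasible P x s);
  start_computable :
    exists2 a, polytime a & forall x, instance P x -> feasible P x (a x);
  payoff_computable :
    exists2 p, polytime p &
      forall x s, instance P x -> feasible P x s ->
        nat_of_bits (p (pair_code x s)) = payoff P x s;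
  neighbor_feasible :
    forall x s s', instance P x -> feasible P x s -> neighbor P x s s' ->
      feasible P x s';
  neighborhood_computable :
    exists2 h, polytime h &
      forall x s, instance P x -> feasible P x s ->
        exists2 ss : seq bits, h (pair_code x s) = seq_code ss &
          forall s', s' \in ss <-> neighbor P x s s'
}.

Definition PLS_reducible (P Q : local_search) : Prop :=
  exists f g : bits -> bits,
    [/\ polytime f, polytime g &
        forall x, instance P x ->
          instance Q (f x) /\
          forall s, local_opt Q (f x) s -> local_opt P x (g (pair_code x s))].

Definition PLS_complete (Q : local_search) : Prop :=
  in_PLS Q /\ forall P, in_PLS P -> PLS_reducible P Q.

(** * CNF formulas with prioritized clauses *)

(* [(v, b)] is the literal made true by giving the value [b] to variable [v]. *)
Definition literal : Type := (nat * bool)%type.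
Definition clause := seq literal.
(* In order of priority, the highest first. *)
Definition cnf := seq clause.

Definition nvars (F : cnf) : nat := \max_(l <- flatten F) l.1.+1.

(* The truth assignment [a] gives the value [nth false a v] to variable [v]. *)
Definition sat_clause (a : bits) (C : clause) : bool :=
  has (fun l : literal => nth false a l.1 == l.2) C.

(* With clauses numbered from 0, clause [i] of [t] has weight 2^(t - (i+1)). *)
Definition lex_payoff (F : cnf) (a : bits) : nat :=
  \sum_(i < size F | sat_clause a (nth [::] F i)) 2 ^ (size F - i.+1).

Definition hamming (a b : bits) : nat :=
  count (fun p : bool * bool => p.1 != p.2) (zip a b).

(* Two bits per token: 00 increments the index of the variable being read
   (indices are in unary), 01 and 10 end a positive, resp. negative, literal,
   and 11 ends a clause. *)
Definition encode_literal (l : literal) : bits :=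
  nseq l.1.*2 false ++ [:: ~~ l.2; l.2].

Definition encode_clause (C : clause) : bits :=
  flatten (map encode_literal C) ++ [:: true; true].

Definition encode_cnf (F : cnf) : bits := flatten (map encode_clause F).

Fixpoint parse (v : nat) (C : clause) (x : bits) {struct x} : option cnf :=
  match x with
  | [::] => if (v == 0) && nilp C then Some [::] else None
  | [:: false, false & y] => parse v.+1 C y
  | [:: false, true & y] => parse 0 (rcons C (v, true)) y
  | [:: true, false & y] => parse 0 (rcons C (v, false)) y
  | [:: true, true & y] =>
      if v == 0 then omap (cons C) (parse 0 [::] y) else None
  | [:: _] => None
  end.

Definition decode_cnf (x : bits) : cnf := odflt [::] (parse 0 [::] x).

Lemma encode_cnfK : cancel encode_cnf decode_cnf.
Proof.
have parseV n v C y : parse v C (nseq n.*2 false ++ y) = parse (n + v) C y.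
  by elim: n v => [|n IHn] v //=; rewrite IHn addnS.
have parseC C C0 y : parse 0 C0 (encode_clause C ++ y) =
    omap (cons (C0 ++ C)) (parse 0 [::] y).
  rewrite /encode_clause -catA.
  elim: C C0 => [|[v b] C IHC] C0 /=; first by rewrite cats0.
  rewrite -catA /encode_literal /= -catA parseV addn0.
  by case: b; rewrite /= IHC cat_rcons.
move=> F; rewrite /decode_cnf.
suff -> : parse 0 [::] (encode_cnf F) = Some F by [].
elim: F => [|C F IHF] //.
by rewrite /encode_cnf /= parseC -/(encode_cnf F) IHF.
Qed.

(** * k-SAT/d-FLIP with lexicographic payoffs *)

Definition is_assignment (F : cnf) (a : bits) : Prop := size a = nvars F.

Definition kSAT_dFLIP (k d : nat) : local_search := {|
  maximize := true;
  instance := fun x =>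
    exists2 F : cnf, x = encode_cnf F & forall C, C \in F -> size C <= k;
  feasible := fun x a => is_assignment (decode_cnf x) a;
  payoff := fun x a => lex_payoff (decode_cnf x) a;
  neighbor := fun x a b =>
    is_assignment (decode_cnf x) b /\ hamming a b <= d
|}.

(* Main.v *)
Require Import Defs.
From mathcomp Require Import all_boot zify.
From Stdlib Require Import FunctionalExtensionality.

(** Hardness is shown by a direct reduction from an arbitrary problem [P] in PLS.
    A polynomial-time machine maps an instance [x] and a solution [s] to the value
    of [s] (0 if [s] is infeasible) and to a successor of [s]: an improving
    neighbour if there is one, the starting solution if [s] is infeasible, and [s]
    otherwise. Its computation on [x] is a circuit [C] of gates of fan-in 2, whose
    inputs encode [s]. The formula describes two copies of [C]; a variable [y]
    names the active copy and variables [v_i] display its value. In order of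
    decreasing priority it says: (1) the gates of the active copy are correct (a
    gate takes 3 literals and the guard on [y] the fourth one); (2) from the most
    significant bit on, [v_i] implies the [i]-th value bit of the active copy, and
    [v_i] holds; (3) the inputs of the inactive copy are the successor computed by
    the active one; (4) all gates are correct. At a local optimum both copies are
    correct, [v] is the value of the active copy, and the inactive copy holds its
    successor. Were the value of the latter larger, flipping [y] together with the
    first [v_i] in which the two values differ would be an improvement. So a local
    optimum yields a solution with no improving neighbour. *)

Set Implicit Arguments.
Unset Strict Implicit.
Unset Printing Implicit Defensive.

Generalizable Variables A B C D E.

(** * Polynomial bounds *)

(** Two flips are needed when the copies change roles. Flipping [y] alone displays no larger bit and
    may falsify the implications of lower bits; with a second flip the first differing bit is gained
    at once, and everything it breaks has lower priority. Gates are listed in topological order, so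
    correcting a wrong output disturbs only gates of lower priority. The guards let the inactive
    copy take new inputs freely; its gates are enforced last, so that it is already correct when [y]
    is flipped.

    The bulk of the work is due to polynomial time being defined by Turing machines. The algorithms
    of [P] are given as machines and must be composed into one function. Stack programs, for which
    closure properties are easy, are therefore compiled to machines, and machines are simulated by
    stack programs. The circuit is the computation tableau of the resulting machine. In it the heads
    stay put and the tapes shift, so a cell depends on four earlier cells; it consists of copies of
    fixed templates at computed addresses, so that the formula can be written down in polynomial
    time. *)

(* Every polynomial is below some [pb k], and these bounds are closed under
   sums, products and composition, so that one exponent is the only parameter
   of a running-time bound. *)
Definition pb (k n : nat) : nat := (n + 2) ^ k.

Definition polyb (f : nat -> nat) : Prop := exists k, forall n, f n <= pb k n.

Lemma pb_gt0 k n : 0 < pb k n.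
Proof. by rewrite /pb expn_gt0 addn2. Qed.

Lemma pb_mono k n m : n <= m -> pb k n <= pb k m.
Proof. by move=> h; case: k => // k; rewrite leq_exp2r // leq_add2r. Qed.

Lemma pb_leexp j k n : j <= k -> pb j n <= pb k n.
Proof. by move=> h; rewrite /pb leq_pexp2l // addn2. Qed.

Lemma polyb_le f g : (forall n, f n <= g n) -> polyb g -> polyb f.
Proof. by move=> h [k hk]; exists k => n; apply: leq_trans (h n) (hk n). Qed.

Lemma polyb_const c : polyb (fun=> c).
Proof.
exists c => n; apply: (@leq_trans (2 ^ c)); first exact: ltnW (ltn_expl _ _).
by case: c => // c; rewrite leq_exp2r // leq_addl.
Qed.

Lemma polyb_id : polyb (fun n => n).
Proof. by exists 1 => n; rewrite /pb expn1 leq_addr. Qed.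

Lemma polyb_add f g : polyb f -> polyb g -> polyb (fun n => f n + g n).
Proof.
move=> [j hj] [k hk]; exists (j + k).+1 => n.
apply: (@leq_trans (2 * pb (j + k) n)).
  rewrite mul2n -addnn leq_add //.
    by apply: leq_trans (hj n) (pb_leexp _ (leq_addr _ _)).
  by apply: leq_trans (hk n) (pb_leexp _ (leq_addl _ _)).
by rewrite /pb expnS leq_mul // leq_addl.
Qed.

Lemma polyb_mul f g : polyb f -> polyb g -> polyb (fun n => f n * g n).
Proof.
move=> [j hj] [k hk]; exists (j + k) => n.
by rewrite /pb expnD leq_mul // [_ ^ _](hj, hk).
Qed.

Lemma polyb_pb k f : polyb f -> polyb (fun n => pb k (f n)).
Proof.
(* Two extra factors [n + 2] absorb the [+ 2] inside [pb]. *)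
move=> [j hj]; exists (j.+2 * k) => n.
apply: leq_trans (pb_mono k (hj n)) _.
rewrite /pb expnM; case: k => // k; rewrite leq_exp2r //.
have h2 : 1 < n + 2 by rewrite addn2.
have := pb_gt0 j n; rewrite /pb => h0; rewrite !expnS.
have : 2 * (2 * (n + 2) ^ j) <= (n + 2) * ((n + 2) * (n + 2) ^ j).
  by rewrite leq_mul // leq_mul.
move: h0; move: (_ ^ j) (_ * (_ * _)) => u v; lia.
Qed.

Lemma polyb_exp k f : polyb f -> polyb (fun n => f n ^ k).
Proof.
move=> /(polyb_pb k); apply: polyb_le => n.
by case: k => // k; rewrite /pb leq_exp2r // leq_addr.
Qed.

Lemma polyb_S f : polyb f -> polyb (fun n => (f n).+1).
Proof.
move=> hf; apply: polyb_le (polyb_add hf (polyb_const 1)) => n.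
by rewrite addn1.
Qed.

Ltac polyb_tac :=
  repeat first [ assumption | exact: polyb_id | exact: polyb_const | apply: polyb_add
               | apply: polyb_mul | apply: polyb_S | apply: polyb_pb | apply: polyb_exp ].

(** Returns from [pb] to the shape of bound used by [polytime]. The factor 2 pays for compilation,
    which spends two machine steps per unit of program time; the constant comes from
    [n + 2 <= 3 * n] for positive [n]. *)
Lemma pb_mul2 k : exists c, forall n, 2 * pb k n <= c * n ^ k + c.
Proof.
exists (2 * 3 ^ k) => n.
suff h : pb k n <= 3 ^ k * n ^ k + 3 ^ k by rewrite -mulnA -mulnDr leq_mul2l.
case: n => [|n].
  apply: (@leq_trans (3 ^ k)); last by rewrite leq_addl.
  by rewrite /pb; case: k => // k; rewrite leq_exp2r.
apply: leq_trans (leq_addr _ _); rewrite /pb -expnMn.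
by case: k => // k; rewrite leq_exp2r //; lia.
Qed.

(** * Stack programs *)

(** Registers are stacks of bits because a stack is half a tape with the head at its top: a push or
    a pop costs a bounded number of machine steps, and conversely two stacks hold a two-way tape. *)
Inductive cmd :=
| Skip
| Push of nat & bool
| Seq of cmd & cmd
| Case of nat & cmd & cmd & cmd
| Loop of nat & cmd & cmd.

Definition store := nat -> bits.

Definition upd (s : store) (r : nat) (w : bits) : store :=
  fun r' => if r' == r then w else s r'.

Definition st (l : seq bits) : store := fun r => nth [::] l r.

(* [Case r c0 c1 c2] pops a bit of [r] and branches on it, [c0] being the branch
   for an empty register; [Loop r c1 c2] pops bits of [r] and runs the
   corresponding branch until [r] is empty. *)
Inductive exec : cmd -> store -> store -> nat -> Prop :=
| ESkip s : exec Skip s s 0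
| EPush r b s : exec (Push r b) s (upd s r (b :: s r)) 1
| ESeq c1 c2 s1 s2 s3 t1 t2 :
    exec c1 s1 s2 t1 -> exec c2 s2 s3 t2 -> exec (Seq c1 c2) s1 s3 (t1 + t2)
| ECase0 r c0 c1 c2 s s' t :
    s r = [::] -> exec c0 s s' t -> exec (Case r c0 c1 c2) s s' t.+1
| ECaseb r c0 c1 c2 b w s s' t :
    s r = b :: w -> exec (if b then c2 else c1) (upd s r w) s' t ->
    exec (Case r c0 c1 c2) s s' t.+1
| ELoop0 r c1 c2 s : s r = [::] -> exec (Loop r c1 c2) s s 1
| ELoopb r c1 c2 b w s s1 s2 t1 t2 :
    s r = b :: w -> exec (if b then c2 else c1) (upd s r w) s1 t1 ->
    exec (Loop r c1 c2) s1 s2 t2 -> exec (Loop r c1 c2) s s2 (t1 + t2).+1.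

Definition execs (c : cmd) (s s' : store) (T : nat) : Prop :=
  exists2 t, t <= T & exec c s s' t.

Fixpoint nreg (c : cmd) : nat :=
  match c with
  | Skip => 0
  | Push r _ => r.+1
  | Seq c1 c2 => maxn (nreg c1) (nreg c2)
  | Case r c0 c1 c2 => maxn r.+1 (maxn (nreg c0) (maxn (nreg c1) (nreg c2)))
  | Loop r c1 c2 => maxn r.+1 (maxn (nreg c1) (nreg c2))
  end.

Lemma upd_st l r w : upd (st l) r w = st (set_nth [::] l r w).
Proof. by apply: functional_extensionality => i; rewrite /st nth_set_nth. Qed.

Lemma st_nil l n : st (l ++ nseq n [::]) = st l.
Proof.
apply: functional_extensionality => i; rewrite /st nth_cat nth_nseq if_same.
by case: ltnP => // h; rewrite nth_default.
Qed.

(** One unit of time pushes at most one bit. Hence running time bounds the size of results, which is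
    what makes composition polynomial. *)
Lemma exec_size c s s' t r : exec c s s' t -> size (s' r) <= size (s r) + t.
Proof.
have hu (w : bits) b q (u : store) : u q = b :: w ->
    size (upd u q w r) <= size (u r).
  by rewrite /upd; case: eqP => // -> ->; rewrite leqW.
move=> e; elim: c s s' t / e => //.
- by move=> *; rewrite addn0.
- by move=> q b s; rewrite /upd; case: eqP => [->|_] /=; rewrite ?addn1 ?leq_addr.
- by move=> c1 c2 s1 s2 s3 t1 t2 _ h1 _ h2; lia.
- by move=> q c0 c1 c2 s s' t _ _ h; lia.
- by move=> q c0 c1 c2 b w s s' t /hu h0 _ h; lia.
- by move=> *; rewrite leq_addr.
- by move=> q c1 c2 b w s s1 s2 t1 t2 /hu h0 _ h1 _ h2; lia.
Qed.

Lemma exec_frame c s s' t r : exec c s s' t -> nreg c <= r -> s' r = s r.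
Proof.
have hu (w : bits) q (u : store) : q < r -> upd u q w r = u r.
  by rewrite /upd; case: eqP => // ->; rewrite ltnn.
move=> e; elim: c s s' t / e => //=.
- by move=> *; rewrite hu.
- by move=> c1 c2 s1 s2 s3 t1 t2 _ h1 _ h2; rewrite geq_max => /andP[/h1 <- /h2].
- by move=> q c0 c1 c2 s s' t _ _ h; rewrite !geq_max => /and4P[_ /h].
- move=> q c0 c1 c2 b w s s' t _ _ h; rewrite !geq_max => /and4P[hq _ h1 h2].
  by rewrite h ?hu //; case: b {h}.
- move=> q c1 c2 b w s s1 s2 t1 t2 _ _ h1 _ h2; rewrite !geq_max.
  case/and3P=> hq k1 k2; rewrite h2 ?geq_max ?hq ?k1 //.
  by rewrite h1 ?hu //; case: b {h1}.
Qed.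

Fixpoint ren (f : nat -> nat) (c : cmd) : cmd :=
  match c with
  | Skip => Skip
  | Push r b => Push (f r) b
  | Seq c1 c2 => Seq (ren f c1) (ren f c2)
  | Case r c0 c1 c2 => Case (f r) (ren f c0) (ren f c1) (ren f c2)
  | Loop r c1 c2 => Loop (f r) (ren f c1) (ren f c2)
  end.

(** Renaming along an injection gives a program registers of its own; as the others are left alone,
    two programs can work side by side. *)
Lemma exec_ren f c s s' t : injective f -> exec c s s' t ->
  forall u : store, (forall r, u (f r) = s r) ->
  exists u', [/\ exec (ren f c) u u' t, forall r, u' (f r) = s' r &
                 forall r, (forall q, r <> f q) -> u' r = u r].
Proof.
move=> fI; elim=> {c s s' t} /=.
- by move=> s u hu; exists u; split=> //; constructor.
- move=> r b s u hu; exists (upd u (f r) (b :: u (f r))); split=> [|q|q hq].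
  + by constructor.
  + by rewrite /upd (inj_eq fI) !hu.
  + by rewrite /upd; case: eqP => // /hq.
- move=> c1 c2 s1 s2 s3 t1 t2 _ h1 _ h2 u /h1[u1 [e1 k1 g1]].
  have [u2 [e2 k2 g2]] := h2 _ k1; exists u2; split=> //; first exact: ESeq e1 e2.
  by move=> r hr; rewrite g2 // g1.
- move=> r c0 c1 c2 s s' t h0 _ h u hu; have [u' [e k g]] := h _ hu.
  by exists u'; split=> //; apply: ECase0 => //; rewrite hu.
- move=> r c0 c1 c2 b w s s' t h0 _ h u hu.
  have [q|u' [e k g]] := h (upd u (f r) w).
    by rewrite /upd (inj_eq fI) hu.
  exists u'; split=> //; first by apply: (@ECaseb _ _ _ _ b w);
    rewrite ?hu //; case: b e {h h0}.
  by move=> q hq; rewrite g // /upd; case: eqP => // /hq.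
- by move=> r c1 c2 s h0 u hu; exists u; split=> //; apply: ELoop0; rewrite hu.
- move=> r c1 c2 b w s s1 s2 t1 t2 h0 _ h1 _ h2 u hu.
  have [q|u1 [e1 k1 g1]] := h1 (upd u (f r) w).
    by rewrite /upd (inj_eq fI) hu.
  have [u2 [e2 k2 g2]] := h2 _ k1.
  exists u2; split=> //; first by apply: (@ELoopb _ _ _ b w _ u1);
    rewrite ?hu //; case: b e1 {h0 h1}.
  by move=> q hq; rewrite g2 // g1 // /upd; case: eqP => // /hq.
Qed.

Lemma execs_seq c1 c2 s1 s2 s3 T1 T2 :
  execs c1 s1 s2 T1 -> execs c2 s2 s3 T2 -> execs (Seq c1 c2) s1 s3 (T1 + T2).
Proof.
by move=> [t1 h1 e1] [t2 h2 e2]; exists (t1 + t2); [exact: leq_add|exact: ESeq e1 e2].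
Qed.

Lemma execs_le c s s' T T' : T <= T' -> execs c s s' T -> execs c s s' T'.
Proof. by move=> h [t ht e]; exists t => //; apply: leq_trans h. Qed.

Definition clear (r : nat) : cmd := Loop r Skip Skip.

Lemma exec_clear r s : exec (clear r) s (upd s r [::]) (size (s r)).+1.
Proof.
have : forall w (u : store), u r = w -> exec (clear r) u (upd u r [::]) (size w).+1.
  elim=> [|b w IH] u h.
    suff -> : upd u r [::] = u by constructor.
    by apply: functional_extensionality => i; rewrite /upd; case: eqP => // ->.
  rewrite -[(size _).+1]/(0 + (size w).+1).+1.
  apply: ELoopb h _ _; first by case: b; constructor.
  have -> : upd u r [::] = upd (upd u r w) r [::].
    by apply: functional_extensionality => i; rewrite /upd; case: eqP.
  by apply: IH; rewrite /upd eqxx.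
exact.
Qed.

Fixpoint clears (n : nat) : cmd :=
  if n is n'.+1 then Seq (clear n) (clears n') else Skip.

Lemma execs_clears n s m : (forall r, size (s r) <= m) ->
  execs (clears n) s (fun r => if 0 < r <= n then [::] else s r) (n * m.+1).
Proof.
elim: n s => [|n IH] s h.
  exists 0 => //; rewrite [fun r => _](_ : _ = s); first by constructor.
  by apply: functional_extensionality => -[].
have h1 r : size (upd s n.+1 [::] r) <= m by rewrite /upd; case: eqP => // _; apply: h.
rewrite mulSn; apply: execs_seq; first by exists (size (s n.+1)).+1;
  [rewrite ltnS; apply: h | exact: exec_clear].
move: (IH _ h1); congr (execs _ _ _ _).
apply: functional_extensionality => r; rewrite /upd [r <= n.+1]leq_eqVlt ltnS.
by case: (r =P n.+1) => [->|_] /=; rewrite ?ltnn.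
Qed.

(** Programs compose only if working registers are left empty. Registers from [nreg c] on are never
    touched and the others are no longer than input plus time, so clearing stays within a polynomial
    bound. *)
Lemma execs_clean c w s' T : execs c (st [:: w]) s' T ->
  execs (Seq c (clears (nreg c))) (st [:: w]) (st [:: s' 0])
    (T + nreg c * (size w + T).+1).
Proof.
move=> [t ht e]; apply: execs_seq; first by exists t; last exact: e.
have h r : size (s' r) <= size w + T.
  apply: leq_trans (exec_size r e) (leq_add _ ht).
  by case: r => [|[|r]].
move: (execs_clears (nreg c) h); congr (execs _ _ _ _).
apply: functional_extensionality => -[|r] //=.
rewrite /st nth_nil; case: ltnP => // hr.
by rewrite (exec_frame e) ?(leq_trans hr) // /st /= nth_nil.
Qed.

Fixpoint pushw (r : nat) (w : bits) : cmd :=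
  if w is b :: w' then Seq (pushw r w') (Push r b) else Skip.

Lemma exec_pushw r w s : exec (pushw r w) s (upd s r (w ++ s r)) (size w).
Proof.
elim: w => [|b w IH] /=.
  suff -> : upd s r (s r) = s by constructor.
  by apply: functional_extensionality => i; rewrite /upd; case: eqP => // ->.
rewrite -addn1; apply: ESeq IH _.
have -> : upd s r (b :: w ++ s r) =
    upd (upd s r (w ++ s r)) r (b :: upd s r (w ++ s r) r).
  by apply: functional_extensionality => i; rewrite /upd eqxx; case: eqP.
by constructor.
Qed.

Definition movw (r q : nat) (u : bool -> bits) : cmd :=
  Loop r (pushw q (u false)) (pushw q (u true)).

(** Moving from stack to stack reverses the order of the bits, so data that must keep their order
    are moved twice. *)
Lemma exec_movw r q u m s : r != q -> (forall b, size (u b) <= m) ->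
  execs (movw r q u) s
    (upd (upd s r [::]) q (flatten [seq u b | b <- rev (s r)] ++ s q))
    (m.+1 * size (s r)).+1.
Proof.
move=> hrq hm.
have : forall w (v : store), v r = w -> execs (movw r q u) v
    (upd (upd v r [::]) q (flatten [seq u b | b <- rev w] ++ v q))
    (m.+1 * size w).+1.
  elim=> [|b w IH] v h.
    exists 1 => //; suff -> : upd (upd v r [::]) q (v q) = v by constructor.
    apply: functional_extensionality => i; rewrite /upd.
    by case: eqP => [->//|_]; case: eqP => // ->.
  have [|t ht e] := IH (upd (upd v r w) q (u b ++ v q)).
    by rewrite /upd (negbTE hrq) eqxx.
  exists (size (u b) + t).+1.
    by rewrite /= mulnS; move: ht (hm b) => /=; lia.
  apply: ELoopb h _ _.
    have -> : (if b then pushw q (u true) else pushw q (u false)) = pushw q (u b).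
      by case: (b).
    exact: exec_pushw.
  move: e; rewrite /movw; congr (exec _ _ _ _).
    apply: functional_extensionality => i; rewrite /upd.
    by rewrite [q == r]eq_sym (negbTE hrq).
  apply: functional_extensionality => i; rewrite /upd eqxx rev_cons map_rcons.
  rewrite flatten_rcons -catA.
  by case: (i == q) => //; case: (i == r).
exact.
Qed.

Definition mov (r q : nat) : cmd := movw r q (fun b => [:: b]).

Lemma exec_mov r q s : r != q ->
  execs (mov r q) s (upd (upd s r [::]) q (rev (s r) ++ s q)) (2 * size (s r)).+1.
Proof.
move=> h; move: (@exec_movw r q (fun b => [:: b]) 1 s h (fun=> leqnn 1)).
by rewrite -/(mov r q) (_ : flatten _ = rev (s r)) //; elim: (rev _) => //= b w ->.
Qed.

(** * Compiling stack programs to Turing machines *)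

Inductive instr :=
| ILeft of nat
| IWrite of nat & bool
| ICase of nat & nat & nat & nat
| IJump of nat.

Fixpoint len (c : cmd) : nat :=
  match c with
  | Skip => 0
  | Push _ _ => 2
  | Seq c1 c2 => len c1 + len c2
  | Case _ c0 c1 c2 => (len c0 + (len c1 + (len c2).+1).+1).+2
  | Loop _ c1 c2 => (len c1 + (len c2).+1).+2
  end.

Fixpoint compile (k : nat) (c : cmd) : seq instr :=
  match c with
  | Skip => [::]
  | Push r b => [:: ILeft r; IWrite r b]
  | Seq c1 c2 => compile k c1 ++ compile (k + len c1) c2
  | Case r c0 c1 c2 =>
      let k0 := k.+1 in let k1 := (k0 + len c0).+1 in
      let k2 := (k1 + len c1).+1 in let e := (k2 + len c2).+1 in
      ICase r k0 k1 k2 ::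
        (compile k0 c0 ++ IJump e :: (compile k1 c1 ++ IJump e ::
         (compile k2 c2 ++ [:: IJump e])))
  | Loop r c1 c2 =>
      let k1 := k.+1 in let k2 := (k1 + len c1).+1 in
      let e := (k2 + len c2).+1 in
      ICase r e k1 k2 ::
        (compile k1 c1 ++ IJump k :: (compile k2 c2 ++ [:: IJump k]))
  end.

Lemma size_compile k c : size (compile k c) = len c.
Proof.
elim: c k => //=.
- by move=> c1 h1 c2 h2 k; rewrite size_cat h1 h2.
- move=> r c0 h0 c1 h1 c2 h2 k.
  by do 3!rewrite size_cat /=; rewrite h0 h1 h2; lia.
- by move=> r c1 h1 c2 h2 k; rewrite size_cat h1 /= size_cat h2 /=; lia.
Qed.

Section Compile.
Variables (n : nat) (C : seq instr).

(** States are positions in the code; the additional one, just past its end, is the halting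
    state. *)
Definition cstate := 'I_(size C).+1.

Definition cdelta (q : cstate) (sc : {ffun 'I_n.+1 -> symbol void}) :
    cstate * {ffun 'I_n.+1 -> symbol void * move} :=
  match nth (IJump 0) C q with
  | ILeft r =>
      (inord q.+1, [ffun i : 'I_n.+1 => (sc i, if i == r :> nat then MoveLeft else Stay)])
  | IWrite r b =>
      (inord q.+1, [ffun i : 'I_n.+1 => (if i == r :> nat then Some (inl b) else sc i, Stay)])
  | ICase r l0 l1 l2 =>
      if sc (inord r) is Some (inl b) then
        (inord (if b then l2 else l1),
         [ffun i : 'I_n.+1 => (sc i, if i == r :> nat then MoveRight else Stay)])
      else (inord l0, [ffun i : 'I_n.+1 => (sc i, Stay)])
  | IJump l => (inord l, [ffun i : 'I_n.+1 => (sc i, Stay)])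
  end.

Definition cmachine : machine :=
  @Machine void cstate n ord0 (fun q => q == size C :> nat) cdelta.

(** The top of the stack is under the head. Nothing is said of the cells to the left: a pop moves
    right and leaves the popped bit behind, and a push moves left and overwrites whatever is
    there. *)
Definition srep (t : tape void) (w : bits) : Prop :=
  exists k, scanned t :: right_of t = [seq Some (inl b) | b <- w] ++ nseq k None.

Definition rep (ts : {ffun 'I_n.+1 -> tape void}) (s : store) : Prop :=
  forall i : 'I_n.+1, srep (ts i) (s i).

Definition cconf (k : nat) (ts : {ffun 'I_n.+1 -> tape void}) : config cmachine :=
  (inord k : cstate, ts).

Lemma tape_stay (t : tape void) : write_move t (scanned t, Stay) = t.
Proof. by case: t. Qed.

Definition code_at (k : nat) (s : seq instr) : Prop :=
  k + size s <= size C /\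
  forall i, i < size s -> nth (IJump 0) C (k + i) = nth (IJump 0) s i.

Lemma code_at_cat k s1 s2 :
  code_at k (s1 ++ s2) -> code_at k s1 /\ code_at (k + size s1) s2.
Proof.
rewrite /code_at size_cat addnA => -[h1 h2]; split; split=> //.
- by apply: leq_trans h1; rewrite leq_addr.
- by move=> i hi; rewrite h2 ?nth_cat ?hi //; apply: ltn_addr.
- move=> i hi; rewrite -addnA h2 ?ltn_add2l // nth_cat ltnNge leq_addr /=.
  by rewrite addKn.
Qed.

Lemma code_at_cons k a s :
  code_at k (a :: s) ->
  [/\ k < size C, nth (IJump 0) C k = a & code_at k.+1 s].
Proof.
move=> [h1 h2]; split; first by apply: leq_trans h1; rewrite /= addnS ltnS leq_addr.
  by rewrite -{1}[k]addn0 h2.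
split; first by rewrite addSnnS.
by move=> i hi; rewrite addSnnS h2.
Qed.

Arguments step : simpl never.

Lemma cstep k ts : k < size C ->
  step (cconf k ts) =
  let: (q, act) := cdelta (inord k) [ffun i => scanned (ts i)] in
  (q, [ffun i => write_move (ts i) (act i)]).
Proof. by move=> h; rewrite /step /= inordK ?(ltnW h) ?ltnS 1?ltnW //  ltn_eqF. Qed.

Lemma cstep_jump k l ts : k < size C -> nth (IJump 0) C k = IJump l ->
  step (cconf k ts) = cconf l ts.
Proof.
move=> h e; rewrite cstep // /cdelta inordK ?ltnS 1?ltnW // e /cconf.
congr (_, _).
by apply/ffunP => i; rewrite !ffunE tape_stay.
Qed.

Lemma cstep_push k r b ts s : k.+1 < size C -> r <= n ->
  nth (IJump 0) C k = ILeft r -> nth (IJump 0) C k.+1 = IWrite r b -> rep ts s ->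
  exists2 ts', iter 2 (@step cmachine) (cconf k ts) = cconf k.+2 ts' &
    rep ts' (upd s r (b :: s r)).
Proof.
move=> h hr e1 e2 hts; rewrite /= cstep 1?ltnW //.
rewrite {1}/cdelta inordK ?ltnS 1?ltnW ?(ltnW h) // e1.
set ts1 := [ffun i => _]; rewrite -/(cconf k.+1 ts1) cstep //.
rewrite {1}/cdelta inordK ?ltnS 1?ltnW // e2.
eexists; first reflexivity.
move=> i; rewrite !ffunE /upd; case: eqP => [ei|_] /=; last first.
  by rewrite [scanned _]/= !tape_stay; apply: hts.
have [m hm] := hts i; rewrite -ei.
by case: (ts i) hm => l a r' /= hm; exists m => /=; rewrite hm.
Qed.

Lemma cstep_case k r l0 l1 l2 ts s : k < size C -> r <= n ->
  nth (IJump 0) C k = ICase r l0 l1 l2 -> rep ts s ->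
  exists2 ts', step (cconf k ts) =
    cconf (if s r is b :: _ then if b then l2 else l1 else l0) ts' &
    rep ts' (if s r is b :: w then upd s r w else s).
Proof.
move=> h hr e hts; rewrite cstep // /cdelta inordK ?ltnS 1?ltnW // e ffunE.
have hio : (inord r : 'I_n.+1) = r :> nat by rewrite inordK.
have [m hm] := hts (inord r); rewrite hio in hm.
case es : (s r) hm => [|b w] hm.
  have -> : scanned (ts (inord r)) = None by case: m hm => [|m] [].
  eexists; first reflexivity.
  by move=> i; rewrite !ffunE tape_stay; apply: hts.
have -> : scanned (ts (inord r)) = Some (inl b) by case: hm.
eexists; first reflexivity.
move=> i; rewrite !ffunE /upd; case: eqP => [ei|_] /=; last first.
  by rewrite tape_stay; apply: hts.
have {i ei} -> : i = inord r by apply/val_inj; rewrite /= inordK.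
case: (ts _) hm => l a r' /= [_ hr'].
case: r' hr' => [|a' r'] hr'; last by exists m.
by exists 1; case: w hr' {es}.
Qed.

(** Each unit of program time is charged at most two machine steps: move and write for a push, test
    and final jump for a branch or a loop round. The code may sit at any address [k], as the
    induction requires. *)
Lemma compile_correct c s s' t : exec c s s' t -> nreg c <= n.+1 ->
  forall k ts, code_at k (compile k c) -> rep ts s ->
  exists m ts', [/\ m <= 2 * t,
    iter m (@step cmachine) (cconf k ts) = cconf (k + len c) ts' & rep ts' s'].
Proof.
have iterD m1 m2 (x : config cmachine) : iter (m1 + m2) (@step cmachine) x =
    iter m2 (@step cmachine) (iter m1 (@step cmachine) x).
  by rewrite addnC iterD.
elim=> {c s s' t} /=.
- by move=> s _ k ts _ hts; exists 0, ts; rewrite addn0.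
- move=> r b s hr k ts /code_at_cons[_ e1 /code_at_cons[h2 e2 _]] hts.
  have [ts' e hts'] := cstep_push h2 hr e1 e2 hts.
  by exists 2, ts'; rewrite addn2.
- move=> c1 c2 s1 s2 s3 t1 t2 _ IH1 _ IH2; rewrite geq_max => /andP[n1 n2] k ts.
  move=> /code_at_cat; rewrite size_compile => -[k1 k2] hts.
  have [m1 [ts1 [b1 e1 h1]]] := IH1 n1 _ _ k1 hts.
  have [m2 [ts2 [b2 e2 h2]]] := IH2 n2 _ _ k2 h1.
  exists (m1 + m2), ts2; rewrite iterD e1 e2 addnA; split=> //.
  by rewrite mulnDr leq_add.
- move=> r c0 c1 c2 s s' t h0 _ IH; rewrite !geq_max => /and4P[nr n0 _ _] k ts.
  case/code_at_cons=> hk ek /code_at_cat[k0]; rewrite size_compile.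
  case/code_at_cons=> hj ej _ hts.
  have [ts1 e1] := cstep_case hk nr ek hts; rewrite h0 in e1 * => h1.
  have [m [ts2 [b2 e2 h2]]] := IH n0 _ _ k0 h1.
  exists (1 + (m + 1)), ts2; split=> //; first lia.
  rewrite iterD [iter 1 _ _]/= e1 iterD e2 /= (cstep_jump _ hj ej).
  by congr cconf; lia.
- move=> r c0 c1 c2 b w s s' t h0 _ IH; rewrite !geq_max.
  case/and4P=> nr n0 n1 n2 k ts.
  case/code_at_cons=> hk ek /code_at_cat[k0]; rewrite size_compile.
  case/code_at_cons=> _ _ /code_at_cat[k1]; rewrite size_compile.
  case/code_at_cons=> hj1 ej1 /code_at_cat[k2]; rewrite size_compile.
  case/code_at_cons=> hj2 ej2 _ hts.
  have [ts1 e1] := cstep_case hk nr ek hts; rewrite h0 in e1 * => h1.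
  case: b IH e1 {h0} => IH e1.
    have [m [ts2 [b2 e2 h2]]] := IH n2 _ _ k2 h1.
    exists (1 + (m + 1)), ts2; split=> //; first lia.
    rewrite iterD [iter 1 _ _]/= e1 iterD e2 /= (cstep_jump _ hj2 ej2).
    by congr cconf; lia.
  have [m [ts2 [b2 e2 h2]]] := IH n1 _ _ k1 h1.
  exists (1 + (m + 1)), ts2; split=> //; first lia.
  rewrite iterD [iter 1 _ _]/= e1 iterD e2 /= (cstep_jump _ hj1 ej1).
  by congr cconf; lia.
- move=> r c1 c2 s h0; rewrite !geq_max => /and3P[nr _ _] k ts.
  case/code_at_cons=> hk ek _ hts.
  have [ts1 e1] := cstep_case hk nr ek hts; rewrite h0 in e1 * => h1.
  by exists 1, ts1; split=> //=; rewrite e1; congr cconf; lia.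
- move=> r c1 c2 b w s s1 s2 t1 t2 h0 _ IH _ IHl hn k ts hat hts.
  move: (hn) (hat); rewrite !geq_max => /and3P[nr n1 n2].
  case/code_at_cons=> hk ek /code_at_cat[k1]; rewrite size_compile.
  case/code_at_cons=> hj1 ej1 /code_at_cat[k2]; rewrite size_compile.
  case/code_at_cons=> hj2 ej2 _.
  have [ts1 e1] := cstep_case hk nr ek hts; rewrite h0 in e1 * => h1.
  have [m [ts2 [b2 e2 h2]]] : exists m ts2, [/\ m <= 2 * t1 + 1,
      iter m (@step cmachine) (cconf (if b then (k.+1 + len c1).+1 else k.+1) ts1)
        = cconf k ts2 & rep ts2 s1].
    case: b IH {e1 h0} => IH.
      have [m [ts2 [b2 e2 h2]]] := IH n2 _ _ k2 h1.
      exists (m + 1), ts2; split=> //; first lia.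
      by rewrite iterD e2 /= (cstep_jump _ hj2 ej2).
    have [m [ts2 [b2 e2 h2]]] := IH n1 _ _ k1 h1.
    exists (m + 1), ts2; split=> //; first lia.
    by rewrite iterD e2 /= (cstep_jump _ hj1 ej1).
  have [m' [ts3 [b3 e3 h3]]] := IHl hn k ts2 hat h2.
  exists (1 + (m + m')), ts3; split=> //; first lia.
  by rewrite iterD [iter 1 _ _]/= e1 iterD e2 e3.
Qed.

End Compile.

Lemma polytime_of_cmd c k f :
  (forall w, execs c (st [:: w]) (st [:: f w]) (pb k (size w))) -> polytime f.
Proof.
move=> H; have [d hd] := pb_mul2 k.
exists (cmachine (nreg c) (compile 0 c)), d, k => w.
have [t ht e] := H w.
set M := cmachine _ _.
have hat : code_at (compile 0 c) 0 (compile 0 c) by split.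
have [|m [ts' [hm em hr]]] := compile_correct e (leqnSn _) hat (ts := (init M w).2).
  move=> i; rewrite /init ffunE; case: eqP => [->|ni].
    case: w {H ht e} => [|b w]; first by exists 1.
    by exists 0; rewrite cats0.
  case: i ni => -[|i] hi ni; first by case: ni; apply: val_inj.
  by exists 1; rewrite /st /= nth_nil.
exists m; first by apply: leq_trans hm (leq_trans _ (hd _)); rewrite leq_mul2l.
have -> : init M w = cconf (n := nreg c) (compile 0 c) 0 (init M w).2.
  by rewrite /init /cconf; congr (_, _); apply: val_inj; rewrite /= inordK.
rewrite /= em /= add0n inordK ?ltnS ?size_compile //; split=> //.
have [j hj] := hr ord0.
rewrite /output_of hj /st /=; elim: (f w) => [|b v IH] /=; first by case: j {hj}.
by rewrite IH.
Qed.

(** * Simulating Turing machines by stack programs *)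

(** Meant for loop-free programs, whose execution is total and takes time at most [cost], whatever
    the store. One step of a simulated machine is such a program, hence takes constant time. The
    last case is a dummy for [Loop]. *)
Fixpoint sem (c : cmd) (s : store) : store :=
  match c with
  | Push r b => upd s r (b :: s r)
  | Seq c1 c2 => sem c2 (sem c1 s)
  | Case r c0 c1 c2 =>
      match s r with
      | [::] => sem c0 s
      | false :: w => sem c1 (upd s r w)
      | true :: w => sem c2 (upd s r w)
      end
  | _ => s
  end.

Fixpoint loopfree (c : cmd) : bool :=
  match c with
  | Seq c1 c2 => loopfree c1 && loopfree c2
  | Case _ c0 c1 c2 => [&& loopfree c0, loopfree c1 & loopfree c2]
  | Loop _ _ _ => false
  | _ => true
  end.

Fixpoint cost (c : cmd) : nat :=
  match c with
  | Push _ _ => 1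
  | Seq c1 c2 => cost c1 + cost c2
  | Case _ c0 c1 c2 => (cost c0 + cost c1 + cost c2).+1
  | _ => 0
  end.

Lemma sem_seq c1 c2 s : sem (Seq c1 c2) s = sem c2 (sem c1 s).
Proof. by []. Qed.

Lemma loopfree_seq c1 c2 : loopfree c1 -> loopfree c2 -> loopfree (Seq c1 c2).
Proof. by move=> /= -> ->. Qed.

Lemma execs_loopfree c s : loopfree c -> execs c s (sem c s) (cost c).
Proof.
elim: c s => //=.
- by move=> s _; exists 0 => //; constructor.
- by move=> r b s _; exists 1 => //; constructor.
- by move=> c1 h1 c2 h2 s /andP[l1 l2]; apply: execs_seq; [apply: h1|apply: h2].
- move=> r c0 h0 c1 h1 c2 h2 s /and3P[l0 l1 l2]; case e: (s r) => [|[] w].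
  + by have [t ht et] := h0 s l0; exists t.+1; [lia|exact: ECase0].
  + by have [t ht et] := h2 (upd s r w) l2; exists t.+1; [lia|apply: ECaseb e _].
  + by have [t ht et] := h1 (upd s r w) l1; exists t.+1; [lia|apply: ECaseb e _].
Qed.

Lemma upd_same s r : upd s r (s r) = s.
Proof. by apply: functional_extensionality => i; rewrite /upd; case: eqP => // ->. Qed.

Lemma upd_upd s r v w : upd (upd s r v) r w = upd s r w.
Proof. by apply: functional_extensionality => i; rewrite /upd; case: eqP. Qed.

Lemma upd_eq s r w : upd s r w r = w.
Proof. by rewrite /upd eqxx. Qed.

Lemma upd_neq s r w i : i != r -> upd s r w i = s i.
Proof. by rewrite /upd => /negbTE ->. Qed.

Lemma sem_pushw r w s : sem (pushw r w) s = upd s r (w ++ s r).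
Proof. by elim: w => [|b w /= ->]; rewrite ?upd_same // upd_upd upd_eq. Qed.

Lemma loopfree_pushw r w : loopfree (pushw r w).
Proof. by elim: w => //= b w ->. Qed.

(** The bits read are remembered in the program text, through the continuation. The program is
    exponential in [n], which is a constant of the simulated machine in all uses. If the register
    runs empty, the continuation gets the bits read so far. *)
Fixpoint readw (n r : nat) (k : bits -> cmd) : cmd :=
  if n is n'.+1 then
    Case r (k [::]) (readw n' r (fun v => k (false :: v)))
      (readw n' r (fun v => k (true :: v)))
  else k [::].

Lemma loopfree_readw n r k : (forall v, loopfree (k v)) -> loopfree (readw n r k).
Proof. by elim: n k => //= n IH k h; rewrite h !IH. Qed.

Lemma sem_readw n r k s v w : s r = v ++ w -> size v = n ->
  sem (readw n r k) s = sem (k v) (upd s r w).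
Proof.
elim: n k s v => [|n IH] k s [|b v] //= h; first by rewrite -h upd_same.
move=> [hv]; rewrite h; case: b h => h.
  by rewrite (IH _ _ v) ?upd_eq // upd_upd.
by rewrite (IH _ _ v) ?upd_eq // upd_upd.
Qed.

Lemma sem_readw0 n r k s : s r = [::] -> sem (readw n r k) s = sem (k [::]) s.
Proof. by case: n => //= n ->. Qed.

(** * One-hot codes of finite types *)

Definition onehot (T : finType) (x : T) : bits := [seq y == x | y <- enum T].

Definition unhot (T : finType) (d : T) (v : bits) : T :=
  odflt d [pick x | onehot x == v].

Lemma size_onehot (T : finType) (x : T) : size (onehot x) = #|T|.
Proof. by rewrite size_map -cardE. Qed.

Lemma onehot_inj (T : finType) : injective (@onehot T).
Proof.
move=> x y /eq_in_map/(_ x); rewrite mem_enum eqxx => /(_ isT)/esym/eqP //.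
Qed.

Lemma onehotK (T : finType) (d x : T) : unhot d (onehot x) = x.
Proof.
rewrite /unhot; case: pickP => [y /eqP/onehot_inj //|/(_ x)].
by rewrite eqxx.
Qed.

(** No element has an empty code, so an exhausted register reads as the default, which is the blank
    for tape symbols. *)
Lemma unhot_nil (T : finType) (d : T) : unhot d [::] = d.
Proof.
rewrite /unhot; case: pickP => // y /eqP/(congr1 size).
by rewrite size_onehot => /eqP; rewrite -leqn0 leqNgt (cardD1 y).
Qed.

Section Simulation.
Variable M : machine.
Notation A := (aux M).
Notation S := (symbol (aux M)).
Notation n := (ntapes M).

(** Half tapes are compared through [nth None], that is, up to trailing blanks: a stack that has run
    empty stands for an endless blank tape. *)
Definition brep (w : bits) (l : seq S) : Prop :=
  exists l', w = flatten [seq onehot a | a <- l'] /\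
    forall j, nth None l' j = nth None l j.

Definition readS (r : nat) (k : S -> cmd) : cmd :=
  readw #|S| r (fun v => k (unhot None v)).

Lemma loopfree_readS r k : (forall v, loopfree (k v)) -> loopfree (readS r k).
Proof. by move=> h; apply: loopfree_readw. Qed.

Lemma sem_readS r k s l : brep (s r) l ->
  exists2 w, brep w (behead l) & sem (readS r k) s = sem (k (head None l)) (upd s r w).
Proof.
case=> -[|a l'] /= [hs hl].
  exists [::].
    by exists [::]; split=> // j; rewrite nth_behead -hl !nth_nil.
  by rewrite /readS sem_readw0 // unhot_nil -nth0 -hl /= -hs upd_same.
exists (flatten [seq onehot a | a <- l']).
  by exists l'; split=> // j; rewrite nth_behead -hl.
by rewrite /readS (sem_readw _ hs) ?size_onehot // onehotK -nth0 -hl.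
Qed.

Lemma brep_cons a w l : brep w l -> brep (onehot a ++ w) (a :: l).
Proof.
move=> [l' [-> h]]; exists (a :: l'); split=> // -[|j] //=; exact: h.
Qed.

(** The two halves of tape [i]. Registers 0 and 1 are left for the input and output word and for the
    state. *)
Definition Lr (i : nat) : nat := i.*2.+2.
Definition Rr (i : nat) : nat := i.*2.+3.

Lemma Lr_eq i j : (Lr i == Lr j) = (i == j).
Proof. by rewrite /Lr; lia. Qed.
Lemma Rr_eq i j : (Rr i == Rr j) = (i == j).
Proof. by rewrite /Rr; lia. Qed.
Lemma LRr_eq i j : (Lr i == Rr j) = false.
Proof. by rewrite /Lr /Rr; lia. Qed.
Lemma RLr_eq i j : (Rr i == Lr j) = false.
Proof. by rewrite /Lr /Rr; lia. Qed.

Fixpoint readall (s : seq nat) (acc : seq S) (k : seq S -> cmd) : cmd :=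
  if s is i :: s' then readS (Rr i) (fun a => readall s' (rcons acc a) k)
  else k acc.

Lemma loopfree_readall s acc k :
  (forall v, loopfree (k v)) -> loopfree (readall s acc k).
Proof. by move=> h; elim: s acc => //= i s IH acc; apply: loopfree_readS. Qed.

Lemma sem_readall (T : nat -> tape A) s acc k u : uniq s ->
  (forall i, i \in s -> brep (u (Rr i)) (scanned (T i) :: right_of (T i))) ->
  exists u', [/\ sem (readall s acc k) u = sem (k (acc ++ map (@scanned A \o T) s)) u',
    forall i, i \in s -> brep (u' (Rr i)) (right_of (T i)) &
    forall r, (forall i, i \in s -> r <> Rr i) -> u' r = u r].
Proof.
elim: s acc u => [|i s IH] acc u /=; first by exists u; rewrite cats0.
case/andP=> nis us hu.
have [w hw e] := sem_readS (fun a => readall s (rcons acc a) k) (hu i (mem_head _ _)).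
have [j hj|u' [e' h1 h2]] := IH (rcons acc (scanned (T i))) (upd u (Rr i) w) us.
  rewrite upd_neq; first by apply: hu; rewrite inE hj orbT.
  by rewrite Rr_eq; apply: contraNneq nis => <-.
exists u'; split; first by rewrite e /= e' cat_rcons.
  move=> j; rewrite inE; case: eqP => [-> _|_ /h1 //].
  by rewrite h2 ?upd_eq // => q hq /eqP; rewrite Rr_eq => /eqP eq; rewrite eq hq in nis.
move=> r hr; rewrite h2 ?upd_neq //; first by apply/eqP/hr; exact: mem_head.
by move=> q hq; apply: hr; rewrite inE hq orbT.
Qed.

Definition doact (i : nat) (am : S * move) : cmd :=
  match am.2 with
  | MoveLeft => Seq (pushw (Rr i) (onehot am.1))
                  (readS (Lr i) (fun a => pushw (Rr i) (onehot a)))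
  | Stay => pushw (Rr i) (onehot am.1)
  | MoveRight => pushw (Lr i) (onehot am.1)
  end.

Fixpoint doacts (s : seq nat) (act : nat -> S * move) : cmd :=
  if s is i :: s' then Seq (doact i (act i)) (doacts s' act) else Skip.

Lemma loopfree_doact i am : loopfree (doact i am).
Proof.
case: am => a [] /=; rewrite /doact /= ?loopfree_pushw //.
by apply: loopfree_readS => v; apply: loopfree_pushw.
Qed.

Lemma loopfree_doacts s act : loopfree (doacts s act).
Proof. by elim: s => //= i s ->; rewrite loopfree_doact. Qed.

Definition trep (u : store) (i : nat) (t : tape A) : Prop :=
  brep (u (Lr i)) (left_of t) /\ brep (u (Rr i)) (scanned t :: right_of t).

Lemma brep_head w l : brep w l -> brep w (head None l :: behead l).
Proof.
case=> l' [-> h]; exists l'; split=> // j; rewrite h.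
by case: l {h} => //=; case: j => [|[]].
Qed.

Lemma sem_doact u i (t : tape A) am :
  brep (u (Lr i)) (left_of t) -> brep (u (Rr i)) (right_of t) ->
  trep (sem (doact i am) u) i (write_move t am) /\
  forall r, r != Lr i -> r != Rr i -> sem (doact i am) u r = u r.
Proof.
case: t => l a r; case: am => a' [] /= hl hr; rewrite /doact /=.
- rewrite sem_pushw; set u1 := upd _ _ _.
  have hl1 : brep (u1 (Lr i)) l by rewrite /u1 upd_neq ?LRr_eq.
  have [w hw ->] := sem_readS (fun a => pushw (Rr i) (onehot a)) hl1.
  rewrite sem_pushw; split; last by move=> q h1 h2; rewrite /u1 !upd_neq.
  split=> /=; first by rewrite upd_neq ?LRr_eq // upd_eq.
  rewrite upd_eq upd_neq ?RLr_eq // /u1 upd_eq.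
  by apply: brep_cons; apply: brep_cons.
- rewrite sem_pushw; split; last by move=> q h1 h2; rewrite !upd_neq.
  split=> /=; first by rewrite upd_neq ?LRr_eq.
  by rewrite upd_eq; apply: brep_cons.
- rewrite sem_pushw; split; last by move=> q h1 h2; rewrite !upd_neq.
  split=> /=; first by rewrite upd_eq; apply: brep_cons.
  by rewrite upd_neq ?RLr_eq //; apply: brep_head.
Qed.

Lemma sem_doacts (T : nat -> tape A) act s u : uniq s ->
  (forall i, i \in s -> brep (u (Lr i)) (left_of (T i)) /\
                        brep (u (Rr i)) (right_of (T i))) ->
  (forall i, i \in s -> trep (sem (doacts s act) u) i (write_move (T i) (act i))) /\
  forall r, (forall i, i \in s -> (r != Lr i) && (r != Rr i)) ->
    sem (doacts s act) u r = u r.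
Proof.
elim: s u => //= i s IH u /andP[nis us] hu.
have [hl hr] := hu i (mem_head _ _).
have [h1 h2] := sem_doact (act i) hl hr.
have [|h3 h4] := IH (sem (doact i (act i)) u) us.
  move=> j hj; have ij : j != i by apply: contraNneq nis => <-.
  rewrite !h2 ?(Lr_eq, Rr_eq, LRr_eq, RLr_eq) //.
  by apply: hu; rewrite inE hj orbT.
split=> [j|r hr'].
  rewrite inE; case: eqP => [-> _|_ /h3 //].
  have ij q : q \in s -> i != q by move=> hq; apply: contraNneq nis => ->.
  case: h1 => h1l h1r; split; rewrite h4 // => q /ij iq.
    by rewrite LRr_eq Lr_eq iq.
  by rewrite RLr_eq Rr_eq iq.
have /andP[k1 k2] := hr' i (mem_head _ _).
by rewrite h4 ?h2 // => q hq; apply: hr'; rewrite inE hq orbT.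
Qed.

Definition simact (q : state M) (sy : seq S) : cmd :=
  let: (q', act) := delta q [ffun i : 'I_n.+1 => nth None sy i] in
  Seq (doacts (iota 0 n.+1) (fun i => act (inord i))) (pushw 1 (true :: onehot q')).

Definition simstep (q : state M) : cmd :=
  if halting q then Skip else readall (iota 0 n.+1) [::] (simact q).

(** The body of a loop on register 1, which holds [true] followed by the code of the state. The loop
    pops the [true]; a step pushes the new state with a fresh [true], while a halting state is
    consumed and leaves the register empty, which ends the loop. *)
Definition simbody : cmd :=
  readw #|state M| 1 (fun v => simstep (unhot (start M) v)).

Lemma loopfree_simbody : loopfree simbody.
Proof.
apply: loopfree_readw => v; rewrite /simstep; case: ifP => // _.
apply: loopfree_readall => sy; rewrite /simact; case: (delta _ _) => q' act.
by apply: loopfree_seq (loopfree_doacts _ _) (loopfree_pushw _ _).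
Qed.

Definition tsrep (u : store) (ts : {ffun 'I_n.+1 -> tape A}) : Prop :=
  forall i : 'I_n.+1, trep u i (ts i).

Definition crep (u : store) (c : config M) : Prop :=
  u 1 = true :: onehot c.1 /\ tsrep u c.2.

Lemma sem_simbody_halt u c : crep u c -> halting c.1 ->
  sem simbody (upd u 1 (onehot c.1)) = upd u 1 [::].
Proof.
move=> [h1 h2] hh.
rewrite (@sem_readw _ _ _ _ (onehot c.1) [::]) ?size_onehot ?upd_eq ?cats0 //.
by rewrite onehotK /simstep hh /= upd_upd.
Qed.

Lemma sem_simbody_step u c : crep u c -> ~~ halting c.1 ->
  crep (sem simbody (upd u 1 (onehot c.1))) (step c).
Proof.
case: c => q ts [/= h1 h2] hh.
rewrite (@sem_readw _ _ _ _ (onehot q) [::]) ?size_onehot ?upd_eq ?cats0 //.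
rewrite onehotK /simstep (negbTE hh) upd_upd.
pose T i := ts (inord i).
have hT i : i < n.+1 -> trep u i (T i).
  by move=> hi; have := h2 (inord i); rewrite inordK.
have [||u' [-> h3 h4]] := @sem_readall T (iota 0 n.+1) [::] (simact q) (upd u 1 [::]).
- exact: iota_uniq.
- by move=> i; rewrite mem_iota add0n => /hT[_ hi]; rewrite upd_neq.
rewrite cat0s /simact.
have -> : [ffun i : 'I_n.+1 => nth None [seq (@scanned A \o T) i | i <- iota 0 n.+1] i]
    = [ffun i => scanned (ts i)].
  apply/ffunP => i; rewrite !ffunE (nth_map 0) ?size_iota // nth_iota //=.
  by rewrite /T add0n inord_val.
case: (delta _ _) => q' act.
have [||h5 h6] := @sem_doacts T (fun i => act (inord i)) (iota 0 n.+1) u'.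
- exact: iota_uniq.
- move=> i hi; split; last exact: h3.
  rewrite h4; last by move=> j _ /eqP; rewrite LRr_eq.
  rewrite upd_neq //; have := hi; rewrite mem_iota add0n => /hT[] //.
rewrite sem_seq sem_pushw.
split=> [|i].
  rewrite upd_eq h6; last by move=> i _; rewrite /Lr /Rr; lia.
  by rewrite h4 ?upd_eq ?cats0 // => i _; rewrite /Rr; lia.
have /h5 : (i : nat) \in iota 0 n.+1 by rewrite mem_iota add0n leq0n ltn_ord.
by rewrite [_.2]/= ffunE /T inord_val /trep !upd_neq.
Qed.

Lemma step_halted (c : config M) m : halting c.1 -> iter m (@step M) c = c.
Proof.
by move=> h; elim: m => //= m ->; case: c h => q ts /= h; rewrite /step h.
Qed.

Lemma execs_simloop m c u : crep u c -> halting (iter m (@step M) c).1 ->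
  exists2 u', execs (Loop 1 Skip simbody) u u' (m.+1 * (cost simbody).+1).+1 &
    tsrep u' (iter m (@step M) c).2 /\ u' 1 = [::].
Proof.
elim: m c u => [|m IH] c u hu hm.
  exists (upd u 1 [::]).
    have := execs_loopfree (upd u 1 (onehot c.1)) loopfree_simbody.
    rewrite (sem_simbody_halt hu hm) => -[t ht e].
    exists (t + 1).+1; first by rewrite mul1n; lia.
    apply: (@ELoopb _ _ _ true (onehot c.1)); [by case: hu|exact: e|].
    by apply: ELoop0; rewrite upd_eq.
  split; last by rewrite upd_eq.
  by move=> i; have := hu.2 i; rewrite /trep !upd_neq.
case hh : (halting c.1).
  rewrite step_halted //; rewrite step_halted // in hm.
  have [u' [t ht e] hu'] := IH c u hu (etrans (congr1 (fun c => halting c.1)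
    (step_halted m hh)) hh).
  rewrite step_halted // in hu'; exists u' => //; exists t => //.
  by apply: leq_trans ht _; rewrite ltnS leq_mul2r leqnSn orbT.
rewrite iterSr in hm *.
have hu1 := sem_simbody_step hu (negbT hh).
have [u' [t ht e] hu'] := IH _ _ hu1 hm.
exists u' => //.
have [t1 ht1 e1] := execs_loopfree (upd u 1 (onehot c.1)) loopfree_simbody.
exists (t1 + t).+1; first by rewrite [_.+2 * _]mulSn; lia.
by apply: (@ELoopb _ _ _ true (onehot c.1)); [case: hu|exact: e1|exact: e].
Qed.

(** Register 1 is again the loop control: it is refilled only after an input/output bit, so the loop
    stops at the first other symbol, just as [bit_prefix] does. *)
Definition outbody : cmd :=
  readS (Rr 0) (fun a =>
    if a is Some (inl b) then Seq (Push 2 b) (Push 1 true) else Skip).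

Lemma loopfree_outbody : loopfree outbody.
Proof. by apply: loopfree_readS => -[[[]|]|]. Qed.

Lemma execs_outloop (l : seq S) u : u 3 = flatten [seq onehot a | a <- l] -> u 1 = [:: true] ->
  exists2 u', execs (Loop 1 Skip outbody) u u' ((size l).+1 * (cost outbody).+1).+1 &
    u' 2 = rev (bit_prefix l) ++ u 2 /\ u' 0 = u 0.
Proof.
have hb (a : S) (l' : seq S) (u' : store) : u' 3 = onehot a ++ flatten [seq onehot a | a <- l'] ->
    sem outbody u' = sem (if a is Some (inl b) then Seq (Push 2 b) (Push 1 true)
      else Skip) (upd u' 3 (flatten [seq onehot a | a <- l'])).
  by move=> h; rewrite /outbody /readS (sem_readw _ h) ?size_onehot // onehotK.
elim: l u => [|a l IH] u h3 h1.
  have := execs_loopfree (upd u 1 [::]) loopfree_outbody.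
  rewrite {1}/outbody /readS sem_readw0 ?unhot_nil ?upd_neq //= => -[t ht e].
  exists (upd u 1 [::]); last by rewrite !upd_neq.
  exists (t + 1).+1; first by rewrite mul1n; lia.
  apply: (@ELoopb _ _ _ true [::]) => //; first exact: e.
  by apply: ELoop0; rewrite upd_eq.
have [t ht e] := execs_loopfree (upd u 1 [::]) loopfree_outbody.
rewrite (hb a l) ?upd_neq // in e.
case: a h3 e => [[b|a]|] h3 e.
- move: e => /=; set u1 := upd _ 1 (true :: _) => e.
  have [||u' [t' ht' e'] [h2' h0']] := IH u1.
  + by rewrite /u1 /upd.
  + by rewrite /u1 /upd.
  exists u'; last first.
    by rewrite h2' h0' /u1 rev_cons cat_rcons /upd.
  exists (t + t').+1; first by rewrite [_.+2 * _]mulSn ltnS addSn -addnS leq_add.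
  by apply: (@ELoopb _ _ _ true [::]) => //; [exact: e|exact: e'].
- exists (upd (upd u 1 [::]) 3 (flatten [seq onehot a | a <- l])).
    exists (t + 1).+1; first by rewrite mulSn; lia.
    apply: (@ELoopb _ _ _ true [::]) => //; first exact: e.
    by apply: ELoop0; rewrite /upd.
  by rewrite !upd_neq.
- exists (upd (upd u 1 [::]) 3 (flatten [seq onehot a | a <- l])).
    exists (t + 1).+1; first by rewrite mulSn; lia.
    apply: (@ELoopb _ _ _ true [::]) => //; first exact: e.
    by apply: ELoop0; rewrite /upd.
  by rewrite !upd_neq.
Qed.

Lemma bit_prefix_ext (l l' : seq S) :
  (forall j, nth None l' j = nth None l j) -> bit_prefix l' = bit_prefix l.
Proof.
elim: l l' => [|a l IH] [|a' l'] // h.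
- by have /= -> := h 0.
- by have /= <- := h 0.
have /= -> := h 0; case: a h => [[b|]|] // h; congr (_ :: _).
by apply: IH => j; apply: (h j.+1).
Qed.

Definition symcode (b : bool) : bits := onehot (Some (inl b) : S).

Definition simulation : cmd :=
  Seq (Seq (mov 0 2) (Seq (movw 2 3 symcode) (pushw 1 (true :: onehot (start M)))))
 (Seq (Loop 1 Skip simbody)
 (Seq (Seq (clear 0) (Seq (clear 2) (Seq (pushw 1 [:: true]) (Loop 1 Skip outbody))))
      (mov 2 0))).

Lemma execs_simulation (f : bits -> bits) (T : nat -> nat) : polyb T ->
  (forall w, computes_within M w (f w) (T (size w))) ->
  exists2 t, polyb t &
    forall w, exists2 u, execs simulation (st [:: w]) u (t (size w)) & u 0 = f w.
Proof.
move=> hT H.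
(* The times for loading the input, running the machine, reading its output and moving the result to
   register 0. The bound [s2] on register sizes after the run is input plus elapsed time, by
   [exec_size]. *)
pose t1 n := (2 * n).+1 + ((#|S|.+1 * n).+1 + #|state M|.+1).
pose t2 n := ((T n).+1 * (cost simbody).+1).+1.
pose s2 n := n + (t1 n + t2 n).
pose t3 n := (s2 n).+1 + ((s2 n).+1 + (1 + ((s2 n).+1 * (cost outbody).+1).+1)).
pose t4 n := (2 * (s2 n + t3 n)).+1.
exists (fun n => t1 n + (t2 n + (t3 n + t4 n))).
  by rewrite /t4 /t3 /s2 /t2 /t1; polyb_tac.
move=> w; have [m hm [hh hv]] := H w.
pose u1 := upd (upd (upd (st [:: w]) 0 [::]) 3 (flatten [seq symcode b | b <- w]))
  1 (true :: onehot (start M)).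
have e1 : execs (Seq (mov 0 2) (Seq (movw 2 3 symcode)
    (pushw 1 (true :: onehot (start M))))) (st [:: w]) u1 (t1 (size w)).
  apply: execs_seq; first exact: exec_mov.
  apply: execs_seq.
    have := @exec_movw 2 3 symcode #|S| (upd (upd (st [:: w]) 0 [::]) 2
      (rev (st [:: w] 0) ++ st [:: w] 2)) isT.
    rewrite upd_eq /st /= cats0 size_rev revK.
    by apply=> b; rewrite size_onehot.
  exists (size (true :: onehot (start M))); first by rewrite /= size_onehot.
  set s0 := upd _ 3 _; have := exec_pushw 1 (true :: onehot (start M)) s0.
  congr (exec _ _ _ _).
  by rewrite /u1 /s0; apply: functional_extensionality => -[|[|[|[|i]]]] //=;
    rewrite /upd /= ?cats0.
have hc : crep u1 (init M w).
  split; first by rewrite /u1 upd_eq.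
  move=> i; rewrite /= ffunE; case: eqP => [->|ni].
    split; first by exists [::]; rewrite /input_tape; case: (w) => [|b w'].
    case: w {hm hh hv e1} @u1 => [|b w] u1.
      by exists [::]; split=> // -[|[]].
    exists [seq Some (inl b) | b <- b :: w]; split=> //.
    by rewrite /u1 upd_neq // upd_eq -map_comp.
  have hi : 0 < i by case: i ni => -[|i] hi // []; apply: val_inj.
  rewrite /trep /u1 /Lr /Rr; case: (nat_of_ord i) hi => // j _.
  rewrite !upd_neq // /st doubleS /= ?nth_nil.
  by split; exists [::]; split=> // -[|[]].
have [u2 e2 [h2 h21]] := execs_simloop hc hh.
have {}e2 : execs (Loop 1 Skip simbody) u1 u2 (t2 (size w)).
  by apply: execs_le e2; rewrite ltnS leq_mul2r ltnS hm orbT.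
have [_ [l' [hl hl']]] := h2 ord0.
have sz2 r : size (u2 r) <= s2 (size w).
  have [t ht e] := execs_seq e1 e2; apply: leq_trans (exec_size r e) _.
  by rewrite leq_add //; case: r => [|[|r]].
set u3 := upd (upd (upd u2 0 [::]) 2 [::]) 1 [:: true].
have h3 : u3 3 = flatten [seq onehot a | a <- l'] by rewrite /u3 !upd_neq.
have [//|u4 e4 [h42 h40]] := execs_outloop h3.
have sl : size l' <= size (u2 3).
  rewrite hl; elim: (l') => //= a l IH; rewrite size_cat size_onehot.
  by rewrite -add1n leq_add //; apply/card_gt0P; exists None.
have e3 : execs (Seq (clear 0) (Seq (clear 2) (Seq (pushw 1 [:: true])
    (Loop 1 Skip outbody)))) u2 u4 (t3 (size w)).
  apply: execs_seq; first by exists (size (u2 0)).+1; [rewrite ltnS; apply: sz2|exact: exec_clear].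
  apply: execs_seq; first by exists (size (upd u2 0 [::] 2)).+1;
    [rewrite ltnS upd_neq //; apply: sz2|exact: exec_clear].
  apply: execs_seq; first by exists 1 => //; exact: exec_pushw.
  rewrite !upd_neq // h21; apply: execs_le e4; rewrite ltnS leq_mul2r ltnS.
  by apply/orP; right; apply: leq_trans sl (sz2 3).
have sz4 : size (u4 2) <= s2 (size w) + t3 (size w).
  have [t ht e] := e3; apply: leq_trans (exec_size 2 e) _.
  by rewrite leq_add.
exists (upd (upd u4 2 [::]) 0 (rev (u4 2) ++ u4 0)).
  apply: execs_seq e1 (execs_seq e2 (execs_seq e3 _)).
  by apply: execs_le (@exec_mov 2 0 u4 isT); rewrite ltnS leq_mul2l sz4.
rewrite upd_eq h42 h40 /u3 /upd /= !cats0 revK -hv.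
by rewrite /output_of; apply: bit_prefix_ext.
Qed.

End Simulation.

Lemma cmd_of_polytime f : polytime f ->
  exists c k, forall w, execs c (st [:: w]) (st [:: f w]) (pb k (size w)).
Proof.
move=> [M [c [k H]]].
have [|t ht Ht] := @execs_simulation M f (fun n => c * n ^ k + c) _ H.
  by polyb_tac.
have [K hK] : polyb (fun n => t n + nreg (simulation M) * (n + t n).+1) by polyb_tac.
exists (Seq (simulation M) (clears (nreg (simulation M)))), K => w.
by have [u e <-] := Ht w; apply: execs_le (execs_clean e).
Qed.

(** * Polynomial time on encoded data *)

Class Enc (A : Type) := code : A -> bits.

#[global] Instance Enc_bool : Enc bool := fun b => [:: b].
(** Unary, so that iterating a number of times, adding and multiplying are all polynomial in the
    size of the code. Payoffs, which may be exponential, never get this type and remain bit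
    strings. *)
#[global] Instance Enc_nat : Enc nat := fun n => nseq n true.
#[global] Instance Enc_prod A B {eA : Enc A} {eB : Enc B} : Enc (A * B) :=
  fun p => pair_code (code p.1) (code p.2).
#[global] Instance Enc_seq A {eA : Enc A} : Enc (seq A) | 10 :=
  fun l => seq_code [seq code x | x <- l].
(* Takes precedence over [Enc_seq] on [seq bool]. *)
#[global] Instance Enc_bits : Enc bits | 0 := id.

(** Input and output sit in register 0 and all other registers are empty before and after, so that
    programs compose by [Seq]. *)
Definition FP {A B : Type} {eA : Enc A} {eB : Enc B} (f : A -> B) : Prop :=
  exists c k, forall a,
    execs c (st [:: code a]) (st [:: code (f a)]) (pb k (size (code a))).

Lemma polytime_FP (f : bits -> bits) : FP f -> polytime f.
Proof. by move=> [c [k h]]; apply: (@polytime_of_cmd c k). Qed.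

Lemma FP_polytime (f : bits -> bits) : polytime f -> FP f.
Proof. exact: cmd_of_polytime. Qed.

Lemma execs_sub f c w v T (u : store) : injective f ->
  (forall r, (exists q, r = f q) \/ (forall q, r <> f q)) ->
  execs c (st [:: w]) (st [:: v]) T -> u (f 0) = w -> (forall q, u (f q.+1) = [::]) ->
  execs (ren f c) u (upd u (f 0) v) T.
Proof.
move=> fI dec [t ht e] h0 hS.
have [|u' [e' h1 h2]] := exec_ren fI e (u := u).
  by move=> [|r]; rewrite ?h0 ?hS // /st /= nth_nil.
exists t => //; suff -> : upd u (f 0) v = u' by [].
apply: functional_extensionality => r; have [[q ->]|hr] := dec r; last first.
  by rewrite h2 // upd_neq //; apply/eqP/hr.
rewrite h1 /upd (inj_eq fI); case: q => [|q] //=.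
by rewrite hS /st /= nth_nil.
Qed.

Lemma execs_even c w v T l : execs c (st [:: w]) (st [:: v]) T ->
  execs (ren double c) (st [:: w; l]) (st [:: v; l]) T.
Proof.
move=> h; have := @execs_sub double c w v T (st [:: w; l]) double_inj _ h erefl.
rewrite double0 upd_st /=; apply=> [r|q]; last by rewrite /st /= ?nth_nil.
case hr: (odd r); [right=> q hq|left; exists r./2; lia].
by rewrite hq odd_double in hr.
Qed.

Lemma execs_odd c w v T l : execs c (st [:: w]) (st [:: v]) T ->
  execs (ren (fun r => r.*2.+1) c) (st [:: l; w]) (st [:: l; v]) T.
Proof.
move=> h; have := @execs_sub (fun r => r.*2.+1) c w v T (st [:: l; w]) _ _ h erefl.
rewrite upd_st /=; apply=> [r q|r|q]; [lia| |by rewrite /st /= ?nth_nil].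
case hr: (odd r); [left; exists r./2; lia|right=> q hq].
by rewrite hq /= odd_double in hr.
Qed.

Lemma execs_exec c s s' t : exec c s s' t -> execs c s s' t.
Proof. by exists t. Qed.

(** * Pairing and unpairing *)

Definition dup : cmd :=
  Loop 2 (Seq (Push 0 false) (Push 1 false)) (Seq (Push 0 true) (Push 1 true)).

Lemma exec_dup a b w :
  exec dup (st [:: a; b; w]) (st [:: rev w ++ a; rev w ++ b; [::]]) (3 * size w).+1.
Proof.
elim: w a b => [|x w IH] a b; first exact: ELoop0.
rewrite rev_cons !cat_rcons.
have -> : (3 * size (x :: w)).+1 = (2 + (3 * size w).+1).+1 by rewrite /=; lia.
apply: (@ELoopb _ _ _ x w _ (st [:: x :: a; x :: b; w])) => //.
have -> : (if x then Seq (Push 0 true) (Push 1 true)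
  else Seq (Push 0 false) (Push 1 false)) = Seq (Push 0 x) (Push 1 x) by case: (x).
rewrite upd_st /= -[2]/(1 + 1); apply: (@ESeq _ _ _ (st [:: x :: a; b; w])).
  by move: (EPush 0 x (st [:: a; b; w])); rewrite upd_st.
by move: (EPush 1 x (st [:: x :: a; b; w])); rewrite upd_st.
Qed.

Definition pairup : cmd :=
  Seq (mov 0 2) (Seq (Push 1 false) (Seq (movw 2 1 (fun b => [:: true; b]))
    (Seq (mov 1 2) (mov 2 0)))).

Lemma size_pair_code x y : size (pair_code x y) = (2 * size x + size y).+1.
Proof.
rewrite /pair_code /self_delim !size_cat /= addnAC addn1; congr (_ + _).+1.
by elim: x => //= b z ->; lia.
Qed.

Lemma execs_pairup x y :
  execs pairup (st [:: x; y]) (st [:: pair_code x y]) (20 * (size x + size y).+1).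
Proof.
set pc := pair_code x y.
have spc : size pc = (2 * size x + size y).+1 by exact: size_pair_code.
have e1 := @exec_mov 0 2 (st [:: x; y]) isT; rewrite !upd_st /= cats0 in e1.
have e2 := EPush 1 false (st [:: [::]; y; rev x]); rewrite !upd_st /= in e2.
have e3 := @exec_movw 2 1 (fun b => [:: true; b]) 2 (st [:: [::]; false :: y; rev x])
  isT (fun=> leqnn 2).
rewrite !upd_st /= size_rev revK in e3.
rewrite [_ ++ _](_ : _ = pc) in e3; last by rewrite /pc /pair_code /self_delim -catA.
have e4 := @exec_mov 1 2 (st [:: [::]; pc; [::]]) isT; rewrite !upd_st /= cats0 in e4.
have e5 := @exec_mov 2 0 (st [:: [::]; [::]; rev pc]) isT.
rewrite !upd_st /= cats0 revK size_rev (st_nil [:: pc] 2) in e5.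
apply: execs_le (execs_seq e1 (execs_seq (execs_exec e2)
  (execs_seq e3 (execs_seq e4 e5)))).
rewrite /= spc; lia.
Qed.

Definition unpairloop : cmd :=
  Loop 1 Skip (Case 0 Skip Skip
    (Case 0 Skip (Seq (Push 2 false) (Push 1 true)) (Seq (Push 2 true) (Push 1 true)))).

(** Total: it returns something on malformed words too, and [unpairloop] computes the same there.
    The reduction relies on this, since the inputs of a circuit may be arbitrary bits. *)
Fixpoint unpair (w : bits) : bits * bits :=
  match w with
  | [:: true, b & w'] => let p := unpair w' in (b :: p.1, p.2)
  | _ :: w' => ([::], w')
  | [::] => ([::], [::])
  end.

Lemma unpairK x y : unpair (pair_code x y) = (x, y).
Proof.
rewrite /pair_code /self_delim -catA /=.
by elim: x => //= b x IH; rewrite IH; case: b.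
Qed.

Lemma execs_unpairloop w acc :
  execs unpairloop (st [:: w; [:: true]; acc])
    (st [:: (unpair w).2; [::]; rev (unpair w).1 ++ acc]) (6 * (size w).+1).
Proof.
have [n] := ubnP (size w); elim: n w acc => // n IH w acc hn.
have stop k v : k <= 3 -> exec (Case 0 Skip Skip (Case 0 Skip
    (Seq (Push 2 false) (Push 1 true)) (Seq (Push 2 true) (Push 1 true))))
    (st [:: w; [::]; acc]) (st [:: v; [::]; acc]) k ->
    execs unpairloop (st [:: w; [:: true]; acc]) (st [:: v; [::]; acc])
      (6 * (size w).+1).
  move=> hk e; exists (k + 1).+1; first lia.
  apply: (@ELoopb _ _ _ true [::]) => //; first by rewrite upd_st; exact: e.
  exact: ELoop0.
case: w hn stop => [|[] [|b w]] hn stop.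
- by apply: (stop 1) => //; apply: ECase0 => //; constructor.
- apply: (stop 2) => //; apply: (@ECaseb _ _ _ _ true [::]) => //.
  by rewrite upd_st; apply: ECase0 => //; constructor.
- rewrite [unpair _]/= /= rev_cons cat_rcons.
  have [|t ht e] := IH w (b :: acc); first by move: hn => /=; lia.
  exists (4 + t).+1; first by move: ht => /=; lia.
  apply: (@ELoopb _ _ _ true [::] _ (st [:: w; [:: true]; b :: acc])) => //.
  rewrite upd_st /=; apply: (@ECaseb _ _ _ _ true (b :: w)) => //.
  rewrite upd_st /=; apply: (@ECaseb _ _ _ _ b w) => //.
  rewrite upd_st /=.
  have -> : (if b then Seq (Push 2 true) (Push 1 true)
    else Seq (Push 2 false) (Push 1 true)) = Seq (Push 2 b) (Push 1 true) by case: (b).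
  rewrite -[2]/(1 + 1); apply: (@ESeq _ _ _ (st [:: w; [::]; b :: acc])).
    by move: (EPush 2 b (st [:: w; [::]; acc])); rewrite upd_st.
  by move: (EPush 1 true (st [:: w; [::]; b :: acc])); rewrite upd_st.
- by apply: (stop 1) => //; apply: (@ECaseb _ _ _ _ false [::]) => //; rewrite upd_st; constructor.
- by apply: (stop 1) => //; apply: (@ECaseb _ _ _ _ false (b :: w)) => //; rewrite upd_st; constructor.
Qed.

Lemma size_unpair w : size (unpair w).1 + size (unpair w).2 <= size w.
Proof.
have [n] := ubnP (size w); elim: n w => // n IH [|[] [|b w]] //= hn.
by have := IH w; lia.
Qed.

Section Closure.
Context {A B : Type} {eA : Enc A} {eB : Enc B}.

Lemma FP_cmd (f : A -> B) (c : cmd) (t : nat -> nat) : polyb t ->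
  (forall a, execs c (st [:: code a]) (st [:: code (f a)]) (t (size (code a)))) -> FP f.
Proof. by move=> [k hk] h; exists c, k => a; apply: execs_le (h a). Qed.

Lemma FP_cmd0 (f : A -> B) (c : cmd) (t : nat -> nat) : polyb t ->
  (forall a, exists2 u, execs c (st [:: code a]) u (t (size (code a))) &
    u 0 = code (f a)) -> FP f.
Proof.
move=> ht h.
apply: (@FP_cmd _ (Seq c (clears (nreg c))) (fun n => t n + nreg c * (n + t n).+1)).
  by polyb_tac.
by move=> a; have [u e <-] := h a; apply: execs_clean.
Qed.

Lemma FP_recode (f : A -> B) : (forall a, code (f a) = code a) -> FP f.
Proof.
move=> h; apply: (@FP_cmd _ Skip (fun=> 0)); first by polyb_tac.
by move=> a; rewrite h; exists 0 => //; constructor.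
Qed.

Lemma FP_ext (f g : A -> B) : f =1 g -> FP f -> FP g.
Proof. by move=> e [c [k h]]; exists c, k => a; rewrite -e. Qed.

Lemma FP_size (f : A -> B) : FP f ->
  exists k, forall a, size (code (f a)) <= pb k (size (code a)).
Proof.
move=> [c [k h]]; have [k' hk'] : polyb (fun n => n + pb k n) by polyb_tac.
exists k' => a; have [t ht e] := h a.
apply: leq_trans (exec_size 0 e) (leq_trans _ (hk' _)).
by rewrite leq_add2l.
Qed.

End Closure.

Lemma FP_comp `{eA : Enc A, eB : Enc B, eC : Enc C} (f : A -> B) (g : B -> C) : FP f -> FP g -> FP (fun a => g (f a)).
Proof.
move=> hf [c2 [k2 h2]]; have [ks hs] := FP_size hf; have [c1 [k1 h1]] := hf.
apply: (@FP_cmd _ _ _ _ _ (Seq c1 c2) (fun n => pb k1 n + pb k2 (pb ks n))).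
  by polyb_tac.
move=> a; apply: execs_seq (h1 a) (execs_le _ (h2 _)).
exact: pb_mono.
Qed.

(** The input is copied into registers 0 and 1; then the two programs run without interference, one
    renamed to the even and the other to the odd registers. *)
Lemma FP_pair `{eA : Enc A, eB : Enc B, eC : Enc C} (f : A -> B) (g : A -> C) : FP f -> FP g -> FP (fun a => (f a, g a)).
Proof.
move=> hf hg; have [kf sf] := FP_size hf; have [kg sg] := FP_size hg.
have [c1 [k1 h1]] := hf; have [c2 [k2 h2]] := hg.
apply: (@FP_cmd _ _ _ _ _ (Seq (mov 0 2) (Seq dup (Seq (ren double c1)
   (Seq (ren (fun r => r.*2.+1) c2) pairup))))
   (fun n => (2 * n).+1 + ((3 * n).+1 + (pb k1 n + (pb k2 n +
      20 * (pb kf n + pb kg n).+1))))); first by polyb_tac.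
move=> a; set w := code a; set n := size _.
have e1 := @exec_mov 0 2 (st [:: w]) isT.
rewrite !upd_st /= cats0 in e1.
have e2 := exec_dup [::] [::] (rev w).
rewrite revK !cats0 size_rev (st_nil [:: w; w] 1) in e2.
apply: execs_seq e1 (execs_seq (execs_exec e2) _).
apply: execs_seq (execs_even _ (h1 a)) (execs_seq (execs_odd _ (h2 a)) _).
apply: execs_le (execs_pairup _ _); rewrite leq_mul2l ltnS leq_add //.
Qed.

Lemma FP_const `{eA : Enc A, eB : Enc B} (b : B) : FP (fun _ : A => b).
Proof.
apply: (@FP_cmd _ _ _ _ _ (Seq (clear 0) (pushw 0 (code b))) (fun n => n.+1 + size (code b))).
  by polyb_tac.
move=> a; set w := code a; set v := code b.
have e1 := exec_clear 0 (st [:: w]); rewrite upd_st /= in e1.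
apply: execs_seq (execs_exec e1) _.
have e2 := exec_pushw 0 v (st [:: [::]]); rewrite upd_st /= cats0 in e2.
exact: execs_exec e2.
Qed.

Lemma FP_if `{eA : Enc A, eB : Enc B} (b : A -> bool) (f g : A -> B) : FP b -> FP f -> FP g ->
  FP (fun a => if b a then f a else g a).
Proof.
move=> hb [c1 [k1 h1]] [c2 [k2 h2]].
have hba : FP (fun a => (b a, a)).
  by apply: FP_pair => //; apply: FP_recode.
have [k3 h3] : polyb (fun n => 3 + (pb k1 n + pb k2 n)) by polyb_tac.
have hs : FP (fun p : bool * A => if p.1 then f p.2 else g p.2).
  (* The code of [(x, a)] starts with [true], [x], [false]; three pops expose the code of [a] and
     branch on [x] on the way. *)
  exists (Case 0 Skip Skip (Case 0 Skip (Case 0 Skip c2 c2) (Case 0 Skip c1 c1))), k3.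
  move=> [x a]; set w := code (x, a); have -> : w = [:: true, x, false & code a] by [].
  have [t ht e] : execs (if x then c1 else c2) (st [:: code a])
      (st [:: code (if x then f a else g a)]) (pb k1 (size (code a)) + pb k2 (size (code a))).
    by case: (x); [apply: execs_le (h1 a); rewrite leq_addr
                  |apply: execs_le (h2 a); rewrite leq_addl].
  exists (3 + t).
    apply: leq_trans (h3 _); rewrite leq_add2l; apply: leq_trans ht _.
    by rewrite leq_add // pb_mono //= ltnW // ltnW // ltnW.
  apply: (@ECaseb _ _ _ _ true [:: x, false & code a]) => //; rewrite upd_st /=.
  apply: (@ECaseb _ _ _ _ x (false :: code a)) => //; rewrite upd_st /=.
  by case: x w e => w e; apply: (@ECaseb _ _ _ _ false (code a)) => //; rewrite upd_st.
exact: FP_comp hba hs.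
Qed.

Lemma FP_id {A : Type} {eA : Enc A} : FP (fun a : A => a).
Proof. exact: FP_recode. Qed.

Lemma FP_unpair1 : FP (fun w : bits => (unpair w).1).
Proof.
apply: (@FP_cmd0 _ _ _ _ _ (Seq (Push 1 true) (Seq unpairloop (Seq (clear 0) (mov 2 0))))
  (fun n => 1 + (6 * n.+1 + (n.+1 + (2 * n).+1)))); first by polyb_tac.
move=> w; rewrite /code /Enc_bits; have hw := size_unpair w.
have e0 := EPush 1 true (st [:: w]); rewrite upd_st /= in e0.
have e1 := execs_unpairloop w [::]; rewrite cats0 in e1.
have e2 := exec_clear 0 (st [:: (unpair w).2; [::]; rev (unpair w).1]).
rewrite upd_st /= in e2.
have e3 := @exec_mov 2 0 (st [:: [::]; [::]; rev (unpair w).1]) isT.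
rewrite !upd_st /= revK size_rev cats0 in e3.
eexists.
  apply: execs_seq (execs_exec e0) _.
  rewrite (_ : st [:: w; [:: true]] = st [:: w; [:: true]; [::]]); last first.
    by rewrite (st_nil [:: w; [:: true]] 1).
  apply: execs_seq e1 (execs_seq (ex_intro2 _ _ _ _ e2) (execs_le _ e3)); lia.
by [].
Qed.

Lemma FP_unpair2 : FP (fun w : bits => (unpair w).2).
Proof.
apply: (@FP_cmd0 _ _ _ _ _ (Seq (Push 1 true) unpairloop)
  (fun n => 1 + (6 * n.+1))); first by polyb_tac.
move=> w; rewrite /code /Enc_bits.
have e0 := EPush 1 true (st [:: w]); rewrite upd_st /= in e0.
have e1 := execs_unpairloop w [::]; rewrite cats0 in e1.
eexists.
  apply: execs_seq (execs_exec e0) _.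
  rewrite (_ : st [:: w; [:: true]] = st [:: w; [:: true]; [::]]); last first.
    by rewrite (st_nil [:: w; [:: true]] 1).
  exact: e1.
by [].
Qed.

Lemma FP_unpair : FP unpair.
Proof.
apply: FP_ext (FP_pair FP_unpair1 FP_unpair2) => w.
by case: (unpair w).
Qed.

(** Programs see only codes, so a program for words serves every typed function with the same effect
    on codes. *)
Lemma FP_via {A B C D} {eA : Enc A} {eB : Enc B} {eC : Enc C} {eD : Enc D}
    (f : A -> B) (F : C -> D) (i : A -> C) :
  FP F -> (forall a, code (i a) = code a) -> (forall a, code (F (i a)) = code (f a)) ->
  FP f.
Proof.
by move=> [c [k h]] hi hF; exists c, k => a; have := h (i a); rewrite hF hi.
Qed.

Section Projections.
Context {A B C : Type} {eA : Enc A} {eB : Enc B} {eC : Enc C}.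

Lemma FP_fst (f : A -> B * C) : FP f -> FP (fun a => (f a).1).
Proof.
move=> hf; apply: FP_comp hf (_ : FP (fun p : B * C => p.1)).
apply: (FP_via (i := fun p => code p) FP_unpair1) => // p.
by rewrite /code /= unpairK.
Qed.

Lemma FP_snd (f : A -> B * C) : FP f -> FP (fun a => (f a).2).
Proof.
move=> hf; apply: FP_comp hf (_ : FP (fun p : B * C => p.2)).
apply: (FP_via (i := fun p => code p) FP_unpair2) => // p.
by rewrite /code /= unpairK.
Qed.

(** A nonempty list and the pair of its head and tail have the same code, so nothing remains to be
    computed after pairing. For the same reason [head] and [behead] below are the two projections of
    [unpair]. *)
Lemma FP_cons (f : A -> B) (g : A -> seq B) : FP f -> FP g ->
  FP (fun a => f a :: g a).
Proof.
by move=> hf hg; apply: FP_comp (FP_pair hf hg) (FP_recode (f := fun p => p.1 :: p.2) _).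
Qed.

Lemma FP_consb (f : A -> bool) (g : A -> bits) : FP f -> FP g ->
  FP (fun a => f a :: g a).
Proof.
move=> hf hg.
have h b : FP (fun l : bits => b :: l).
  apply: (@FP_cmd _ _ _ _ _ (Push 0 b) (fun=> 1)); first by polyb_tac.
  move=> w; exists 1 => //.
  by move: (EPush 0 b (st [:: w])); rewrite upd_st.
apply: (@FP_ext _ _ _ _ (fun a => if f a then true :: g a else false :: g a)).
  by move=> a; case: (f a).
by apply: FP_if => //; apply: FP_comp hg (h _).
Qed.

Lemma FP_beheadb (f : A -> bits) : FP f -> FP (fun a => behead (f a)).
Proof.
move=> hf; apply: FP_comp hf (_ : FP (fun w : bits => behead w)).
apply: (@FP_cmd _ _ _ _ _ (Case 0 Skip Skip Skip) (fun=> 1)); first by polyb_tac.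
move=> [|b w]; exists 1 => //; first by apply: ECase0 => //; constructor.
apply: (@ECaseb _ _ _ _ b w) => //; rewrite upd_st /=.
by case: b; constructor.
Qed.

Lemma FP_nilpb0 : FP (fun w : bits => nilp w).
Proof.
pose c b := Seq (clear 0) (Push 0 b).
apply: (@FP_cmd _ _ _ _ _ (Case 0 (c true) (c false) (c false)) (fun n => (n.+1 + 1).+1)).
  by polyb_tac.
have h b (w : bits) : execs (c b) (st [:: w]) (st [:: [:: b]]) ((size w).+1 + 1).
  have e1 := exec_clear 0 (st [:: w]); rewrite upd_st /= in e1.
  have e2 := EPush 0 b (st [:: [::]]); rewrite upd_st /= in e2.
  by apply: execs_seq (execs_exec e1) (execs_exec e2).
move=> [|b w].
  by have [t ht e] := h true [::]; exists t.+1 => //; apply: ECase0.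
have [t ht e] := h false w; exists t.+1; first exact: leqW.
by apply: (@ECaseb _ _ _ _ b w) => //; rewrite upd_st /=; case: (b).
Qed.

Lemma FP_nilpb (f : A -> bits) : FP f -> FP (fun a => nilp (f a)).
Proof. by move=> hf; apply: FP_comp hf FP_nilpb0. Qed.

Lemma FP_headb (f : A -> bits) : FP f -> FP (fun a => head false (f a)).
Proof.
move=> hf; apply: FP_comp hf (_ : FP (fun w : bits => head false w)).
pose c b := Seq (clear 0) (Push 0 b).
apply: (@FP_cmd _ _ _ _ _ (Case 0 (c false) (c false) (c true)) (fun n => (n.+1 + 1).+1)).
  by polyb_tac.
have h b (w : bits) : execs (c b) (st [:: w]) (st [:: [:: b]]) ((size w).+1 + 1).
  have e1 := exec_clear 0 (st [:: w]); rewrite upd_st /= in e1.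
  have e2 := EPush 0 b (st [:: [::]]); rewrite upd_st /= in e2.
  by apply: execs_seq (execs_exec e1) (execs_exec e2).
move=> [|b w].
  by have [t ht e] := h false [::]; exists t.+1 => //; apply: ECase0.
have [t ht e] := h b w; exists t.+1; first exact: leqW.
by apply: (@ECaseb _ _ _ _ b w) => //; rewrite upd_st /=; case: (b) e.
Qed.

Lemma FP_nilp (f : A -> seq B) : FP f -> FP (fun a => nilp (f a)).
Proof.
move=> hf; apply: FP_comp hf (_ : FP (fun l : seq B => nilp l)).
apply: (FP_via (i := fun p => code p) FP_nilpb0) => // p.
by case: p => //= x l; rewrite /code /Enc_seq /= /seq_code /=; case: (code x).
Qed.

Lemma FP_head (d : B) (f : A -> seq B) : FP f -> FP (fun a => head d (f a)).
Proof.
move=> hf; apply: FP_comp hf (_ : FP (fun l : seq B => head d l)).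
pose F w := if nilp w then @code B eB d else (unpair w).1.
have hF : FP F by apply: FP_if FP_nilpb0 (FP_const _) FP_unpair1.
apply: (FP_via (i := fun p => code p) hF) => // p.
case: p => [|x l] //; rewrite /F.
have -> : code (x :: l) = pair_code (code x) (code l) by [].
by rewrite unpairK /nilp size_pair_code.
Qed.

Lemma FP_behead (f : A -> seq B) : FP f -> FP (fun a => behead (f a)).
Proof.
move=> hf; apply: FP_comp hf (_ : FP (fun l : seq B => behead l)).
apply: (FP_via (i := fun p => code p) FP_unpair2) => // p.
case: p => [|x l] //.
have -> : code (x :: l) = pair_code (code x) (code l) by [].
by rewrite unpairK.
Qed.

End Projections.

(** * Bounded iteration *)

(** The state stays in the even registers, and the word [w] in register 1 serves as the loop
    counter. All intermediate values must be assumed small: iterating a polynomial-time function can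
    otherwise grow exponentially. *)
Lemma FP_iter_aux {B} {eB : Enc B} (s : B -> B) k : FP s ->
  exists c k', forall (w : bits) b,
    (forall i, i <= size w -> size (code (iter i s b)) <= pb k (size (code (w, b)))) ->
    execs c (st [:: code (w, b)]) (st [:: code (iter (size w) s b)])
      (pb k' (size (code (w, b)))).
Proof.
move=> [c [j h]].
pose lp := Loop 1 (ren double c) (ren double c).
have [k' hk'] : polyb (fun n => 1 + (6 * n.+1 + ((2 * n).+1 + (n * (pb j (pb k n)).+1).+1))).
  by polyb_tac.
exists (Seq (Push 1 true) (Seq unpairloop (Seq (mov 2 1) lp))), k' => w b hs.
set n := size (code (w, b)) in hs *; apply: execs_le (hk' _) _.
have hw : size w <= n by rewrite /n /code /= size_pair_code /code /Enc_bits /=; lia.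
set x := code (w, b).
have e0 := EPush 1 true (st [:: x]); rewrite upd_st /= in e0.
have e1 := execs_unpairloop x [::].
rewrite cats0 (_ : unpair x = (w, code b)) ?unpairK //= in e1.
set y := code b in e1.
have e2 := @exec_mov 2 1 (st [:: y; [::]; rev w]) isT.
rewrite !upd_st /= revK size_rev cats0 (st_nil [:: y; w] 1) in e2.
apply: execs_seq (execs_exec e0) _.
rewrite (_ : st [:: x; [:: true]] = st [:: x; [:: true]; [::]]);
  last by rewrite (st_nil [:: x; [:: true]] 1).
apply: execs_seq e1 (execs_seq (execs_le _ e2) _); first by rewrite ltnS leq_mul2l.
have : forall v b', (forall i, i <= size v -> size (code (iter i s b')) <= pb k n) ->
    execs lp (st [:: code b'; v]) (st [:: code (iter (size v) s b')])
      (size v * (pb j (pb k n)).+1).+1.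
  elim=> [|z v IH] b' hb.
    by exists 1 => //; rewrite (st_nil [:: code b'] 1); apply: ELoop0.
  have [|t ht e] := IH (s b').
    by move=> i hi; rewrite -iterSr; apply: hb.
  have [t1 ht1 e1'] := execs_even v (h b').
  exists (t1 + t).+1.
    rewrite [size (z :: v)]/= mulSn ltnS addSn -addnS leq_add //.
    by apply: leq_trans ht1 (pb_mono _ _); apply: (hb 0).
  rewrite [size (z :: v)]/= iterSr.
  apply: (@ELoopb _ _ _ z v _ _ _ _ _ _ _ e) => //; rewrite upd_st /=.
  by case: (z).
move/(_ w b hs); apply: execs_le; rewrite ltnS leq_mul2r hw orbT //.
Qed.

Lemma FP_iterb `{eA : Enc A, eB : Enc B} (w : A -> bits) (s : A -> B -> B) (b : A -> B) :
  FP w -> FP (fun p : A * B => s p.1 p.2) -> FP b ->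
  (exists k, forall a i, i <= size (w a) ->
     size (code (iter i (s a) (b a))) <= pb k (size (code a))) ->
  FP (fun a => iter (size (w a)) (s a) (b a)).
Proof.
move=> hw hs hb [k hk].
(* The parameter [a] is carried along in the state, as [FP_iter_aux] iterates a function without
   parameter. *)
pose s' (p : A * B) := (p.1, s p.1 p.2).
have its i a x : iter i s' (a, x) = (a, iter i (s a) x) by elim: i => //= i ->.
have hs' : FP s' by apply: FP_pair => //; apply: FP_fst FP_id.
have [k0 hk0] : polyb (fun n => (2 * n + pb k n).+1) by polyb_tac.
have [c [k1 hc]] := FP_iter_aux k0 hs'.
have hp : FP (fun a => (w a, (a, b a))) by apply: FP_pair => //; apply: FP_pair FP_id hb.
have [kp hkp] := FP_size hp; have [cp [k2 hcp]] := hp.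
have hi : FP (fun a => iter (size (w a)) s' (a, b a)).
  apply: (@FP_cmd _ _ _ _ _ (Seq cp c) (fun n => pb k2 n + pb k1 (pb kp n))).
    by polyb_tac.
  move=> a; apply: execs_seq (hcp a) (execs_le (pb_mono k1 (hkp a)) (hc _ _ _)).
  move=> i hi; rewrite its {1}/code /= size_pair_code /=.
  apply: (@leq_trans (pb k0 (size (code a)))).
    by apply: leq_trans (hk0 _); rewrite ltnS leq_add2l; apply: hk.
  apply: pb_mono; rewrite {2}/code /= size_pair_code {3}/code /= size_pair_code /=.
  by lia.
apply: FP_ext (FP_snd hi) => a.
by rewrite its.
Qed.

Lemma FP_iter `{eA : Enc A, eB : Enc B} (n : A -> nat) (s : A -> B -> B) (b : A -> B) :
  FP n -> FP (fun p : A * B => s p.1 p.2) -> FP b ->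
  (exists k, forall a i, i <= n a ->
     size (code (iter i (s a) (b a))) <= pb k (size (code a))) ->
  FP (fun a => iter (n a) (s a) (b a)).
Proof.
move=> hn hs hb [k hk].
apply: (@FP_ext _ _ _ _ (fun a => iter (size (nseq (n a) true)) (s a) (b a))).
  by move=> a; rewrite size_nseq.
apply: FP_iterb => //.
by exists k => a i; rewrite size_nseq; apply: hk.
Qed.

Class Dflt (A : Type) := dflt : A.
#[global] Instance Dflt_bool : Dflt bool := false.
#[global] Instance Dflt_nat : Dflt nat := 0.
#[global] Instance Dflt_prod A B {dA : Dflt A} {dB : Dflt B} : Dflt (A * B) := (dflt, dflt).
#[global] Instance Dflt_seq A : Dflt (seq A) := [::].

Section SeqCode.
Context {T : Type} {eT : Enc T}.
Implicit Types l : seq T.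

Lemma size_code_pair {U} {eU : Enc U} (p : T * U) :
  size (code p) = (2 * size (code p.1) + size (code p.2)).+1.
Proof. exact: size_pair_code. Qed.

Lemma size_code_cons x l :
  size (code (x :: l)) = (2 * size (code x) + size (code l)).+1.
Proof. exact: size_pair_code. Qed.

Lemma code_cat l1 l2 : code (l1 ++ l2) = code l1 ++ code l2.
Proof. by rewrite /code /Enc_seq /seq_code !map_cat flatten_cat. Qed.

Lemma size_code_catrev l1 l2 :
  size (code (catrev l1 l2)) = size (code l1) + size (code l2).
Proof. by elim: l1 l2 => //= x l IH l2; rewrite IH !size_code_cons; lia. Qed.

Lemma size_code_rev l : size (code (rev l)) = size (code l).
Proof. by rewrite size_code_catrev addn0. Qed.

Lemma size_le_code l : size l <= size (code l).
Proof. by elim: l => //= x l IH; rewrite size_code_cons; lia. Qed.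

Lemma size_code_take i l : size (code (take i l)) <= size (code l).
Proof. by rewrite -{2}(cat_take_drop i l) code_cat size_cat leq_addr. Qed.

Lemma size_code_drop i l : size (code (drop i l)) <= size (code l).
Proof. by rewrite -{2}(cat_take_drop i l) code_cat size_cat leq_addl. Qed.

End SeqCode.

Lemma size_code_map {T U} {eT : Enc T} {eU : Enc U} (g : T -> U) (l : seq T) m :
  (forall x, size (code x) <= size (code l) -> size (code (g x)) <= m) ->
  size (code (map g l)) <= size l * (2 * m).+1.
Proof.
elim: l => //= x l IH h; rewrite size_code_cons [X in _ <= X]mulSn addSn ltnS leq_add //.
  by rewrite leq_mul2l h // size_code_cons; lia.
by apply: IH => y hy; apply: h; rewrite size_code_cons; lia.
Qed.

Lemma FP_foldl `{eA : Enc A, eB : Enc B, eT : Enc C, dT : Dflt C}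
    (l : A -> seq C) (f : A -> B -> C -> B) (b : A -> B) :
  FP l -> FP (fun p : A * (B * C) => f p.1 p.2.1 p.2.2) -> FP b ->
  (exists k, forall a i,
     size (code (foldl (f a) (b a) (take i (l a)))) <= pb k (size (code a))) ->
  FP (fun a => foldl (f a) (b a) (l a)).
Proof.
move=> hl hf hb [k hk].
pose s a (q : seq C * B) :=
  if nilp q.1 then q else (behead q.1, f a q.2 (head (@dflt C dT) q.1)).
have its a i x y : iter i (s a) (x, y) = (drop i x, foldl (f a) y (take i x)).
  elim: i x y => [|i IH] x y; first by rewrite drop0 take0.
  rewrite iterSr {2}/s; case: x => [|c x] /=; first by rewrite IH.
  by rewrite IH.
have [kl hkl] := FP_size hl.
have hs : FP (fun p : A * (seq C * B) => s p.1 p.2).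
  have h2 : FP (fun p : A * (seq C * B) => p.2) by exact: FP_snd FP_id.
  apply: FP_if (FP_nilp (FP_fst h2)) (h2) _.
  apply: FP_pair (FP_behead (FP_fst h2)) _.
  have h : FP (fun p : A * (seq C * B) => (p.1, (p.2.2, head dflt p.2.1))).
    exact: FP_pair (FP_fst FP_id) (FP_pair (FP_snd h2) (FP_head _ (FP_fst h2))).
  exact: FP_comp h hf.
have hc : FP (fun a => code (l a)).
  exact: FP_comp hl (FP_recode (f := fun x => code x) _).
(* The code of the list serves as the counter. It is at least as long as the list, and the surplus
   rounds do nothing because [s] stops at the empty list. *)
apply: (@FP_ext _ _ _ _ (fun a => (iter (size (code (l a))) (s a) (l a, b a)).2)).
  by move=> a; rewrite its take_oversize // size_le_code.
apply/FP_snd/FP_iterb => //; first exact: FP_pair.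
have [k0 hk0] : polyb (fun n => (2 * pb kl n + pb k n).+1) by polyb_tac.
exists k0 => a i _; apply: leq_trans (hk0 _); rewrite its size_code_pair /=.
rewrite ltnS leq_add //; rewrite leq_mul2l /=.
exact: leq_trans (size_code_drop _ _) (hkl a).
Qed.

(** A word is its own code, unlike other lists, so the list operations below come in two
    versions. *)
Lemma FP_foldlb `{eA : Enc A, eB : Enc B} (l : A -> bits) (f : A -> B -> bool -> B)
    (b : A -> B) :
  FP l -> FP (fun p : A * (B * bool) => f p.1 p.2.1 p.2.2) -> FP b ->
  (exists k, forall a i,
     size (code (foldl (f a) (b a) (take i (l a)))) <= pb k (size (code a))) ->
  FP (fun a => foldl (f a) (b a) (l a)).
Proof.
move=> hl hf hb [k hk].
pose s a (q : bits * B) :=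
  if nilp q.1 then q else (behead q.1, f a q.2 (head false q.1)).
have its a i x y : iter i (s a) (x, y) = (drop i x, foldl (f a) y (take i x)).
  elim: i x y => [|i IH] x y; first by rewrite drop0 take0.
  rewrite iterSr {2}/s; case: x => [|c x] /=; first by rewrite IH.
  by rewrite IH.
have [kl hkl] := FP_size hl.
have hs : FP (fun p : A * (bits * B) => s p.1 p.2).
  have h2 : FP (fun p : A * (bits * B) => p.2) by exact: FP_snd FP_id.
  apply: FP_if (FP_nilpb (FP_fst h2)) (h2) _.
  apply: FP_pair (FP_beheadb (FP_fst h2)) _.
  have h : FP (fun p : A * (bits * B) => (p.1, (p.2.2, head false p.2.1))).
    exact: FP_pair (FP_fst FP_id) (FP_pair (FP_snd h2) (FP_headb (FP_fst h2))).
  exact: FP_comp h hf.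
apply: (@FP_ext _ _ _ _ (fun a => (iter (size (l a)) (s a) (l a, b a)).2)).
  by move=> a; rewrite its take_size.
apply/FP_snd/FP_iterb => //; first exact: FP_pair.
have [k0 hk0] : polyb (fun n => (2 * pb kl n + pb k n).+1) by polyb_tac.
exists k0 => a i _; apply: leq_trans (hk0 _); rewrite its size_code_pair /=.
rewrite ltnS leq_add //; rewrite leq_mul2l /= /code /Enc_bits size_drop.
exact: leq_trans (leq_subr _ _) (hkl a).
Qed.

(** * A library of polynomial-time functions *)

Ltac polyk e := 
  let K := fresh "K" in let hK := fresh "hK" in
  have [K hK] : polyb e by polyb_tac.

Lemma size_code_nat (n : nat) : size (code n) = n.
Proof. exact: size_nseq. Qed.

Lemma FP_comp2 `{eA : Enc A, eB : Enc B, eC : Enc C, eD : Enc D} (f : A -> B) (g : A -> C)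
    (h : B -> C -> D) :
  FP (fun p : B * C => h p.1 p.2) -> FP f -> FP g -> FP (fun a => h (f a) (g a)).
Proof. by move=> hh hf hg; apply: FP_comp (FP_pair hf hg) hh. Qed.

Lemma FP_negb `{eA : Enc A} (f : A -> bool) : FP f -> FP (fun a => ~~ f a).
Proof.
move=> hf; apply: FP_ext (FP_if hf (FP_const false) (FP_const true)) => a.
by case: (f a).
Qed.

Lemma FP_andb `{eA : Enc A} (f g : A -> bool) : FP f -> FP g -> FP (fun a => f a && g a).
Proof.
move=> hf hg; apply: FP_ext (FP_if hf hg (FP_const false)) => a.
by case: (f a).
Qed.

Lemma FP_orb `{eA : Enc A} (f g : A -> bool) : FP f -> FP g -> FP (fun a => f a || g a).
Proof.
move=> hf hg; apply: FP_ext (FP_if hf (FP_const true) hg) => a.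
by case: (f a).
Qed.

Lemma FP_eqb `{eA : Enc A} (f g : A -> bool) : FP f -> FP g -> FP (fun a => f a == g a).
Proof.
move=> hf hg; apply: FP_ext (FP_if hf hg (FP_negb hg)) => a.
by case: (f a); case: (g a).
Qed.

Lemma FP_sizeb `{eA : Enc A} (f : A -> bits) : FP f -> FP (fun a => size (f a)).
Proof.
move=> hf; have [k hk] := FP_size hf.
apply: (@FP_ext _ _ _ _ (fun a => iter (size (f a)) succn 0)).
  by move=> a; elim: (size _) => //= i ->.
apply: (FP_iterb (s := fun _ => succn)) (hf) _ (FP_const 0) _.
  apply: FP_comp (FP_snd FP_id) (_ : FP (fun n => n.+1)).
  exact: (FP_via (i := fun n => code n) (FP_consb (FP_const true) FP_id)).
exists k => a i hi; apply: leq_trans (hk a); apply: leq_trans hi.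
by rewrite (_ : iter i succn 0 = i) ?size_nseq //; elim: i => //= i ->.
Qed.

Lemma FP_nseqb `{eA : Enc A} (b : bool) (n : A -> nat) : FP n -> FP (fun a => nseq (n a) b).
Proof.
move=> hn; have [k hk] := FP_size hn.
apply: (@FP_ext _ _ _ _ (fun a => iter (n a) (cons b) [::])).
  by move=> a; rewrite /nseq /ncons.
apply: (FP_iter (s := fun _ => cons b)) (hn) _ (FP_const _) _.
  exact: FP_consb (FP_const b) (FP_snd FP_id).
exists k => a i hi; apply: leq_trans (hk a); rewrite {2}/code /Enc_nat size_nseq.
by rewrite -[iter _ _ _]/(nseq i b) /code /Enc_bits size_nseq.
Qed.

Lemma FP_S `{eA : Enc A} (n : A -> nat) : FP n -> FP (fun a => (n a).+1).
Proof.
move=> hn.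
apply: FP_ext (FP_sizeb (FP_consb (FP_const true) (FP_nseqb true hn))) => a.
by rewrite /= size_nseq.
Qed.

Lemma FP_pred `{eA : Enc A} (n : A -> nat) : FP n -> FP (fun a => (n a).-1).
Proof.
move=> hn; apply: FP_ext (FP_sizeb (FP_beheadb (FP_nseqb true hn))) => a.
by rewrite size_behead size_nseq.
Qed.

Lemma FP_addn `{eA : Enc A} (n m : A -> nat) : FP n -> FP m -> FP (fun a => n a + m a).
Proof.
move=> hn hm; have [k hk] := FP_size hn; have [k' hk'] := FP_size hm.
have hi i j : iter i succn j = i + j by elim: i => //= i ->.
apply: (@FP_ext _ _ _ _ (fun a => iter (n a) succn (m a))) => [a //|].
apply: (FP_iter (s := fun _ => succn)) (hn) _ (hm) _.
  exact: FP_S (FP_snd FP_id).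
polyk (fun n => pb k n + pb k' n); exists K => a i hi'; apply: leq_trans (hK _).
rewrite hi {1}/code /Enc_nat size_nseq; move: (hk a) (hk' a).
rewrite {1 3}/code /Enc_nat !size_nseq; lia.
Qed.

Lemma FP_subn `{eA : Enc A} (n m : A -> nat) : FP n -> FP m -> FP (fun a => n a - m a).
Proof.
move=> hn hm; have [k hk] := FP_size hn.
have hi i j : iter i predn j = j - i by elim: i => //= [|i ->]; rewrite ?subn0 ?subnS.
apply: (@FP_ext _ _ _ _ (fun a => iter (m a) predn (n a))) => [a //|].
apply: (FP_iter (s := fun _ => predn)) (hm) _ (hn) _.
  exact: FP_pred (FP_snd FP_id).
exists k => a i _; apply: leq_trans (hk _); rewrite hi /code /Enc_nat !size_nseq.
exact: leq_subr.
Qed.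

Lemma FP_leq `{eA : Enc A} (n m : A -> nat) : FP n -> FP m -> FP (fun a => n a <= m a).
Proof.
move=> hn hm; apply: FP_ext (FP_nilpb (FP_nseqb true (FP_subn hn hm))) => a.
by rewrite /nilp size_nseq.
Qed.

Lemma FP_eqn `{eA : Enc A} (n m : A -> nat) : FP n -> FP m -> FP (fun a => n a == m a).
Proof.
move=> hn hm; apply: FP_ext (FP_andb (FP_leq hn hm) (FP_leq hm hn)) => a.
by rewrite eqn_leq.
Qed.

Lemma FP_muln `{eA : Enc A} (n m : A -> nat) : FP n -> FP m -> FP (fun a => n a * m a).
Proof.
move=> hn hm; have [k hk] := FP_size hn; have [k' hk'] := FP_size hm.
have hi i j : iter i (addn j) 0 = i * j by elim: i => //= i ->.
apply: (@FP_ext _ _ _ _ (fun a => iter (n a) (addn (m a)) 0)) => [a //|].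
apply: (FP_iter (s := fun a => addn (m a))) (hn) _ (FP_const _) _.
  exact: FP_addn (FP_comp (FP_fst FP_id) hm) (FP_snd FP_id).
polyk (fun n => pb k n * pb k' n); exists K => a i hi'; apply: leq_trans (hK _).
rewrite hi {1}/code /Enc_nat size_nseq; move: (hk a) (hk' a).
rewrite {1 3}/code /Enc_nat !size_nseq => h1 h2.
by rewrite leq_mul // (leq_trans hi').
Qed.

Lemma FP_expn `{eA : Enc A} (n : A -> nat) k : FP n -> FP (fun a => n a ^ k).
Proof.
move=> hn; elim: k => [|k IH]; first exact: FP_const.
by apply: FP_ext (FP_muln hn IH) => a; rewrite expnS.
Qed.

Lemma FP_maxn `{eA : Enc A} (n m : A -> nat) : FP n -> FP m ->
  FP (fun a => maxn (n a) (m a)).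
Proof.
move=> hn hm; apply: FP_ext (FP_addn hn (FP_subn hm hn)) => a.
by rewrite -maxnE.
Qed.

(** A left fold that pushes elements builds the list in reverse, so [catrev] is the primitive from
    which [rev] and [cat] are obtained. *)
Lemma FP_catrev `{eA : Enc A, eB : Enc B, dB : Dflt B} (l1 l2 : A -> seq B) :
  FP l1 -> FP l2 -> FP (fun a => catrev (l1 a) (l2 a)).
Proof.
move=> h1 h2; have [k1 hk1] := FP_size h1; have [k2 hk2] := FP_size h2.
have hc (s t : seq B) : foldl (fun acc x => x :: acc) t s = catrev s t.
  by elim: s t => //= x s IH t.
apply: (@FP_ext _ _ _ _ (fun a => foldl (fun acc x => x :: acc) (l2 a) (l1 a))) => [a //|].
apply: (FP_foldl (f := fun _ acc x => x :: acc)) (h1) _ (h2) _.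
  exact: FP_cons (FP_snd (FP_snd FP_id)) (FP_fst (FP_snd FP_id)).
polyk (fun n => pb k1 n + pb k2 n); exists K => a i; apply: leq_trans (hK _).
rewrite hc size_code_catrev leq_add //; exact: leq_trans (size_code_take _ _) (hk1 a).
Qed.

Lemma FP_rev `{eA : Enc A, eB : Enc B, dB : Dflt B} (l : A -> seq B) :
  FP l -> FP (fun a => rev (l a)).
Proof. by move=> h; apply: FP_catrev h (FP_const _). Qed.

Lemma FP_cat `{eA : Enc A, eB : Enc B, dB : Dflt B} (l1 l2 : A -> seq B) :
  FP l1 -> FP l2 -> FP (fun a => l1 a ++ l2 a).
Proof.
move=> h1 h2; apply: FP_ext (FP_catrev (FP_rev h1) h2) => a.
by rewrite catrevE revK.
Qed.

Lemma FP_catrevb `{eA : Enc A} (l1 l2 : A -> bits) :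
  FP l1 -> FP l2 -> FP (fun a => catrev (l1 a) (l2 a)).
Proof.
move=> h1 h2; have [k1 hk1] := FP_size h1; have [k2 hk2] := FP_size h2.
have hc (s t : bits) : foldl (fun acc x => x :: acc) t s = catrev s t.
  by elim: s t => //= x s IH t.
apply: (@FP_ext _ _ _ _ (fun a => foldl (fun acc x => x :: acc) (l2 a) (l1 a))) => [a //|].
apply: (FP_foldlb (f := fun _ acc x => x :: acc)) (h1) _ (h2) _.
  exact: FP_consb (FP_snd (FP_snd FP_id)) (FP_fst (FP_snd FP_id)).
polyk (fun n => pb k1 n + pb k2 n); exists K => a i; apply: leq_trans (hK _).
rewrite hc catrevE {1}/code /Enc_bits size_cat size_rev leq_add //.
  apply: leq_trans (hk1 a); rewrite /code /Enc_bits size_take_min; exact: geq_minr.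
exact: hk2.
Qed.

Lemma FP_revb `{eA : Enc A} (l : A -> bits) : FP l -> FP (fun a => rev (l a)).
Proof. by move=> h; apply: FP_catrevb h (FP_const _). Qed.

Lemma FP_catb `{eA : Enc A} (l1 l2 : A -> bits) :
  FP l1 -> FP l2 -> FP (fun a => l1 a ++ l2 a).
Proof.
move=> h1 h2; apply: FP_ext (FP_catrevb (FP_revb h1) h2) => a.
by rewrite catrevE revK.
Qed.

Lemma FP_map `{eA : Enc A, eB : Enc B, eC : Enc C, dB : Dflt B, dC : Dflt C}
    (l : A -> seq B) (g : A -> B -> C) :
  FP l -> FP (fun p : A * B => g p.1 p.2) -> FP (fun a => [seq g a x | x <- l a]).
Proof.
move=> hl hg; have [k hk] := FP_size hl; have [k' hk'] := FP_size hg.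
have hc a (s : seq B) t :
    foldl (fun acc x => g a x :: acc) t s = catrev [seq g a x | x <- s] t.
  by elim: s t => //= x s IH t.
apply: (@FP_ext _ _ _ _ (fun a => rev (foldl (fun acc x => g a x :: acc) [::] (l a)))).
  by move=> a; rewrite hc catrevE cats0 revK.
apply: FP_rev; apply: (FP_foldl (f := fun a acc x => g a x :: acc)) (hl) _ (FP_const _) _.
  apply: FP_cons (FP_fst (FP_snd FP_id)).
  by apply: FP_comp (FP_pair (FP_fst FP_id) (FP_snd (FP_snd FP_id))) hg.
polyk (fun n => pb k n * (2 * pb k' (2 * n + pb k n).+1).+1).
exists K => a i; apply: leq_trans (hK _); rewrite hc size_code_catrev addn0.
apply: leq_trans (@size_code_map _ _ _ _ (g a) _ (pb k' (2 * size (code a) + pb k (size (code a))).+1) _) _.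
  move=> x hx; apply: leq_trans (hk' (a, x)) (pb_mono _ _); rewrite size_code_pair /=.
  rewrite ltnS leq_add2l; apply: leq_trans hx (leq_trans (size_code_take _ _) (hk a)).
rewrite leq_mul2r; apply/orP; right.
exact: leq_trans (size_le_code _) (leq_trans (size_code_take _ _) (hk a)).
Qed.

Lemma FP_mapb `{eA : Enc A, eB : Enc B, dB : Dflt B} (l : A -> seq B) (g : A -> B -> bool) :
  FP l -> FP (fun p : A * B => g p.1 p.2) ->
  @FP A bits eA Enc_bits (fun a => [seq g a x | x <- l a]).
Proof.
move=> hl hg; have [k hk] := FP_size hl.
have hc a (s : seq B) t :
    foldl (fun acc x => g a x :: acc) t s = catrev [seq g a x | x <- s] t.
  by elim: s t => //= x s IH t.
apply: (@FP_ext _ _ _ _ (fun a => rev (foldl (fun acc x => g a x :: acc) [::] (l a)))).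
  by move=> a; rewrite hc catrevE cats0 revK.
apply: FP_revb; apply: (FP_foldl (f := fun a acc x => g a x :: acc)) (hl) _ (FP_const _) _.
  apply: FP_consb (FP_fst (FP_snd FP_id)).
  by apply: FP_comp (FP_pair (FP_fst FP_id) (FP_snd (FP_snd FP_id))) hg.
exists k => a i; apply: leq_trans (hk a).
rewrite hc catrevE cats0 {1}/code /Enc_bits size_rev size_map.
by apply: leq_trans (size_le_code _) (size_code_take _ _).
Qed.

Lemma FP_filter `{eA : Enc A, eB : Enc B, dB : Dflt B} (l : A -> seq B) (g : A -> B -> bool) :
  FP l -> FP (fun p : A * B => g p.1 p.2) -> FP (fun a => [seq x <- l a | g a x]).
Proof.
move=> hl hg; have [k hk] := FP_size hl.
have hc a (s : seq B) t : foldl (fun acc x => if g a x then x :: acc else acc) t s =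
    catrev [seq x <- s | g a x] t.
  by elim: s t => //= x s IH t; rewrite IH; case: (g a x).
apply: (@FP_ext _ _ _ _ (fun a =>
    rev (foldl (fun acc x => if g a x then x :: acc else acc) [::] (l a)))).
  by move=> a; rewrite hc catrevE cats0 revK.
apply: FP_rev; apply: (FP_foldl (f := fun a acc x => if g a x then x :: acc else acc))
  (hl) _ (FP_const _) _.
  apply: FP_if; last exact: FP_fst (FP_snd FP_id).
    by apply: FP_comp (FP_pair (FP_fst FP_id) (FP_snd (FP_snd FP_id))) hg.
  exact: FP_cons (FP_snd (FP_snd FP_id)) (FP_fst (FP_snd FP_id)).
exists k => a i; apply: leq_trans (hk a); rewrite hc size_code_catrev addn0.
apply: leq_trans (size_code_take i _).
elim: (take i (l a)) => //= x s IH; case: ifP => _; rewrite !size_code_cons; lia.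
Qed.

Lemma FP_has `{eA : Enc A, eB : Enc B, dB : Dflt B} (l : A -> seq B) (g : A -> B -> bool) :
  FP l -> FP (fun p : A * B => g p.1 p.2) -> FP (fun a => has (g a) (l a)).
Proof.
move=> hl hg; apply: FP_ext (FP_negb (FP_nilp (FP_filter hl hg))) => a.
by rewrite has_count -size_filter /nilp; case: (size _).
Qed.

Lemma FP_all `{eA : Enc A, eB : Enc B, dB : Dflt B} (l : A -> seq B) (g : A -> B -> bool) :
  FP l -> FP (fun p : A * B => g p.1 p.2) -> FP (fun a => all (g a) (l a)).
Proof.
move=> hl hg.
apply: FP_ext (FP_negb (FP_has (g := fun a x => ~~ g a x) hl (FP_negb hg))) => a.
by rewrite has_predC negbK.
Qed.

Lemma FP_flatten `{eA : Enc A, eB : Enc B, dB : Dflt B} (l : A -> seq (seq B)) :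
  FP l -> FP (fun a => flatten (l a)).
Proof.
move=> hl; have [k hk] := FP_size hl.
have hc (s : seq (seq B)) t : foldl (fun acc x => catrev x acc) t s =
    rev (flatten s) ++ t.
  by elim: s t => //= x s IH t; rewrite IH rev_cat -catA catrevE.
apply: (@FP_ext _ _ _ _ (fun a => rev (foldl (fun acc x => catrev x acc) [::] (l a)))).
  by move=> a; rewrite hc cats0 revK.
apply: FP_rev; apply: (FP_foldl (f := fun a acc x => catrev x acc)) (hl) _ (FP_const _) _.
  exact: FP_catrev (FP_snd (FP_snd FP_id)) (FP_fst (FP_snd FP_id)).
exists k => a i; apply: leq_trans (hk a); apply: leq_trans (size_code_take i _).
rewrite hc cats0 size_code_rev; elim: (take i (l a)) => //= x s IH.
by rewrite code_cat size_cat size_code_cons; lia.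
Qed.

Lemma FP_flattenb `{eA : Enc A} (l : A -> seq bits) :
  FP l -> FP (fun a => flatten (l a)).
Proof.
move=> hl; have [k hk] := FP_size hl.
have hc (s : seq bits) t : foldl (fun acc x => catrev x acc) t s =
    rev (flatten s) ++ t.
  by elim: s t => //= x s IH t; rewrite IH rev_cat -catA catrevE.
apply: (@FP_ext _ _ _ _ (fun a => rev (foldl (fun acc x => catrev x acc) [::] (l a)))).
  by move=> a; rewrite hc cats0 revK.
apply: FP_revb; apply: (FP_foldl (f := fun a acc x => catrev x acc)) (hl) _ (FP_const _) _.
  exact: FP_catrevb (FP_snd (FP_snd FP_id)) (FP_fst (FP_snd FP_id)).
exists k => a i; apply: leq_trans (hk a); apply: leq_trans (size_code_take i _).
rewrite hc cats0 {1}/code /Enc_bits size_rev; elim: (take i (l a)) => //= x s IH.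
by rewrite size_cat size_code_cons {1}/code /Enc_bits; lia.
Qed.

Lemma FP_dropb `{eA : Enc A} (n : A -> nat) (l : A -> bits) :
  FP n -> FP l -> FP (fun a => drop (n a) (l a)).
Proof.
move=> hn hl; have [k hk] := FP_size hl.
have hc i (s : bits) : iter i behead s = drop i s.
  by elim: i s => [|i IH] s; rewrite ?drop0 // iterSr IH; case: s.
apply: (@FP_ext _ _ _ _ (fun a => iter (n a) behead (l a))) => [a //|].
apply: (FP_iter (s := fun a => behead)) (hn) _ (hl) _.
  exact: FP_beheadb (FP_snd FP_id).
exists k => a i _; apply: leq_trans (hk a); rewrite hc /code /Enc_bits size_drop.
exact: leq_subr.
Qed.

Lemma FP_drop `{eA : Enc A, eB : Enc B} (n : A -> nat) (l : A -> seq B) :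
  FP n -> FP l -> FP (fun a => drop (n a) (l a)).
Proof.
move=> hn hl; have [k hk] := FP_size hl.
have hc i (s : seq B) : iter i behead s = drop i s.
  by elim: i s => [|i IH] s; rewrite ?drop0 // iterSr IH; case: s.
apply: (@FP_ext _ _ _ _ (fun a => iter (n a) behead (l a))) => [a //|].
apply: (FP_iter (s := fun a => behead)) (hn) _ (hl) _.
  exact: FP_behead (FP_snd FP_id).
exists k => a i _; apply: leq_trans (hk a); rewrite hc.
exact: size_code_drop.
Qed.

Lemma FP_nthb `{eA : Enc A} (n : A -> nat) (l : A -> bits) :
  FP l -> FP n -> FP (fun a => nth false (l a) (n a)).
Proof.
move=> hl hn; apply: FP_ext (FP_headb (FP_dropb hn hl)) => a.
by rewrite -nth0 nth_drop addn0.
Qed.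

Lemma FP_nth `{eA : Enc A, eB : Enc B} (d : B) (n : A -> nat) (l : A -> seq B) :
  FP l -> FP n -> FP (fun a => nth d (l a) (n a)).
Proof.
move=> hl hn; apply: FP_ext (FP_head d (FP_drop hn hl)) => a.
by rewrite -nth0 nth_drop addn0.
Qed.

Lemma FP_iota0 `{eA : Enc A} (n : A -> nat) : FP n -> FP (fun a => iota 0 (n a)).
Proof.
move=> hn; have [k hk] := FP_size hn.
have hc i : iter i (fun q : nat * seq nat => (q.1.+1, q.1 :: q.2)) (0, [::]) =
    (i, rev (iota 0 i)).
  elim: i => // i IH; rewrite iterS IH; congr (_, _).
  by rewrite -[i.+1]addn1 iotaD rev_cat.
apply: (@FP_ext _ _ _ _ (fun a => rev (iter (n a)
    (fun q : nat * seq nat => (q.1.+1, q.1 :: q.2)) (0, [::])).2)).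
  by move=> a; rewrite hc revK.
apply/FP_rev/FP_snd; apply: (FP_iter (s := fun a (q : nat * seq nat) =>
    (q.1.+1, q.1 :: q.2))) (hn) _ (FP_const _) _.
  have h1 : FP (fun p : A * (nat * seq nat) => p.2.1) by exact: FP_fst (FP_snd FP_id).
  exact: FP_pair (FP_S h1) (FP_cons h1 (FP_snd (FP_snd FP_id))).
polyk (fun n => (2 * pb k n + pb k n * (2 * pb k n).+1).+1).
exists K => a i hi; apply: leq_trans (hK _); rewrite hc size_code_pair /=.
have {}hi : i <= pb k (size (code a)).
  by apply: leq_trans (hk a); rewrite {1}/code /Enc_nat size_nseq.
rewrite size_code_rev ltnS leq_add //.
  by rewrite /code /Enc_nat size_nseq leq_mul2l.
apply: (@leq_trans (size (iota 0 i) * (2 * pb k (size (code a))).+1)); last first.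
  by rewrite size_iota leq_mul2r hi orbT.
have : all (fun j => j <= pb k (size (code a))) (iota 0 i).
  by apply/allP => j; rewrite mem_iota => /andP[_]; lia.
elim: (iota 0 i) => //= j s IH /andP[hj /IH]; rewrite size_code_cons.
by rewrite size_code_nat [X in _ < X]mulSn; lia.
Qed.

Lemma FP_size_seq `{eA : Enc A, eB : Enc B, dB : Dflt B} (l : A -> seq B) :
  FP l -> FP (fun a => size (l a)).
Proof.
move=> hl; have h : @FP A bits eA Enc_bits (fun a => [seq true | _ <- l a]).
  exact: FP_mapb (hl) (FP_const true).
by apply: FP_ext (FP_sizeb h) => a; rewrite size_map.
Qed.

Ltac fp1 :=
  first [ assumption | exact FP_id | simple apply FP_const
        | simple eapply FP_fst | simple eapply FP_snd | simple eapply FP_pair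
        | simple eapply FP_if | simple eapply FP_negb | simple eapply FP_andb
        | simple eapply FP_orb | simple eapply FP_eqb | simple eapply FP_eqn
        | simple eapply FP_leq | simple eapply FP_S | simple eapply FP_addn
        | simple eapply FP_subn | simple eapply FP_muln | simple eapply FP_expn
        | simple eapply FP_maxn | simple eapply FP_pred
        | simple eapply FP_sizeb | simple eapply FP_size_seq
        | simple eapply FP_nseqb | simple eapply FP_consb | simple eapply FP_cons
        | simple eapply FP_beheadb | simple eapply FP_behead
        | simple eapply FP_nilpb | simple eapply FP_nilp
        | simple eapply FP_revb | simple eapply FP_rev
        | simple eapply FP_catb | simple eapply FP_cat
        | simple eapply FP_mapb | simple eapply FP_map | simple eapply FP_filter
        | simple eapply FP_has | simple eapply FP_all
        | simple eapply FP_flattenb | simple eapply FP_flatten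
        | simple eapply FP_headb | simple eapply FP_dropb | simple eapply FP_drop
        | simple eapply FP_nthb | simple eapply FP_nth | simple eapply FP_iota0
        | simple eapply FP_head ].
Ltac fp := repeat fp1.

(** * The problem belongs to PLS *)

Fixpoint flipb (i : nat) (a : bits) : bits :=
  match a, i with
  | x :: a', 0 => ~~ x :: a'
  | x :: a', i'.+1 => x :: flipb i' a'
  | [::], _ => [::]
  end.

Lemma size_flipb i a : size (flipb i a) = size a.
Proof. by elim: a i => [|x a IH] [|i] //=; rewrite IH. Qed.

Lemma nth_flipb i a k : i < size a ->
  nth false (flipb i a) k = (nth false a k == (k != i)).
Proof.
elim: a i k => [|x a IH] [|i] [|k] //= hi; rewrite ?eqSS; do 1?[by case: x];
  do ?[by case: (nth _ _ _)].
by rewrite IH.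
Qed.

Lemma flipb_map i a :
  flipb i a = [seq (nth false a k == (k != i)) | k <- iota 0 (size a)].
Proof.
apply: (@eq_from_nth _ false); first by rewrite size_flipb size_map size_iota.
move=> k; rewrite size_flipb => hk.
rewrite (nth_map 0) ?size_iota // nth_iota // add0n.
have [hi|hi] := ltnP i (size a); first exact: nth_flipb.
have -> : k != i by rewrite neq_ltn (leq_trans hk hi).
suff -> : flipb i a = a by case: (nth _ _ _).
by elim: a i hi {k hk} => [|x a IH] [|i] //= hi; rewrite IH.
Qed.

Lemma hamming_flipb i a b : size a = size b -> hamming a (flipb i b) <= (hamming a b).+1.
Proof.
rewrite /hamming; elim: a b i => [|x a IH] [|y b] [|i] //= [hs].
  by case: x; case: y => /=; lia.
by move: (IH b i hs); lia.
Qed.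

Lemma hammingxx a : hamming a a = 0.
Proof. by rewrite /hamming; elim: a => //= x a ->; rewrite eqxx. Qed.

Lemma hamming_eq0 a b : size a = size b -> hamming a b = 0 -> a = b.
Proof.
rewrite /hamming; elim: a b => [|x a IH] [|y b] //= [/IH h].
by case: eqP => //= -> /h ->.
Qed.

(** If the words agree, the index found is [size a], where [flipb] changes nothing; hence the bound
    is not strict. *)
Lemma hamming_toward a b : size a = size b ->
  exists2 i, i <= size a & hamming (flipb i a) b = (hamming a b).-1.
Proof.
rewrite /hamming; elim: a b => [|x a IH] [|y b] //=; first by exists 0.
move=> [hs]; case: (eqVneq x y) => [->|xy].
  by have [i hi e] := IH b hs; exists i.+1 => //=; rewrite e eqxx.
by exists 0 => //=; case: x xy; case: y.
Qed.

(** The index [size a] is included: flipping there is void, which brings in words at distance less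
    than 2. *)
Definition neighbors2 (a : bits) : seq bits :=
  flatten [seq [seq flipb i (flipb j a) | i <- iota 0 (size a).+1]
          | j <- iota 0 (size a).+1].

Lemma mem_neighbors2 a b :
  b \in neighbors2 a <-> size b = size a /\ hamming a b <= 2.
Proof.
split=> [/flatten_mapP[j _ /mapP[i _ ->]]|[hs h2]].
  rewrite !size_flipb; split=> //.
  apply: leq_trans (hamming_flipb _ _) _; first by rewrite size_flipb.
  by rewrite ltnS -(hammingxx a) hamming_flipb.
have [j hj ej] := hamming_toward (esym hs).
have hs' : size (flipb j a) = size b by rewrite size_flipb.
have [i hi ei] := hamming_toward hs'.
apply/flatten_mapP; exists j; first by rewrite mem_iota ltnS.
apply/mapP; exists i; first by rewrite mem_iota ltnS -(size_flipb j).
apply/esym/hamming_eq0; first by rewrite size_flipb.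
by rewrite ei ej; lia.
Qed.

Lemma FP_neighbors2 : FP neighbors2.
Proof.
apply: (@FP_ext _ _ _ _ (fun a => flatten [seq [seq
   [seq (nth false [seq (nth false a k == (k != j)) | k <- iota 0 (size a)] k == (k != i))
     | k <- iota 0 (size a)] | i <- iota 0 (size a).+1] | j <- iota 0 (size a).+1])).
  move=> a; rewrite /neighbors2; congr flatten; apply: eq_map => j.
  by apply: eq_map => i; rewrite (flipb_map i) size_flipb flipb_map.
by fp.
Qed.

(** * Parsing of formulas by a fold of polynomial size *)

Lemma parse_encode F : parse 0 [::] (encode_cnf F) = Some F.
Proof.
have parseV n v C y : parse v C (nseq n.*2 false ++ y) = parse (n + v) C y.
  by elim: n v => [|n IHn] v //=; rewrite IHn addnS.
have parseC C C0 y : parse 0 C0 (encode_clause C ++ y) =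
    omap (cons (C0 ++ C)) (parse 0 [::] y).
  rewrite /encode_clause -catA.
  elim: C C0 => [|[v b] C IHC] C0 /=; first by rewrite cats0.
  rewrite -catA /encode_literal /= -catA parseV addn0.
  by case: b; rewrite /= IHC cat_rcons.
elim: F => [|C F IHF] //.
by rewrite /encode_cnf /= parseC -/(encode_cnf F) IHF.
Qed.

(** The converse of [parse_encode]: what has been consumed can be reconstructed from [C] and [v]. So
    the words that parse are exactly the codes, which makes instances recognizable. *)
Lemma parse_Some v C x F : parse v C x = Some F ->
  flatten (map encode_literal C) ++ nseq v.*2 false ++ x = encode_cnf F.
Proof.
have [n] := ubnP (size x); elim: n v C x F => // n IH v C [|b1 [|b2 y]] F hn.
- by case: v => //; case: C => //= -[<-].
- by case: (b1).
have {}hn : size y < n by move: hn => /=; lia.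
have nS : nseq v.+1.*2 false = nseq v.*2 false ++ [:: false; false].
  by rewrite doubleS -addn2 nseqD.
case: b1; case: b2 => /=.
- case: eqP => // ->; case e: (parse 0 [::] y) => [F'|] //= [<-].
  rewrite -[encode_cnf _]/(encode_clause C ++ encode_cnf F') -(IH _ _ _ _ hn e).
  by rewrite /encode_clause -catA.
- move/(IH _ _ _ _ hn) <-; rewrite map_rcons flatten_rcons /encode_literal /=.
  by rewrite -!catA.
- move/(IH _ _ _ _ hn) <-; rewrite map_rcons flatten_rcons /encode_literal /=.
  by rewrite -!catA.
- by move/(IH _ _ _ _ hn) <-; rewrite nS -!catA.
Qed.

(* The pending first bit of a token, the index being read, the current clause
   and the previous ones (both reversed), and whether no error occurred. *)
Definition pstate : Type := (bits * (nat * (clause * (cnf * bool))))%type.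

Definition pstep (s : pstate) (b : bool) : pstate :=
  let v := s.2.1 in let C := s.2.2.1 in let F := s.2.2.2.1 in let ok := s.2.2.2.2 in
  if nilp s.1 then ([:: b], s.2) else ([::],
  if head false s.1 then
    if b then (0, ([::], (rev C :: F, ok && (v == 0)))) else (0, ((v, false) :: C, (F, ok)))
  else if b then (0, ((v, true) :: C, (F, ok))) else (v.+1, (C, (F, ok)))).

Definition pinit : pstate := ([::], (0, ([::], ([::], true)))).

Definition pok (s : pstate) : bool :=
  [&& nilp s.1, s.2.1 == 0, nilp s.2.2.1 & s.2.2.2.2].

Lemma pok_false l s : ~~ s.2.2.2.2 -> pok (foldl pstep s l) = false.
Proof.
elim: l s => [|b l IH] s h /=; first by rewrite /pok (negbTE h) !andbF.
apply: IH; rewrite /pstep; case: (nilp _) => //=.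
by case: (head _ _); case: b; rewrite //= negb_and h.
Qed.

(** [parse] reads two bits at a time and builds its result after the recursive call; the fold does
    the same bit by bit with accumulators, a form to which closure under bounded iteration
    applies. *)
Lemma parse_foldl v C F x :
  let s := foldl pstep ([::], (v, (rev C, (F, true)))) x in
  omap (catrev F) (parse v C x) = if pok s then Some (rev s.2.2.2.1) else None.
Proof.
have [n] := ubnP (size x); elim: n v C F x => // n IH v C F [|b1 [|b2 y]] hn.
- rewrite /= /pok /= andbT -[nilp (rev C)]/(size _ == 0) size_rev.
  by case: ifP => //= _; rewrite catrevE cats0.
- by case: (b1).
have {}hn : size y < n by move: hn => /=; lia.
case: b1; case: b2 => /=.
- rewrite /pstep /= revK.
  case: eqP => hv; last by rewrite pok_false.
  have := IH 0 [::] (C :: F) y hn => /= <-.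
  by case: (parse 0 [::] y).
- by rewrite /pstep /= -rev_rcons; apply: IH.
- by rewrite /pstep /= -rev_rcons; apply: IH.
- by rewrite /pstep /=; apply: IH.
Qed.

Definition pfinal (x : bits) : pstate := foldl pstep pinit x.

Lemma parse_pfinal x :
  parse 0 [::] x = if pok (pfinal x) then Some (rev (pfinal x).2.2.2.1) else None.
Proof. by have := parse_foldl 0 [::] [::] x; case: (parse 0 [::] x). Qed.

Definition litweight (C : clause) : nat := sumn [seq l.1.+1 | l <- C].
Definition cnfweight (F : cnf) : nat := sumn [seq (litweight C).+1 | C <- F].

(** A literal takes [4 * v + 5] bits in a list, at most 5 times its weight [v.+1]. The next bound
    doubles this and adds one bit per clause. *)
Lemma size_code_clause (C : clause) : size (code C) <= 5 * litweight C.
Proof.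
elim: C => //= -[v b] C IH; rewrite size_code_cons size_code_pair /= size_code_nat.
rewrite -[litweight _]/(v.+1 + litweight C).
apply: (@leq_trans (2 * (2 * v + 1).+1 + 5 * litweight C).+1); last lia.
by rewrite ltnS leq_add2l.
Qed.

Lemma size_code_cnf (F : cnf) : size (code F) <= 11 * cnfweight F.
Proof.
elim: F => //= C F IH; rewrite size_code_cons /cnfweight /= -/(cnfweight F).
apply: (@leq_trans (2 * (5 * litweight C) + 11 * cnfweight F).+1); last lia.
by rewrite ltnS leq_add // leq_mul2l; apply: size_code_clause.
Qed.

(** A potential that each bit read increases by at most one, whichever token it completes; it keeps
    the parser state linear in the input. *)
Definition pweight (s : pstate) : nat :=
  s.2.1 + (litweight s.2.2.1 + cnfweight s.2.2.2.1).

Lemma pweight_step s b : pweight (pstep s b) <= (pweight s).+1.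
Proof.
rewrite /pweight /pstep; case: (nilp _) => /=; first lia.
case: (head _ _); case: b => /=; rewrite /cnfweight /litweight /=; try lia.
by rewrite map_rev sumn_rev; lia.
Qed.

Lemma size_pstate s : size s.1 <= 1 -> size (code s) <= 40 * (pweight s).+1.
Proof.
move=> h; rewrite !size_code_pair /= size_code_nat /pweight.
have h1 : size (code s.1) <= 1 by [].
have := size_code_clause s.2.2.1; have := size_code_cnf s.2.2.2.1.
move: h1.
move: (size (code s.1)) (size (code s.2.2.1)) (size (code s.2.2.2.1)) => a b c; lia.
Qed.

Lemma FP_pfinal : FP pfinal.
Proof.
apply: (FP_foldlb (f := fun _ => pstep)) FP_id _ (FP_const _) _.
  by rewrite /pstep /pstate /cnf /clause /literal; cbv zeta; fp.
have h x : pweight (foldl pstep pinit x) <= size x /\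
    size (foldl pstep pinit x).1 <= 1.
  elim/last_ind: x => [|x b [IH1 IH2]] //; rewrite foldl_rcons size_rcons; split.
    exact: leq_trans (pweight_step _ _) _.
  by rewrite /pstep; case: (nilp _).
polyk (fun n => 40 * n.+1); exists K => x i; apply: leq_trans (hK _).
have [h1 h2] := h (take i x); apply: leq_trans (size_pstate h2) _.
rewrite leq_mul2l ltnS (leq_trans h1) // size_take_min; exact: geq_minr.
Qed.

Definition decoded (x : bits) : cnf := if pok (pfinal x) then rev (pfinal x).2.2.2.1 else [::].

Lemma decodedE x : decode_cnf x = decoded x.
Proof. by rewrite /decode_cnf parse_pfinal /decoded; case: ifP. Qed.

Lemma FP_decode : FP decode_cnf.
Proof.
apply: (@FP_ext _ _ _ _ decoded) => [x|]; first by rewrite decodedE.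
have h := FP_pfinal; rewrite /decoded /pok.
apply: FP_comp h (_ : FP (fun s : pstate => if [&& nilp s.1, s.2.1 == 0, nilp s.2.2.1 &
  s.2.2.2.2] then rev s.2.2.2.1 else [::])).
by fp.
Qed.

Definition kcnf_instance (k : nat) (x : bits) : bool :=
  pok (pfinal x) && all (fun C : clause => size C <= k) (decoded x).

Lemma kcnf_instanceP k d x : kcnf_instance k x <-> instance (kSAT_dFLIP k d) x.
Proof.
rewrite /kcnf_instance /decoded; have := parse_pfinal x; case: (pok _) => /= h; split.
- by move=> /allP H; exists (rev (pfinal x).2.2.2.1) => //; rewrite -(parse_Some h).
- case=> F xF /allP; rewrite xF parse_encode in h.
  by rewrite xF; case: h => /esym ->.
- by [].
- by case=> F xF; rewrite xF parse_encode in h.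
Qed.

Lemma FP_kcnf_instance k : FP (kcnf_instance k).
Proof.
have h1 : FP decoded by apply: FP_ext FP_decode => x; rewrite decodedE.
have h2 : FP (fun x => pok (pfinal x)).
  apply: FP_comp FP_pfinal (_ : FP pok); rewrite /pok; fp.
by rewrite /kcnf_instance; fp.
Qed.

(** * Number of variables and payoff *)

Lemma nvars_foldl F :
  nvars F = foldl (fun n (l : literal) => maxn n l.1.+1) 0 (flatten F).
Proof.
rewrite /nvars; have : forall n (s : seq literal),
    maxn n (\max_(l <- s) l.1.+1) = foldl (fun n (l : literal) => maxn n l.1.+1) n s.
  move=> n s; elim: s n => [|l s IH] n /=; first by rewrite big_nil maxn0.
  by rewrite big_cons maxnA IH.
by move/(_ 0 (flatten F)); rewrite max0n.
Qed.

Lemma FP_nvars : FP nvars.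
Proof.
apply: (@FP_ext _ _ _ _ (fun F : cnf =>
  foldl (fun n (l : literal) => maxn n l.1.+1) 0 (flatten F))) => [F|].
  by rewrite nvars_foldl.
have hfl : FP (fun F : cnf => flatten F) by fp.
apply: (FP_foldl (f := fun (_ : cnf) n (l : literal) => maxn n l.1.+1)) (hfl) _ (FP_const 0) _.
  by fp.
have [k hk] := FP_size hfl; exists k => F i; apply: leq_trans (hk F).
rewrite size_code_nat; apply: leq_trans (size_code_take i _).
move: (take i (flatten F)) => s.
have : forall n, foldl (fun n (l : literal) => maxn n l.1.+1) n s <= maxn n (size (code s)).
  elim: s => [|l s IH] n /=; first by rewrite leq_max leqnn.
  apply: leq_trans (IH _) _; rewrite size_code_cons size_code_pair size_code_nat; lia.
by move/(_ 0); rewrite max0n.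
Qed.

Lemma FP_sat_clause `{eA : Enc A} (a : A -> bits) (C : A -> clause) :
  FP a -> FP C -> FP (fun x => sat_clause (a x) (C x)).
Proof. by move=> ha hC; rewrite /sat_clause; apply: FP_has => //; fp; apply: FP_comp ha; fp. Qed.

Lemma polytime_bool (f : bits -> bool) : FP f -> polytime (fun w => [:: f w]).
Proof. by move=> h; apply: polytime_FP; apply: FP_comp h (FP_recode (f := fun b => [:: b]) _). Qed.

Lemma nat_of_bits_rcons l b : nat_of_bits (rcons l b) = nat_of_bits l + b * 2 ^ size l.
Proof.
elim: l => [|c l IH] /=; first by rewrite muln1 addn0.
by rewrite IH expnS; lia.
Qed.

Lemma lex_payoff_cons C F a :
  lex_payoff (C :: F) a = sat_clause a C * 2 ^ size F + lex_payoff F a.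
Proof.
rewrite /lex_payoff big_mkcond [in RHS]big_mkcond big_ord_recl /= subn1 /=.
by congr (_ + _); case: ifP; rewrite ?mul1n.
Qed.

(** The clause weights are distinct powers of 2, so the satisfaction vector is the binary expansion;
    it is reversed because the last clause has weight 1. *)
Lemma lex_payoff_bits F a : lex_payoff F a = nat_of_bits (rev [seq sat_clause a C | C <- F]).
Proof.
elim: F => [|C F IH]; first by rewrite /lex_payoff big_ord0.
by rewrite lex_payoff_cons /= rev_cons nat_of_bits_rcons size_rev size_map IH addnC.
Qed.

Theorem kSAT_2FLIP_in_PLS k : in_PLS (kSAT_dFLIP k 2).
Proof.
have hx : FP (fun w : bits => decode_cnf (unpair w).1).
  exact: FP_comp (FP_fst FP_unpair) FP_decode.
have hs : FP (fun w : bits => (unpair w).2) by exact: FP_snd FP_unpair.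
have hn : FP (fun x => nvars (decode_cnf x)) by exact: FP_comp FP_decode FP_nvars.
have hnx : FP (fun w => nvars (decode_cnf (unpair w).1)) by exact: FP_comp (FP_fst FP_unpair) hn.
split.
- exists (fun x => [:: kcnf_instance k x]); first exact/polytime_bool/FP_kcnf_instance.
  by move=> x; rewrite -(kcnf_instanceP k 2); split=> [[]|->].
- have [j hj] := FP_size hn; have [c hc] := pb_mul2 j; exists c, j => x s _ /= ->.
  apply: (leq_trans _ (hc _)); apply: (@leq_trans (pb j (size x))).
    by rewrite -[nvars _]size_code_nat; apply: hj.
  by rewrite leq_pmull.
- exists (fun w => [:: size (unpair w).2 == nvars (decode_cnf (unpair w).1)]).
    by apply: polytime_bool; fp.
  move=> x s _; rewrite unpairK /= /is_assignment.
  by split=> [[/eqP]|->] //; rewrite eqxx.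
- exists (fun x => nseq (nvars (decode_cnf x)) false); first by apply: polytime_FP; fp.
  by move=> x _ /=; rewrite /is_assignment size_nseq.
- exists (fun w => rev [seq sat_clause (unpair w).2 C | C <- decode_cnf (unpair w).1]).
    apply: polytime_FP; apply: FP_revb; apply: FP_mapb => //.
    by apply: FP_sat_clause; fp; apply: FP_comp (FP_fst FP_id) FP_unpair.
  by move=> x s _ _; rewrite unpairK /= lex_payoff_bits.
- by move=> x s s' _ _ [].
- exists (fun w => seq_code (neighbors2 (unpair w).2)).
    apply: polytime_FP; apply: FP_comp (FP_comp hs FP_neighbors2)
      (FP_recode (f := fun ss : seq bits => seq_code ss) _) => ss.
    by rewrite {2}/code /Enc_seq map_id.
  move=> x s _ sx; exists (neighbors2 s); first by rewrite unpairK.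
  move=> s'; rewrite mem_neighbors2 /= /is_assignment; rewrite /= /is_assignment in sx.
  by rewrite sx.
Qed.

(** * Two copies of a circuit as a prioritized formula *)

Lemma lex_payoff_lt F a : lex_payoff F a < 2 ^ size F.
Proof.
elim: F => [|C F IH]; first by rewrite /lex_payoff big_ord0.
rewrite lex_payoff_cons /= expnS; move: IH.
by case: (sat_clause a C); move: (2 ^ size F) (lex_payoff F a) => u v; lia.
Qed.

(** A clause gained outweighs all later ones together, so [F2] may change arbitrarily. *)
Lemma lex_payoff_improve (F1 F2 : cnf) a b :
  {in F1, forall D, sat_clause a D -> sat_clause b D} ->
  (exists2 C, C \in F1 & ~~ sat_clause a C && sat_clause b C) ->
  lex_payoff (F1 ++ F2) a < lex_payoff (F1 ++ F2) b.
Proof.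
elim: F1 => [|C F1 IH] hab [D]; first by rewrite in_nil.
rewrite /= !lex_payoff_cons => hD /andP[na nb].
have hC := hab C (mem_head _ _).
have lt1 := lex_payoff_lt (F1 ++ F2) a.
case ea: (sat_clause a C) hC => hC.
  rewrite hC // ltn_add2l; apply: IH => [E hE|]; first by apply: hab; rewrite inE hE orbT.
  exists D; last by rewrite na.
  by move: hD; rewrite inE => /predU1P[eD|//]; rewrite eD ea in na.
case eb: (sat_clause b C) hC => hC; first by rewrite mul0n mul1n add0n (leq_trans lt1) // leq_addr.
rewrite ltn_add2l; apply: IH => [E hE|]; first by apply: hab; rewrite inE hE orbT.
exists D; last by rewrite na.
by move: hD; rewrite inE => /predU1P[eD|//]; rewrite eD eb in nb.
Qed.

Definition fl (u : nat) (A : nat -> bool) : nat -> bool :=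
  fun k => if k == u then ~~ A k else A k.

Definition satf (A : nat -> bool) (C : clause) : bool :=
  has (fun l : literal => A l.1 == l.2) C.

Lemma satf_ext A A' C : A =1 A' -> satf A C = satf A' C.
Proof. by move=> h; apply: eq_has => l; rewrite h. Qed.

Lemma satf_neq u A C : all (fun l : literal => l.1 != u) C -> satf (fl u A) C = satf A C.
Proof.
move=> /allP h; apply: eq_in_has => l /h /negbTE hl.
by rewrite /fl hl.
Qed.

Lemma lt_nvars (F : cnf) (C : clause) (l : literal) : C \in F -> l \in C -> l.1 < nvars F.
Proof.
move=> hC hl; have h : l \in flatten F by apply/flattenP; exists C.
rewrite /nvars; exact: (@leq_bigmax_seq _ _ xpredT (fun l : literal => l.1.+1) l h isT).
Qed.

Lemma lt_nvars_has (F : cnf) (C : clause) u :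
  C \in F -> has (fun l : literal => l.1 == u) C -> u < nvars F.
Proof. by move=> hC /hasP[l hl /eqP <-]; apply: lt_nvars hC hl. Qed.

(** The only form in which optimality is used: a change that loses no clause of an initial segment
    gains none there. Each argument about the gadget chooses a segment ending with the clause to be
    gained, and payoffs need not be mentioned any more. *)
Definition prefix_opt (F : cnf) (A B : nat -> bool) : Prop :=
  forall F1 F2, F = F1 ++ F2 -> {in F1, forall D, satf A D -> satf B D} ->
  {in F1, forall C, satf B C -> satf A C}.

Lemma flip_opt k F a : local_opt (kSAT_dFLIP k 2) (encode_cnf F) a ->
  let A := nth false a in
  (forall u, u < nvars F -> prefix_opt F A (fl u A)) /\
  (forall u v, u < nvars F -> v < nvars F -> u != v ->
     prefix_opt F A (fl u (fl v A))).
Proof.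
rewrite /local_opt /= encode_cnfK /is_assignment /better /= encode_cnfK.
case=> sa opt; set A := nth false a.
have key b : size b = size a -> hamming a b <= 2 -> prefix_opt F A (nth false b).
  move=> sb hb F1 F2 eF hF C hC sC; apply/negPn/negP => nC.
  have sb' : size b = nvars F by rewrite sb.
  apply: (opt b sb' (conj sb' hb)); rewrite eF; apply: lex_payoff_improve => //.
  by exists C => //; rewrite nC.
have ext A' B B' : B =1 B' -> prefix_opt F A' B -> prefix_opt F A' B'.
  move=> e h F1 F2 eF hF C hC; rewrite -(satf_ext C e); apply: h eF _ C hC => D hD sD.
  by rewrite (satf_ext D e); apply: hF.
have flE u b : u < size b -> nth false (flipb u b) =1 fl u (nth false b).
  by move=> hu j; rewrite nth_flipb // /fl; case: (j == u); case: (nth _ _ _).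
split=> [u hu|u v hu hv uv].
  rewrite -sa in hu; apply: ext (flE u a hu) (key _ _ _); first by rewrite size_flipb.
  by apply: leq_trans (hamming_flipb _ _) _; rewrite ?hammingxx.
rewrite -sa in hu hv.
apply: ext (key (flipb u (flipb v a)) _ _); last 2 first.
- by rewrite !size_flipb.
- apply: leq_trans (hamming_flipb _ _) _; first by rewrite size_flipb.
  by rewrite ltnS (leq_trans (hamming_flipb _ _)) // hammingxx.
move=> j; rewrite flE ?size_flipb // /fl; case: eqP => _; by rewrite flE.
Qed.

(** * Gates and their clauses *)

Definition gate : Type := (bits * (nat * nat))%type.

Definition gval (g : gate) (x y : bool) : bool := nth false g.1 (x.*2 + y).

Definition bools2 : seq (bool * bool) :=
  [:: (false, false); (false, true); (true, false); (true, true)].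

Definition bools3 : seq (bool * (bool * bool)) :=
  [seq (false, p) | p <- bools2] ++ [seq (true, p) | p <- bools2].

Lemma mem_bools2 p : p \in bools2.
Proof. by case: p => [] [] []. Qed.

Lemma mem_bools3 p : p \in bools3.
Proof. by case: p => [] [] [] [] []. Qed.

Section Gadget.
Variables (m nin : nat) (gates : seq gate) (outs : nat -> nat).

Definition g0 : gate := ([::], (0, 0)).
Definition nw : nat := nin + size gates.

(* Variable 0 names the active copy, variables 1 to [m] display its value, and
   the wires of the two copies follow. *)
Definition wvar (c : bool) (w : nat) : nat := m.+1 + ((if c then nw else 0) + w).

(** One row of the truth table of gate [j] in copy [p.1]: the first two literals hold unless the
    inputs are [p.2], in which case the output must be the table entry. *)
Definition gclause (j : nat) (p : bool * (bool * bool)) : clause :=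
  let g := nth g0 gates j in
  [:: (wvar p.1 g.2.1, ~~ p.2.1); (wvar p.1 g.2.2, ~~ p.2.2);
      (wvar p.1 (nin + j), gval g p.2.1 p.2.2)].

Definition cgclause (j : nat) (p : bool * (bool * bool)) : clause :=
  (0, ~~ p.1) :: gclause j p.

Definition jclause (i : nat) (c : bool) : clause :=
  [:: (0, ~~ c); (i.+1, false); (wvar c (outs i), true)].

Definition vclause (i : nat) : clause := [:: (i.+1, true)].

(** For the two values of [p.2], these are the two implications that make up the equality of an
    input wire of the inactive copy with the output wire that prescribes it. *)
Definition kclause (j : nat) (p : bool * bool) : clause :=
  [:: (0, ~~ p.1); (wvar (~~ p.1) j, p.2); (wvar p.1 (outs (m + j)), ~~ p.2)].

Definition blk1 (r : seq nat) : cnf := [seq cgclause j p | j <- r, p <- bools3].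
(** The three kinds of clauses are interleaved: everything about bit [i] precedes everything about
    lower bits, which the double flip may therefore break. *)
Definition blk2 (r : seq nat) : cnf :=
  flatten [seq [:: jclause i false; jclause i true; vclause i] | i <- r].
Definition blk3 (r : seq nat) : cnf := [seq kclause j p | j <- r, p <- bools2].
Definition blk4 (r : seq nat) : cnf := [seq gclause j p | j <- r, p <- bools3].

Definition gadget : cnf :=
  blk1 (iota 0 (size gates)) ++ blk2 (iota 0 m) ++ blk3 (iota 0 nin) ++
  blk4 (iota 0 (size gates)).

Lemma size_gadget C : C \in gadget -> size C <= 4.
Proof.
rewrite !mem_cat => /or4P[/allpairsP[[j p] [_ _ ->]]|
  /flatten_mapP[i _]|/allpairsP[[j p] [_ _ ->]]|/allpairsP[[j p] [_ _ ->]]] //.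
by rewrite !inE => /or3P[/eqP->|/eqP->|/eqP->].
Qed.

Definition consistent (W : nat -> bool) : Prop :=
  forall j, j < size gates ->
    W (nin + j) = gval (nth g0 gates j) (W (nth g0 gates j).2.1) (W (nth g0 gates j).2.2).

Variable A : nat -> bool.
Hypothesis wf_gates : forall j, j < size gates ->
  (nth g0 gates j).2.1 < nin + j /\ (nth g0 gates j).2.2 < nin + j.
Hypothesis wf_outs : forall i, i < m + nin -> outs i < nw.
Hypothesis opt1 : forall u, u < nvars gadget -> prefix_opt gadget A (fl u A).
Hypothesis opt2 : forall u v, u < nvars gadget -> v < nvars gadget -> u != v ->
  prefix_opt gadget A (fl u (fl v A)).

Let c := A 0.
Let W (d : bool) (w : nat) : bool := A (wvar d w).

Lemma iota_split i n : i < n ->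
  exists r, iota 0 n = (iota 0 i ++ [:: i]) ++ r.
Proof.
move=> h; exists (iota i.+1 (n - i.+1)).
by rewrite -[in LHS](subnKC h) -{1}[i.+1]addn1 !iotaD !add0n addn1.
Qed.

Lemma blk1_cat r1 r2 : blk1 (r1 ++ r2) = blk1 r1 ++ blk1 r2.
Proof. by rewrite /blk1 map_cat flatten_cat. Qed.

Lemma blk2_cat r1 r2 : blk2 (r1 ++ r2) = blk2 r1 ++ blk2 r2.
Proof. by rewrite /blk2 map_cat flatten_cat. Qed.

Lemma blk3_cat r1 r2 : blk3 (r1 ++ r2) = blk3 r1 ++ blk3 r2.
Proof. by rewrite /blk3 map_cat flatten_cat. Qed.

Lemma blk4_cat r1 r2 : blk4 (r1 ++ r2) = blk4 r1 ++ blk4 r2.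
Proof. by rewrite /blk4 map_cat flatten_cat. Qed.

Lemma flS u : fl u A u = ~~ A u. Proof. by rewrite /fl eqxx. Qed.
Lemma flN u k : k != u -> fl u A k = A k. Proof. by rewrite /fl => /negbTE ->. Qed.

Lemma inactive_sat (A' : nat -> bool) d C : A' 0 = ~~ d -> satf A' ((0, ~~ d) :: C).
Proof. by move=> h; rewrite /satf /= h eqxx. Qed.

(** Gates up to [j] read only wires before the output of gate [j], and earlier gates do not write
    it. So flipping a wrong output changes just the clauses of gate [j] itself, in its own copy, and
    repairs them. *)
Lemma gclause_flip d d' j j' p : j < size gates -> j' <= j ->
  W d (nin + j) != gval (nth g0 gates j) (W d (nth g0 gates j).2.1) (W d (nth g0 gates j).2.2) ->
  satf A (gclause j' (d', p)) ->
  satf (fl (wvar d (nin + j)) A) (gclause j' (d', p)).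
Proof.
move=> hj hj' bad; have [w1 w2] := wf_gates hj; have [w1' w2'] := wf_gates (leq_ltn_trans hj' hj).
have n1 : wvar d' (nth g0 gates j').2.1 != wvar d (nin + j).
  by rewrite /wvar /nw; case: d {bad}; case: d'; lia.
have n2 : wvar d' (nth g0 gates j').2.2 != wvar d (nin + j).
  by rewrite /wvar /nw; case: d {bad n1}; case: d'; lia.
case: (eqVneq (wvar d' (nin + j')) (wvar d (nin + j))) => [e|ne]; last first.
  by rewrite satf_neq //= n1 n2 ne.
have [ed ej] : d' = d /\ j' = j.
  by move: e; rewrite /wvar /nw; case: d {bad n1 n2}; case: d'; split=> //; lia.
subst d' j'; move=> _; rewrite /satf /= flS !flN // orbF -/(W d _) -/(W d _).
case: p => x y /=; case: (eqVneq (W d (nth g0 gates j).2.1) (~~ x)) => //= ex.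
case: (eqVneq (W d (nth g0 gates j).2.2) (~~ y)) => //= ey.
have -> : x = W d (nth g0 gates j).2.1 by move: ex; case: (x); case: (W d _).
have -> : y = W d (nth g0 gates j).2.2 by move: ey; case: (y); case: (W d _).
by move: bad; rewrite -/(W d _); case: (W d (nin + j)); case: (gval _ _ _).
Qed.

(* The only clause of gate [j] that is violated when its output is wrong. *)
Definition badclause (d : bool) (j : nat) : clause :=
  gclause j (d, (W d (nth g0 gates j).2.1, W d (nth g0 gates j).2.2)).

Lemma badclause_sat d j : satf A (badclause d j) =
  (W d (nin + j) == gval (nth g0 gates j) (W d (nth g0 gates j).2.1) (W d (nth g0 gates j).2.2)).
Proof.
rewrite /satf /= orbF -!/(W d _).
by case: (W d (nth g0 gates j).2.1); case: (W d (nth g0 gates j).2.2).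
Qed.

Lemma badclause_flip d j : j < size gates ->
  W d (nin + j) != gval (nth g0 gates j) (W d (nth g0 gates j).2.1) (W d (nth g0 gates j).2.2) ->
  satf (fl (wvar d (nin + j)) A) (badclause d j).
Proof.
move=> hj bad; rewrite /satf /= flS orbF -/(W d (nin + j)).
by apply/or3P/Or33; move: bad; case: (W d (nin + j)); case: (gval _ _ _).
Qed.

(** Flipping the output of a wrong active gate would gain its violated clause, within the segment of
    block 1 that ends with this gate; the display and all later gates have lower priority. *)
Lemma active_consistent : consistent (W c).
Proof.
move=> j hj; apply/eqP/negPn/negP => bad.
have [r er] := iota_split hj.
pose F1 := blk1 (iota 0 j ++ [:: j]).
have eF : exists F2, gadget = F1 ++ F2.
  exists (blk1 r ++ blk2 (iota 0 m) ++ blk3 (iota 0 nin) ++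
    blk4 (iota 0 (size gates))).
  by rewrite /gadget {1}er blk1_cat -/F1 -!catA.
case: eF => F2 eF.
have inF1 : (0, ~~ c) :: badclause c j \in F1.
  apply/allpairsP; exists (j, (c, (W c (nth g0 gates j).2.1, W c (nth g0 gates j).2.2))).
  by split; [rewrite /= mem_cat inE eqxx orbT|exact: mem_bools3|].
have hu : wvar c (nin + j) < nvars gadget.
  apply: (@lt_nvars_has _ ((0, ~~ c) :: badclause c j)); first by rewrite eF mem_cat inF1.
  by rewrite /= eqxx ?orbT.
have hyp : {in F1, forall D, satf A D -> satf (fl (wvar c (nin + j)) A) D}.
  move=> D /allpairsP[[j' [d p]] [/= hj' _ ->]]; rewrite /cgclause.
  have {}hj' : j' <= j by move: hj'; rewrite mem_cat mem_iota inE /=; lia.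
  case/orP=> h; apply/orP; [by left; rewrite flN|right].
  exact: gclause_flip h.
have s1 : satf (fl (wvar c (nin + j)) A) ((0, ~~ c) :: badclause c j).
  by apply/orP; right; apply: badclause_flip.
have /orP[] := opt1 hu eF hyp inF1 s1; first by rewrite /= -/c; case: (c).
move=> h; have : satf A (badclause c j) by exact: h.
by rewrite badclause_sat (negbTE bad).
Qed.

Lemma wvar_neq d i w : i < m -> wvar d w != i.+1.
Proof. by rewrite /wvar; lia. Qed.

Lemma blk1_wire u D r : u <= m -> u != 0 -> D \in blk1 r ->
  satf (fl u A) D = satf A D.
Proof.
move=> hu u0 /allpairsP[[j [d p]] [_ _ ->]]; apply: satf_neq.
rewrite /= eq_sym u0 /=.
by rewrite /wvar; apply/and4P; split=> //; lia.
Qed.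

Lemma displayed i : i < m -> A i.+1 = W c (outs i).
Proof.
move=> hi; have [r er] := iota_split hi.
have n0 d : wvar d (outs i) != i.+1 by exact: wvar_neq.
pose P := blk1 (iota 0 (size gates)) ++ blk2 (iota 0 i).
have eF : exists F2, gadget = (P ++ [:: jclause i false; jclause i true; vclause i]) ++ F2.
  exists (blk2 r ++ blk3 (iota 0 nin) ++ blk4 (iota 0 (size gates))).
  by rewrite /gadget er !blk2_cat /P -!catA.
case: eF => F2 eF.
have hu : i.+1 < nvars gadget.
  apply: (@lt_nvars _ (vclause i) (i.+1, true)); last exact: mem_head.
  by rewrite eF !mem_cat !inE eqxx !orbT.
have hP : {in P, forall D, satf A D -> satf (fl i.+1 A) D}.
  move=> D; rewrite mem_cat => /orP[/blk1_wire -> //|].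
  case/flatten_mapP=> i'; rewrite mem_iota add0n => /andP[_ hi'].
  have ni : i'.+1 != i.+1 by rewrite eqSS ltn_eqF.
  by rewrite !inE => /or3P[] /eqP ->; rewrite satf_neq //= ?ni ?wvar_neq.
have hJz (A' : nat -> bool) : A' 0 = c -> satf A' (jclause i (~~ c)).
  by move=> h; apply: inactive_sat; rewrite h negbK.
have c0 : fl i.+1 A 0 = c by rewrite flN.
case ev: (A i.+1); case eo: (W c (outs i)) => //.
(* The display claims a bit that the active copy does not have: withdrawing it gains the
   implication, and the lost [vclause i] lies just beyond the segment. *)
- pose F1 := P ++ [:: jclause i false; jclause i true].
  have eF1 : gadget = F1 ++ vclause i :: F2 by rewrite eF /F1 -!catA.
  have hyp : {in F1, forall D, satf A D -> satf (fl i.+1 A) D}.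
    move=> D; rewrite mem_cat => /orP[/hP //|hD sD].
    have [d ->] : exists d, D = jclause i d.
      by move: hD; rewrite !inE => /orP[] /eqP ->; eexists.
    by rewrite /satf /= flS ev /= orbT.
  have inF1 : jclause i c \in F1 by rewrite mem_cat !inE; case: (c); rewrite eqxx !orbT.
  have := opt1 hu eF1 hyp inF1; rewrite {1}/satf /= flS ev /= orbT => /(_ isT).
  by rewrite -/(W c _) eo -/c; case: (c).
(* The active copy has a bit that is not displayed: displaying it gains [vclause i], since the
   implication is satisfied by the output wire in the active copy and by the guard in the other. *)
- have hyp : {in P ++ [:: jclause i false; jclause i true; vclause i],
      forall D, satf A D -> satf (fl i.+1 A) D}.
    move=> D; rewrite mem_cat => /orP[/hP //|hD sD].
    have hJ d : satf (fl i.+1 A) (jclause i d).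
      case: (eqVneq d c) => [->|dc].
        by rewrite /satf /= (flN (n0 c)) -/(W c _) eo /= !orbT.
      have -> : d = ~~ c by case: (d) dc; case: (c).
      exact: hJz.
    by move: hD; rewrite !inE => /or3P[] /eqP -> //; rewrite /satf /= flS ev.
  have inF1 : vclause i \in P ++ [:: jclause i false; jclause i true; vclause i].
    by rewrite mem_cat !inE eqxx !orbT.
  by have := opt1 hu eF hyp inF1; rewrite {1}/satf /= flS ev => /(_ isT).
Qed.

(* Clauses guarded by the inactive copy are satisfied whatever its wires are. *)
Lemma blk12_inactive w D : w < nw ->
  D \in blk1 (iota 0 (size gates)) ++ blk2 (iota 0 m) ->
  satf A D -> satf (fl (wvar (~~ c) w) A) D.
Proof.
move=> hw; set u := wvar _ _.
have u0 : 0 != u by [].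
have cu : fl u A 0 = c by rewrite flN.
have wu w' : w' < nw -> wvar c w' != u by rewrite /u /wvar; case: (c) => /=; lia.
rewrite mem_cat => /orP[/allpairsP[[j [d p]] [/= hj _ ->]]|/flatten_mapP[i hi]].
  rewrite mem_iota add0n /= in hj; have [w1 w2] := wf_gates hj.
  case: (eqVneq d c) => [->|dc].
    by rewrite satf_neq //; apply/and5P; split=> //; apply: wu; rewrite /nw; lia.
  by move=> _; apply: inactive_sat; rewrite cu; case: (d) dc; case: (c).
rewrite mem_iota add0n /= in hi.
have ni : i.+1 != u by rewrite eq_sym wvar_neq.
have hJ d : satf A (jclause i d) -> satf (fl u A) (jclause i d).
  case: (eqVneq d c) => [->|dc].
    by rewrite satf_neq //; apply/and4P; split=> //; apply: wu; rewrite wf_outs // ltn_addr.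
  by move=> _; apply: inactive_sat; rewrite cu; case: (d) dc; case: (c).
rewrite !inE => /or3P[] /eqP ->; [exact: hJ|exact: hJ|].
by rewrite satf_neq //= ni.
Qed.

Lemma kclause_inactive w D j p : w < nw -> j < nin -> w != j -> D = kclause j p ->
  satf A D -> satf (fl (wvar (~~ c) w) A) D.
Proof.
move=> hw hj wj ->; set u := wvar _ _.
have u0 : 0 != u by [].
have cu : fl u A 0 = c by rewrite flN.
case: p => d b; case: (eqVneq d c) => [->|dc]; last first.
  by move=> _; apply: inactive_sat; rewrite cu; case: (d) dc; case: (c).
rewrite satf_neq //; apply/and4P; split=> //.
  by rewrite /u /wvar !eqn_add2l eq_sym.
have := @wf_outs (m + j); rewrite ltn_add2l => /(_ hj).
by rewrite /u /wvar; case: (c) => /=; lia.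
Qed.

(** An inactive wire may be changed freely as far as blocks 1 and 2 are concerned, and the gates
    that read it are only enforced in block 4. So a wrong input could be corrected at a gain. *)
Lemma copied j : j < nin -> W (~~ c) j = W c (outs (m + j)).
Proof.
move=> hj; have [r er] := iota_split hj.
set u := wvar (~~ c) j.
pose P := blk1 (iota 0 (size gates)) ++ blk2 (iota 0 m).
pose F1 := P ++ blk3 (iota 0 j ++ [:: j]).
have eF : exists F2, gadget = F1 ++ F2.
  exists (blk3 r ++ blk4 (iota 0 (size gates))).
  by rewrite /gadget er blk3_cat /F1 /P -!catA.
case: eF => F2 eF.
have hjw : j < nw by rewrite /nw ltn_addr.
have ho : outs (m + j) < nw by apply: wf_outs; rewrite ltn_add2l.
have ou : wvar c (outs (m + j)) != u by rewrite /u /wvar; case: (c) => /=; lia.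
have inF1 b : kclause j (c, b) \in F1.
  rewrite mem_cat; apply/orP; right; apply/allpairsP; exists (j, (c, b)).
  by split; [rewrite /= mem_cat inE eqxx orbT|exact: mem_bools2|].
have hu : u < nvars gadget.
  apply: (@lt_nvars_has _ (kclause j (c, true))); first by rewrite eF mem_cat inF1.
  by rewrite /= -/u eqxx ?orbT.
apply/eqP/negPn/negP => bad.
have cu : fl u A 0 = c by rewrite flN.
have hyp : {in F1, forall D, satf A D -> satf (fl u A) D}.
  move=> D; rewrite mem_cat => /orP[/blk12_inactive|/allpairsP[[j' [d b]] [/= hj' _ ->]]].
    exact.
  have {}hj' : j' <= j by move: hj'; rewrite mem_cat mem_iota inE /=; lia.
  case: (eqVneq j j') => [<-|jj']; last first.
    by apply: kclause_inactive (erefl _) => //; apply: leq_ltn_trans hj.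
  case: (eqVneq d c) => [-> _|dc]; last first.
    by move=> _; apply: inactive_sat; rewrite cu; case: (d) dc; case: (c).
  rewrite /satf /= -/u flS (flN ou) -/(W _ _) -/(W _ _) orbF.
  by move: bad; case: (W (~~ c) j); case: (W c _); case: (b) => //= _; rewrite orbT.
have := opt1 hu eF hyp (inF1 (W c (outs (m + j)))).
rewrite {1}/satf /= -/u flS (flN ou) -/(W _ _) -/(W _ _).
have -> : ~~ W (~~ c) j == W c (outs (m + j)).
  by move: bad; case: (W (~~ c) j); case: (W c _).
rewrite orbT => /(_ isT); rewrite /satf /= -/u -/c -/(W _ _) -/(W c _).
have e b : (b == ~~ b) = false by case: b.
by rewrite (negbTE bad) !e.
Qed.

(** As for the active copy, but within block 4. The flipped wire is a gate output of the inactive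
    copy, hence none of the inputs and outputs compared in the unguarded clauses of block 3. *)
Lemma inactive_consistent : consistent (W (~~ c)).
Proof.
move=> j hj; apply/eqP/negPn/negP => bad.
have [r er] := iota_split hj.
set u := wvar (~~ c) (nin + j).
pose P := (blk1 (iota 0 (size gates)) ++ blk2 (iota 0 m)) ++ blk3 (iota 0 nin).
pose F1 := P ++ blk4 (iota 0 j ++ [:: j]).
have eF : exists F2, gadget = F1 ++ F2.
  exists (blk4 r).
  by rewrite /gadget {2}er blk4_cat /F1 /P -!catA.
case: eF => F2 eF.
have hjw : nin + j < nw by rewrite /nw ltn_add2l.
have inF1 : badclause (~~ c) j \in F1.
  rewrite mem_cat; apply/orP; right; apply/allpairsP.
  exists (j, (~~ c, (W (~~ c) (nth g0 gates j).2.1, W (~~ c) (nth g0 gates j).2.2))).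
  by split; [rewrite /= mem_cat inE eqxx orbT|exact: mem_bools3|].
have hu : u < nvars gadget.
  apply: (@lt_nvars_has _ (badclause (~~ c) j)); first by rewrite eF mem_cat inF1.
  by rewrite /= -/u eqxx ?orbT.
have hyp : {in F1, forall D, satf A D -> satf (fl u A) D}.
  move=> D; rewrite !(mem_cat D P) [D \in P]mem_cat.
  case/orP=> [/orP[/blk12_inactive|]|].
  - exact.
  - case/allpairsP=> -[j' p] [/= hj' _ eD]; rewrite mem_iota add0n /= in hj'.
    by apply: kclause_inactive eD => //; rewrite neq_ltn ltn_addr ?orbT.
  case/allpairsP=> -[j' [d p]] [/= hj' _ ->].
  have {}hj' : j' <= j by move: hj'; rewrite mem_cat mem_iota inE /=; lia.
  exact: gclause_flip.
have := opt1 hu eF hyp inF1; rewrite badclause_flip // => /(_ isT).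
by rewrite badclause_sat (negbTE bad).
Qed.

(** The only use of a double flip. Both copies must be known to be correct by now, since block 1 has
    to survive the exchange of their roles. *)
Lemma no_better i : i < m ->
  (forall i', i' < i -> W c (outs i') = W (~~ c) (outs i')) ->
  ~~ W c (outs i) -> ~~ W (~~ c) (outs i).
Proof.
move=> hi heq ho; apply/negP => hz; have [r er] := iota_split hi.
pose F1 := blk1 (iota 0 (size gates)) ++ blk2 (iota 0 i ++ [:: i]).
have eF : exists F2, gadget = F1 ++ F2.
  exists (blk2 r ++ blk3 (iota 0 nin) ++ blk4 (iota 0 (size gates))).
  by rewrite /gadget er blk2_cat /F1 -!catA.
case: eF => F2 eF.
have inF1 : vclause i \in F1.
  rewrite mem_cat; apply/orP; right; apply/flatten_mapP.
  by exists i; rewrite ?mem_cat ?inE ?eqxx ?orbT.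
have hv : i.+1 < nvars gadget.
  by apply: (@lt_nvars _ (vclause i) (i.+1, true)); rewrite ?mem_head // eF mem_cat inF1.
have hu : 0 < nvars gadget by apply: leq_trans hv.
pose B := fl 0 (fl i.+1 A).
have B0 : B 0 = ~~ c by [].
have Bw d w : B (wvar d w) = W d w.
  by rewrite /B /fl; have /negbTE -> := @wvar_neq d i w hi.
have Bi : B i.+1 = ~~ A i.+1 by rewrite /B /fl /= eqxx.
have Bn i' : i' != i -> B i'.+1 = A i'.+1 by rewrite /B /fl /= eqSS => /negbTE ->.
have ev : A i.+1 = false by rewrite displayed // (negbTE ho).
have hyp : {in F1, forall D, satf A D -> satf B D}.
  move=> D; rewrite mem_cat => /orP[].
    (* Clauses of the formerly active copy are now satisfied by their guard, those of the newly
       active one by its consistency. *)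
    case/allpairsP=> -[j [d p]] [/= hj _ ->] _.
    rewrite mem_iota add0n /= in hj.
    case: (eqVneq d c) => [->|dc]; first by apply: inactive_sat; rewrite B0.
    have -> : d = ~~ c by case: (d) dc; case: (c).
    apply/orP; right; rewrite /= !Bw (inactive_consistent hj).
    case: p => x y /=; case: (eqVneq (W (~~ c) (nth g0 gates j).2.1) (~~ x)) => //= ex.
    case: (eqVneq (W (~~ c) (nth g0 gates j).2.2) (~~ y)) => //= ey.
    have -> : x = W (~~ c) (nth g0 gates j).2.1 by move: ex; case: (x); case: (W _ _).
    have -> : y = W (~~ c) (nth g0 gates j).2.2 by move: ey; case: (y); case: (W _ _).
    by rewrite eqxx.
  case/flatten_mapP=> i' hi'; have {}hi' : i' <= i.
    by move: hi'; rewrite mem_cat mem_iota inE /=; lia.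
  have hJc : satf B (jclause i' c) by apply: inactive_sat; rewrite B0.
  have hJz : satf B (jclause i' (~~ c)).
    (* At bit [i] the newly active output is 1; at more significant bits the display is unchanged
       and the two copies agree. *)
    rewrite /satf /= Bw; case: (eqVneq i' i) => [->|ii']; first by rewrite hz !orbT.
    have lt : i' < i by rewrite ltn_neqAle ii'.
    rewrite Bn // displayed ?(ltn_trans lt) // heq //.
    by case: (W _ _); rewrite /= !orbT.
  have hJ d : satf B (jclause i' d).
    case: (eqVneq d c) => [->//|dc].
    by have -> : d = ~~ c by case: (d) dc; case: (c).
  rewrite !inE => /or3P[] /eqP -> //.
  case: (eqVneq i' i) => [->|ii']; first by rewrite /satf /= Bi ev.
  by rewrite /satf /= Bn.
have := opt2 hu hv isT eF hyp inF1.
by rewrite /satf /= -/B Bi ev => /(_ isT).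
Qed.

End Gadget.

(** * Circuits for Boolean functions *)

Inductive bexp := BVar of nat | BCst of bool | BOp of bits & bexp & bexp.

Definition tabval (t : bits) (x y : bool) : bool := nth false t (x.*2 + y).

Fixpoint beval (f : nat -> bool) (e : bexp) : bool :=
  match e with
  | BVar i => f i
  | BCst b => b
  | BOp t e1 e2 => tabval t (beval f e1) (beval f e2)
  end.

Definition tproj : bits := [:: false; false; true; true].
Definition tand : bits := [:: false; false; false; true].
(** Not the usual NAND: the table is that of the conjunction of the negated first argument with the
    second. *)
Definition tnand : bits := [:: false; true; false; false].
Definition tor : bits := [:: false; true; true; true].

(** Shannon expansion on the last variable. The result is exponential in [n], but it is applied only
    to functions fixed by the machine, independent of the instance. *)
Fixpoint synth (n : nat) (phi : (nat -> bool) -> bool) : bexp :=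
  if n is n'.+1 then
    let s b := synth n' (fun f => phi (fun i => if i == n' then b else f i)) in
    BOp tor (BOp tand (BVar n') (s true)) (BOp tnand (BVar n') (s false))
  else BCst (phi (fun=> false)).

Lemma beval_synth n phi f :
  (forall g h : nat -> bool, (forall i, i < n -> g i = h i) -> phi g = phi h) ->
  beval f (synth n phi) = phi f.
Proof.
elim: n phi => [|n IH] phi hphi /=; first exact: hphi.
have h b : beval f (synth n (fun g => phi (fun i => if i == n then b else g i))) =
    phi (fun i => if i == n then b else f i).
  rewrite IH // => g g' hg; apply: hphi => i hi; case: eqP => // ne.
  by apply: hg; lia.
rewrite !h (_ : phi f = phi (fun i => if i == n then f n else f i)).
  by case: (f n); case: (phi _); case: (phi _).
by apply: hphi => i _; case: eqP => // ->.
Qed.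

(* A reference [(k, o)] is to the wire at offset [o] of the [k]-th of a list of
   base addresses, the first of which is that of the block itself. *)
Definition tref : Type := (nat * nat)%type.
Definition tgate : Type := (bits * (tref * tref))%type.

Definition rwire (bases : seq nat) (r : tref) : nat := nth 0 bases r.1 + r.2.

Definition inst (bases : seq nat) (g : tgate) : gate :=
  (g.1, (rwire bases g.2.1, rwire bases g.2.2)).

Definition tg0 : tgate := ([::], ((0, 0), (0, 0))).

Definition seg_ok (Wv : nat -> bool) (bases : seq nat) (s : nat) (tm : seq tgate) :=
  forall i, i < size tm -> let g := nth tg0 tm i in
    Wv (rwire bases (0, s + i)) =
    tabval g.1 (Wv (rwire bases g.2.1)) (Wv (rwire bases g.2.2)).

Lemma seg_ok_cat Wv bases s tm1 tm2 : seg_ok Wv bases s (tm1 ++ tm2) ->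
  seg_ok Wv bases s tm1 /\ seg_ok Wv bases (s + size tm1) tm2.
Proof.
move=> h; split=> i hi g.
  by have := h i; rewrite size_cat nth_cat hi; apply; apply: ltn_addr.
have := h (size tm1 + i); rewrite size_cat ltn_add2l nth_cat [_ + i < size _]ltnNge leq_addr /= addKn.
by rewrite addnA; apply.
Qed.

Definition ref_wf (Q : tref -> Prop) (i : nat) (r : tref) : Prop :=
  r.1 = 0 /\ r.2 < i \/ Q r.

Definition seg_wf (Q : tref -> Prop) (s : nat) (tm : seq tgate) : Prop :=
  forall i, i < size tm -> ref_wf Q (s + i) (nth tg0 tm i).2.1 /\
                           ref_wf Q (s + i) (nth tg0 tm i).2.2.

Lemma seg_wf_cat Q s tm1 tm2 :
  seg_wf Q s tm1 -> seg_wf Q (s + size tm1) tm2 -> seg_wf Q s (tm1 ++ tm2).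
Proof.
move=> h1 h2 i; rewrite size_cat nth_cat => hs; case: (ltnP i (size tm1)) => hi.
  exact: h1.
by have := h2 (i - size tm1); rewrite -addnA subnKC //; apply; lia.
Qed.

Section Compile.
Variable rho : nat -> tref.

(** A constant still needs two input references; the start of the second base is one that exists for
    every block. *)
Definition gcst (b : bool) : tgate := (nseq 4 b, ((1, 0), (1, 0))).

(** Even a variable gets a gate, so that the value of an expression is always the last wire of its
    segment. *)
Fixpoint bcomp (s : nat) (e : bexp) : seq tgate :=
  match e with
  | BVar i => [:: (tproj, (rho i, rho i))]
  | BCst b => [:: gcst b]
  | BOp t e1 e2 =>
      let c1 := bcomp s e1 in let c2 := bcomp (s + size c1) e2 in
      c1 ++ c2 ++ [:: (t, ((0, (s + size c1).-1), (0, (s + size c1 + size c2).-1)))]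
  end.

Fixpoint bvars (e : bexp) (i : nat) : Prop :=
  match e with
  | BVar j => i = j
  | BCst _ => False
  | BOp _ e1 e2 => bvars e1 i \/ bvars e2 i
  end.

Lemma size_bcomp_gt0 s e : 0 < size (bcomp s e).
Proof. by case: e => //= t e1 e2; rewrite !size_cat /= !addn1 !addnS. Qed.

Lemma bcomp_ok Wv bases s e : seg_ok Wv bases s (bcomp s e) ->
  Wv (rwire bases (0, (s + size (bcomp s e)).-1)) =
  beval (fun i => Wv (rwire bases (rho i))) e.
Proof.
elim: e s => [i|b|t e1 IH1 e2 IH2] s /=.
- by move=> /(_ 0 isT) /=; rewrite addn0 addn1 /= => ->; case: (Wv _).
- by move=> /(_ 0 isT) /=; rewrite addn0 addn1 /= => ->; case: (Wv _); case: b.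
set c1 := bcomp s e1; set c2 := bcomp _ e2.
case/seg_ok_cat=> /IH1 h1 /seg_ok_cat[/IH2 h2 /(_ 0 isT)] /=.
rewrite -/c1 -/c2 in h1 h2 *; rewrite addn0 h1 h2 => <-.
by rewrite !size_cat /= !addnA addn1.
Qed.

Lemma bcomp_wf (Q : tref -> Prop) s e : Q (1, 0) -> (forall i, bvars e i -> Q (rho i)) ->
  seg_wf Q s (bcomp s e).
Proof.
move=> Q1; elim: e s => [i|b|t e1 IH1 e2 IH2] s /= h.
- by case=> // _; split; right; apply: h.
- by case=> // _; split; right.
apply: seg_wf_cat; first by apply: IH1 => i hi; apply: h; left.
apply: seg_wf_cat; first by apply: IH2 => i hi; apply: h; right.
have := size_bcomp_gt0 s e1; have := size_bcomp_gt0 (s + size (bcomp s e1)) e2.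
by move=> g1 g2 [|//] _ /=; rewrite /ref_wf; split; left; split=> //=; lia.
Qed.

Lemma bvars_synth n phi i : bvars (synth n phi) i -> i < n.
Proof.
elim: n phi => //= n IH phi.
by case=> [[->//|/IH]|[->//|/IH]]; apply: ltnW.
Qed.

Fixpoint bcomps (s : nat) (es : seq bexp) : seq tgate * seq nat :=
  if es is e :: es' then
    let c := bcomp s e in let r := bcomps (s + size c) es' in
    (c ++ r.1, (s + size c).-1 :: r.2)
  else ([::], [::]).

Lemma bcomps_ok Wv bases s es j : seg_ok Wv bases s (bcomps s es).1 -> j < size es ->
  Wv (rwire bases (0, nth 0 (bcomps s es).2 j)) =
  beval (fun i => Wv (rwire bases (rho i))) (nth (BCst false) es j).
Proof.
elim: es s j => //= e es IH s [|j] /seg_ok_cat[h1 h2] /= hj; first exact: bcomp_ok.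
exact: IH.
Qed.

Lemma bcomps_wf (Q : tref -> Prop) s es : Q (1, 0) ->
  (forall j i, j < size es -> bvars (nth (BCst false) es j) i -> Q (rho i)) ->
  seg_wf Q s (bcomps s es).1.
Proof.
move=> Q1; elim: es s => //= e es IH s h; apply: seg_wf_cat.
  by apply: bcomp_wf => // i; apply: (h 0).
by apply: IH => j i hj; apply: (h j.+1).
Qed.

Lemma size_bcomps2 s es : size (bcomps s es).2 = size es.
Proof. by elim: es s => //= e es IH s; rewrite IH. Qed.

Lemma bcomps_lt s es j : j < size es -> nth 0 (bcomps s es).2 j < s + size (bcomps s es).1.
Proof.
elim: es s j => //= e es IH s [|j] hj; rewrite size_cat /=.
  by have := size_bcomp_gt0 s e; lia.
by have := IH (s + size (bcomp s e)) j hj; lia.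
Qed.

Definition tcopy (o : nat) : tgate := (tproj, ((0, o), (0, o))).

(* The values of [es] end up at the offsets [K0], [K0 + 1], ... *)
Definition template (K0 : nat) (es : seq bexp) : seq tgate :=
  let b := bcomps 0 es in
  (b.1 ++ nseq (K0 - size b.1) (gcst false)) ++ [seq tcopy o | o <- b.2].

Definition bodysize (es : seq bexp) : nat := size (bcomps 0 es).1.

Lemma size_template K0 es : bodysize es <= K0 -> size (template K0 es) = K0 + size es.
Proof.
move=> h; rewrite /template !size_cat size_nseq size_map size_bcomps2.
by rewrite subnKC.
Qed.

Lemma template_ok Wv bases K0 es j : bodysize es <= K0 ->
  seg_ok Wv bases 0 (template K0 es) -> j < size es ->
  Wv (rwire bases (0, K0 + j)) =
  beval (fun i => Wv (rwire bases (rho i))) (nth (BCst false) es j).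
Proof.
move=> hK /seg_ok_cat[/seg_ok_cat[h1 _] h2] hj; rewrite -(bcomps_ok h1 hj).
move: h2; rewrite size_cat size_nseq subnKC // add0n => /(_ j).
rewrite size_map size_bcomps2 => /(_ hj) /=.
rewrite (nth_map 0) ?size_bcomps2 //= => ->.
by case: (Wv _).
Qed.

Lemma template_wf (Q : tref -> Prop) K0 es : bodysize es <= K0 -> Q (1, 0) ->
  (forall j i, j < size es -> bvars (nth (BCst false) es j) i -> Q (rho i)) ->
  seg_wf Q 0 (template K0 es).
Proof.
move=> hK Q1 h; apply: seg_wf_cat.
  apply: seg_wf_cat; first exact: bcomps_wf.
  by move=> i; rewrite size_nseq => hi; rewrite nth_nseq hi; split; right.
move=> j; rewrite size_map size_bcomps2 => hj.
have := bcomps_lt 0 hj; rewrite -/(bodysize es) (nth_map 0) ?size_bcomps2 //=.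
by rewrite size_cat size_nseq subnKC // => ho; split; left; split=> //=; lia.
Qed.

End Compile.

(** * The tableau of a Turing machine *)

Section Cells.
Variable M : machine.

(* The contents of all tapes at one position relative to the heads, together
   with the state at position 0. *)
Definition cell : finType :=
  (option (state M) * {ffun 'I_(ntapes M).+1 -> symbol (aux M)})%type.

Definition cell0 : cell := (None, [ffun=> None]).

(** The central cell [c0] supplies the state and the scanned symbols, hence the action. A tape
    shifts against the move of its head, so after a move to the left a cell receives the symbol of
    its left neighbour; a symbol coming from the centre is replaced by the one just written. *)
Definition cellstep (c0 cl c cr : cell) : cell :=
  if c0.1 is Some q then
    if halting q then c else
    let: (q', act) := delta q c0.2 in
    (if c.1 is Some _ then Some q' else None,
     [ffun i => let c' := match (act i).2 with
                          | MoveLeft => cl | Stay => c | MoveRight => cr end in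
                if c'.1 is Some _ then (act i).1 else c'.2 i])
  else c.

Definition tcell (W : nat) (t : tape (aux M)) (p : nat) : symbol (aux M) :=
  if p < W then nth None (left_of t) (W - p.+1)
  else if p == W then scanned t else nth None (right_of t) (p - W.+1).

Definition cellat (W : nat) (c : config M) (p : nat) : cell :=
  (if p == W then Some c.1 else None, [ffun i => tcell W (c.2 i) p]).

Lemma tcell_left W t a p : 0 < p -> tcell W (write_move t (a, MoveLeft)) p =
  if p.-1 == W then a else tcell W t p.-1.
Proof.
case: t p => l s r [//|p] _; rewrite /tcell /=.
case: (ltngtP p W) => h.
- case: (ltngtP p.+1 W) => h' //; last by rewrite -h' subnn nth0.
  + by rewrite nth_behead; congr nth; lia.
  + by lia.
- have -> : p.+1 < W = false by lia.
  have -> : (p.+1 == W) = false by lia.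
  by have -> : p.+1 - W.+1 = (p - W.+1).+1 by lia.
- by rewrite -h ltnNge leqnSn /= gtn_eqF // subnn.
Qed.

Lemma tcell_right W t a p : tcell W (write_move t (a, MoveRight)) p =
  if p.+1 == W then a else tcell W t p.+1.
Proof.
case: t => l s r; rewrite /tcell /=.
case: (ltngtP p W) => h.
- case: (ltngtP p.+1 W) => h'; first by rewrite -[W - p.+1]prednK ?subn_gt0 //= -subnS.
  + by lia.
  + by rewrite -h' subnn.
- rewrite ltnNge ltnW ?leqW //= gtn_eqF 1?ltnW //; first by rewrite nth_behead; congr nth; lia.
- by rewrite h ltnNge leqnSn /= gtn_eqF // subnn nth0.
Qed.

Lemma tcell_stay W t a p : tcell W (write_move t (a, Stay)) p =
  if p == W then a else tcell W t p.
Proof. by case: t => l s r; rewrite /tcell /=; case: ltngtP. Qed.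

Lemma cellat_step W c p : 0 < p ->
  cellat W (step c) p =
  cellstep (cellat W c W) (cellat W c p.-1) (cellat W c p) (cellat W c p.+1).
Proof.
move=> hp; case: c => q ts; rewrite /cellstep /step /= eqxx.
case: ifP => // _.
have -> : [ffun i => tcell W (ts i) W] = [ffun i => scanned (ts i)].
  by apply/ffunP => i; rewrite !ffunE /tcell ltnn eqxx.
case: (delta _ _) => q' act; rewrite /cellat /=; congr (_, _); first by case: (p == W).
apply/ffunP => i; rewrite !ffunE; case: (act i) => a [] /=.
- by rewrite tcell_left //; case: (p.-1 == W); rewrite ?ffunE.
- by rewrite tcell_stay; case: (p == W); rewrite ?ffunE.
- by rewrite tcell_right; case: (p.+1 == W); rewrite ?ffunE.
Qed.

Definition inputsym (w : bits) (i : nat) : symbol (aux M) :=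
  if i < size w then Some (inl (nth false w i)) else None.

Definition initcell (ctr : bool) (a : symbol (aux M)) : cell :=
  (if ctr then Some (start M) else None, [ffun i => if i == ord0 then a else None]).

Lemma cellat_init W w p :
  cellat W (init M w) p =
  initcell (p == W) (if p < W then None else inputsym w (p - W)).
Proof.
rewrite /cellat /initcell; congr (_, _); apply/ffunP => i; rewrite !ffunE.
case: (i == ord0); last first.
  by rewrite /tcell /=; case: ltngtP => // _; rewrite nth_nil.
rewrite /tcell /inputsym /input_tape; case: (ltngtP p W) => h.
- by case: w => //= *; rewrite nth_nil.
- case: w => [|b w] /=; first by rewrite nth_nil.
  have -> : p - W = (p - W.+1).+1 by lia.
  rewrite ltnS; case: ltnP => hs /=; first by rewrite (nth_map false).
  by rewrite nth_default // size_map.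
- by rewrite h subnn; case: w.
Qed.

Definition isone (c : cell) : bool := c.2 ord0 == Some (inl true).

(** The bit added to the one-hot code makes each output bit of the machine available on a single
    wire. *)
Definition cbits (c : cell) : bits := rcons (onehot c) (isone c).

Definition cw : nat := #|cell|.

Definition readcell (f : nat -> bool) (o : nat) : cell :=
  unhot cell0 [seq f (o + i) | i <- iota 0 cw].

Lemma readcell_ext f g o : (forall i, i < cw -> f (o + i) = g (o + i)) ->
  readcell f o = readcell g o.
Proof.
move=> h; rewrite /readcell; congr unhot; apply/eq_in_map => i; rewrite mem_iota.
exact: h.
Qed.

Lemma readcellE f o c : (forall i, i < cw -> f (o + i) = nth false (cbits c) i) ->
  readcell f o = c.
Proof.
move=> h; rewrite /readcell -[RHS](onehotK cell0 c); congr unhot.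
apply: (@eq_from_nth _ false); first by rewrite size_map size_iota size_onehot.
move=> i; rewrite size_map size_iota => hi.
by rewrite (nth_map 0) ?size_iota // nth_iota // h // nth_rcons size_onehot hi.
Qed.

Definition stepexps : seq bexp :=
  [seq synth (4 * cw) (fun f => nth false (cbits (cellstep (readcell f 0)
     (readcell f cw) (readcell f (2 * cw)) (readcell f (3 * cw)))) b)
  | b <- iota 0 cw.+1].

(* The symbol of an initial cell is blank, a constant bit or the value of an
   input wire. *)
Definition source : finType := option (option bool).

Definition srcsym (s : source) (x : bool) : symbol (aux M) :=
  if s is Some s' then Some (inl (odflt x s')) else None.

Definition initexps (ctr : bool) (s : source) : seq bexp :=
  [seq synth 1 (fun f => nth false (cbits (initcell ctr (srcsym s (f 0)))) b)
  | b <- iota 0 cw.+1].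

(** The largest body among all templates: padded to it, all blocks have the same length [KK], and
    addresses are simple arithmetic. Dummy references are used here because [rhostep] depends on
    [K0]; sizes do not depend on references, by [bodysize_rho]. *)
Definition K0 : nat :=
  maxn (bodysize (fun=> (1, 0)) stepexps)
    (\max_(k : bool * source) bodysize (fun=> (1, 0)) (initexps k.1 k.2)).

(** Input [i] of a step block is bit [i %% cw] of the [i %/ cw]-th of the four cells read; bases are
    shifted by one, base 0 being the block itself. *)
Definition rhostep (i : nat) : tref := ((i %/ cw).+1, K0 + i %% cw).
Definition rhoinit (i : nat) : tref := (1, 0).

Lemma size_bcomp_rho rho rho' s e : size (bcomp rho s e) = size (bcomp rho' s e).
Proof.
by elim: e s => //= t e1 IH1 e2 IH2 s; rewrite !size_cat !IH1 IH2.
Qed.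

Lemma bodysize_rho rho rho' es : bodysize rho es = bodysize rho' es.
Proof.
rewrite /bodysize; elim: es 0 => //= e es IH s.
by rewrite !size_cat (size_bcomp_rho rho rho') IH.
Qed.

Definition tstep : seq tgate := template rhostep K0 stepexps.
Definition tinit (ctr : bool) (s : source) : seq tgate :=
  template rhoinit K0 (initexps ctr s).

Definition KK : nat := K0 + cw.+1.

Lemma bodysize_step : bodysize rhostep stepexps <= K0.
Proof. by rewrite (bodysize_rho _ (fun=> (1, 0))) leq_maxl. Qed.

Lemma bodysize_init ctr s : bodysize rhoinit (initexps ctr s) <= K0.
Proof.
rewrite (bodysize_rho _ (fun=> (1, 0))) (leq_trans _ (leq_maxr _ _)) //.
exact: (leq_bigmax (F := fun k : bool * source =>
  bodysize (fun=> (1, 0)) (initexps k.1 k.2)) (ctr, s)).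
Qed.

Lemma size_tstep : size tstep = KK.
Proof. by rewrite size_template ?bodysize_step // size_map size_iota. Qed.

Lemma size_tinit ctr s : size (tinit ctr s) = KK.
Proof. by rewrite size_template ?bodysize_init // size_map size_iota. Qed.

Definition cellenc (Wv : nat -> bool) (base : nat) (c : cell) : Prop :=
  forall b, b < cw.+1 -> Wv (base + (K0 + b)) = nth false (cbits c) b.

Lemma tstep_ok Wv self b0 bl b br c0 cl c cr :
  seg_ok Wv [:: self; b0; bl; b; br] 0 tstep ->
  cellenc Wv b0 c0 -> cellenc Wv bl cl -> cellenc Wv b c -> cellenc Wv br cr ->
  cellenc Wv self (cellstep c0 cl c cr).
Proof.
move=> hok h0 hl h hr j hj.
have := template_ok bodysize_step hok (j := j).
rewrite size_map size_iota => /(_ hj); rewrite /rwire /= => ->.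
rewrite (nth_map 0) ?size_iota // nth_iota // add0n.
have rd k bk ck f : k < 4 -> nth 0 [:: b0; bl; b; br] k = bk -> cellenc Wv bk ck ->
    (forall i, f i = Wv (nth 0 [:: self; b0; bl; b; br] (rhostep i).1 + (rhostep i).2)) ->
    readcell f (k * cw) = ck.
  move=> hk ek hck hf; apply: readcellE => i hi; rewrite hf /=.
  have c_gt0 : 0 < cw by apply: leq_ltn_trans hi.
  rewrite divnMDl // divn_small // addn0 modnMDl modn_small // ek.
  by apply: hck; rewrite ltnW.
rewrite beval_synth; last first.
  move=> f g hfg; congr (nth false (cbits _) j).
  by congr cellstep; apply: readcell_ext => i hi; apply: hfg; lia.
congr (nth false (cbits _) j).
have e0 := rd 0 b0 c0 _ isT erefl h0 (fun=> erefl); rewrite mul0n in e0.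
have e1 := rd 1 bl cl _ isT erefl hl (fun=> erefl); rewrite mul1n in e1.
by rewrite e0 e1 (rd 2 b c _ isT erefl h) // (rd 3 br cr _ isT erefl hr).
Qed.

Lemma tinit_ok Wv self u ctr s :
  seg_ok Wv [:: self; u] 0 (tinit ctr s) ->
  cellenc Wv self (initcell ctr (srcsym s (Wv u))).
Proof.
move=> hok j hj.
have := template_ok (bodysize_init ctr s) hok (j := j).
rewrite size_map size_iota => /(_ hj); rewrite /rwire /= => ->.
rewrite (nth_map 0) ?size_iota // nth_iota // add0n beval_synth; last first.
  by move=> f g /(_ 0 isT) ->.
by rewrite /= addn0.
Qed.

Lemma cw_gt0 : 0 < cw.
Proof. by apply/card_gt0P; exists cell0. Qed.

Lemma tstep_wf : seg_wf (fun r => 0 < r.1 <= 4 /\ r.2 < KK) 0 tstep.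
Proof.
apply: template_wf bodysize_step _ _; first by rewrite /KK addnS.
move=> j i; rewrite size_map size_iota => hj.
rewrite (nth_map 0) ?size_iota // => /bvars_synth hi; rewrite /rhostep /=; split.
  by rewrite ltn_divLR ?cw_gt0.
by rewrite /KK ltn_add2l ltnS ltnW // ltn_mod cw_gt0.
Qed.

Lemma tinit_wf ctr s : seg_wf (fun r => r = (1, 0)) 0 (tinit ctr s).
Proof. exact: template_wf (bodysize_init ctr s) _ _. Qed.

End Cells.

(** * Rows of blocks of equal length *)

Lemma nth_flatten_uniform (A : Type) (d : A) (f : nat -> seq A) K n i j :
  (forall i, size (f i) = K) -> i < n -> j < K ->
  nth d (flatten [seq f i | i <- iota 0 n]) (i * K + j) = nth d (f i) j.
Proof.
move=> hf hi hj; have -> : f i = f (0 + i) by rewrite add0n.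
elim: n 0 i hi => // n IH o [|i] hi /=; first by rewrite nth_cat hf mul0n add0n addn0 hj.
by rewrite nth_cat hf mulSn -addnA ltnNge leq_addr /= addKn IH // addSnnS.
Qed.

Lemma size_flatten_uniform (A : Type) (f : nat -> seq A) K n :
  (forall i, size (f i) = K) -> size (flatten [seq f i | i <- iota 0 n]) = n * K.
Proof.
by move=> hf; elim: n 0 => //= n IH o; rewrite size_cat hf IH mulSn.
Qed.

Section Tableau.
Variables (M : machine) (T nout nin : nat) (pre : bits).
Hypothesis nout_gt0 : 0 < nout.
Hypothesis nin_gt0 : 0 < nin.

(** The heads are at position [T] and the output occupies the [nout] cells from there on. Errors
    from the cut ends spread by one cell per step, so a margin of [T] cells on each side
    suffices. *)
Definition trow : nat := (T + (T + nout)).+1.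
Definition cbase (t p : nat) : nat := nin + (t * trow + p) * KK M.

Definition insrc (i : nat) : source :=
  if i < size pre then Some (Some (nth false pre i))
  else if i < size pre + nin then Some None else None.

Definition cellsrc (p : nat) : source := if p < T then None else insrc (p - T).

(** Cells that read no input refer to wire 0 by default, a legal reference because [nin] is
    positive; their source is a constant or blank. *)
Definition inwire (p : nat) : nat :=
  if p - T - size pre < nin then p - T - size pre else 0.

Definition initgates (p : nat) : seq gate :=
  [seq inst [:: cbase 0 p; inwire p] g | g <- tinit M (p == T) (cellsrc p)].

Definition stepgates (t p : nat) : seq gate :=
  [seq inst [:: cbase t p; cbase t.-1 T; cbase t.-1 p.-1; cbase t.-1 p; cbase t.-1 p.+1] g
  | g <- tstep M].

Definition cellgates (t p : nat) : seq gate :=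
  if t == 0 then initgates p else stepgates t p.

Definition tableau : seq gate :=
  flatten [seq flatten [seq cellgates t p | p <- iota 0 trow] | t <- iota 0 T.+1].

Definition outwire (i : nat) : nat := cbase T (T + i) + (K0 M + cw M).

Lemma size_cellgates t p : size (cellgates t p) = KK M.
Proof. by rewrite /cellgates; case: eqP => _; rewrite size_map ?size_tinit ?size_tstep. Qed.

Lemma size_row t : size (flatten [seq cellgates t p | p <- iota 0 trow]) = trow * KK M.
Proof. by apply: size_flatten_uniform => p; apply: size_cellgates. Qed.

Lemma size_tableau : size tableau = T.+1 * (trow * KK M).
Proof. by apply: size_flatten_uniform => t; apply: size_row. Qed.

Lemma KK_gt0 : 0 < KK M.
Proof. by rewrite /KK addnS. Qed.

Lemma nth_tableau t p i : t <= T -> p < trow -> i < KK M ->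
  nth g0 tableau ((t * trow + p) * KK M + i) = nth g0 (cellgates t p) i.
Proof.
move=> ht hp hi; rewrite mulnDl -addnA -mulnA /tableau.
rewrite (@nth_flatten_uniform _ _ (fun t => flatten [seq cellgates t p | p <- iota 0 trow])
  (trow * KK M)) //; last 2 first.
- by move=> t'; apply: size_row.
- apply: (@leq_trans (p.+1 * KK M)); first by rewrite mulSn addnC ltn_add2r.
  by rewrite leq_mul2r hp orbT.
by rewrite (@nth_flatten_uniform _ _ (cellgates t) (KK M)) //; apply: size_cellgates.
Qed.

Lemma tableau_index j : j < size tableau -> exists t p i,
  [/\ t <= T, p < trow, i < KK M & j = (t * trow + p) * KK M + i].
Proof.
rewrite size_tableau mulnA => hj.
exists (j %/ KK M %/ trow), (j %/ KK M %% trow), (j %% KK M).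
split; rewrite ?ltn_mod ?KK_gt0 -?divn_eq //.
by rewrite -ltnS ltn_divLR // ltn_divLR ?KK_gt0.
Qed.

Lemma tableau_wf j : j < size tableau ->
  (nth g0 tableau j).2.1 < nin + j /\ (nth g0 tableau j).2.2 < nin + j.
Proof.
move=> /tableau_index[t [p [i [ht hp hi ->]]]]; rewrite nth_tableau //.
set self := nin + _.
have selfE : self = cbase t p + i by rewrite /self /cbase addnA.
have key bases r (Q : tref -> Prop) : nth 0 bases 0 = cbase t p ->
    (forall r, Q r -> rwire bases r < self) -> ref_wf Q (0 + i) r -> rwire bases r < self.
  move=> h0 hQ [[r1 r2]|/hQ //].
  by rewrite /rwire r1 h0 selfE ltn_add2l.
rewrite /cellgates; case: eqP => t0.
  have hi' : i < size (tinit M (p == T) (cellsrc p)) by rewrite size_tinit.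
  have [w1 w2] := tinit_wf hi'; rewrite (nth_map tg0) //=.
  have hQ r : r = (1, 0) -> rwire [:: cbase 0 p; inwire p] r < self.
    move=> ->; rewrite /rwire /= addn0 /self.
    by apply: leq_trans (leq_addr _ _); rewrite /inwire; case: ifP.
  have e0 : cbase 0 p = cbase t p by rewrite t0.
  by split; [apply: key hQ w1|apply: key hQ w2].
have hi' : i < size (tstep M) by rewrite size_tstep.
have [w1 w2] := tstep_wf hi'; rewrite (nth_map tg0) //=.
have hQ r : 0 < r.1 <= 4 /\ r.2 < KK M -> rwire [:: cbase t p; cbase t.-1 T;
    cbase t.-1 p.-1; cbase t.-1 p; cbase t.-1 p.+1] r < self.
  have hb t' p' o : t' * trow + p' < t * trow + p -> o < KK M -> cbase t' p' + o < self.
    move=> h ho; rewrite selfE /cbase -!addnA ltn_add2l.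
    apply: (@leq_trans ((t' * trow + p').+1 * KK M)).
      by rewrite mulSn addnC ltn_add2r.
    by apply: leq_trans (leq_addr _ _); rewrite leq_mul2r h orbT.
  have ht1 : t * trow = t.-1 * trow + trow by rewrite -{1}(prednK (n := t)) ?mulSn 1?addnC //; lia.
  case: r => k o /= [hk ho]; rewrite /rwire /=.
  have hT : T < trow by rewrite /trow; lia.
  (* At the right end of a row, [p.+1] falls on the first block of row [t]. It precedes block [p] as
     a row has at least two cells, so the gates stay in topological order even where the contents
     are meaningless. *)
  have h2 : 1 < trow by rewrite /trow; lia.
  case: k hk => [|[|[|[|[|k]]]]] //= _; apply: hb => //; rewrite ht1; lia.
by split; [apply: key hQ w1|apply: key hQ w2].
Qed.

Section Correct.
Variable Wv : nat -> bool.
Hypothesis ok : consistent nin tableau Wv.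

Let w : bits := pre ++ [seq Wv i | i <- iota 0 nin].

Lemma block_ok t p bases tm : t <= T -> p < trow -> size tm = KK M ->
  nth 0 bases 0 = cbase t p -> cellgates t p = [seq inst bases g | g <- tm] ->
  seg_ok Wv bases 0 tm.
Proof.
move=> ht hp hs hb hc i; rewrite hs => hi g.
have hj : (t * trow + p) * KK M + i < size tableau.
  rewrite size_tableau mulnA; apply: (@leq_trans ((t * trow + p).+1 * KK M)).
    by rewrite mulSn addnC ltn_add2r.
  rewrite leq_mul2r; apply/orP; right.
  apply: (@leq_trans (t * trow + trow)); first by rewrite -addnS leq_add2l.
  by rewrite addnC -mulSn leq_mul2r ltnS ht orbT.
have := ok hj; rewrite nth_tableau // hc (nth_map tg0) ?hs // add0n /rwire /= hb.
by rewrite /cbase addnA.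
Qed.

Lemma size_w : size w = size pre + nin.
Proof. by rewrite size_cat size_map size_iota. Qed.

Lemma insrc_sym i : inputsym M w i =
  srcsym M (insrc i) (Wv (if i - size pre < nin then i - size pre else 0)).
Proof.
rewrite /inputsym /insrc size_w nth_cat; case: (ltnP i (size pre)) => h1.
  by rewrite ltn_addr.
case: ltnP => h2 //=.
have h3 : i - size pre < nin by lia.
by rewrite h3 (nth_map 0) ?size_iota // nth_iota.
Qed.

(* A row is cut off at both ends, so only the cells that no information from
   outside can have reached by time [t] are right. *)
Lemma tableau_cell t p : t <= T -> t <= p -> p + t < trow ->
  cellenc Wv (cbase t p) (cellat T (iter t (@step M) (init M w)) p).
Proof.
elim: t p => [|t IH] p ht tp hp.
  rewrite addn0 in hp; rewrite /= cellat_init.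
  have hs := block_ok (bases := [:: cbase 0 p; inwire p]) ht hp (size_tinit M (p == T) (cellsrc p)) erefl erefl.
  have := tinit_ok hs; rewrite /cellsrc /inwire; case: ltnP => // hpT.
  by rewrite insrc_sym.
rewrite iterS cellat_step; last by apply: leq_trans tp.
have hp' : p < trow by apply: leq_ltn_trans hp; rewrite leq_addr.
have hT : T < trow by rewrite /trow; lia.
have hs := block_ok (bases := [:: cbase t.+1 p; cbase t T; cbase t p.-1; cbase t p;
  cbase t p.+1]) ht hp' (size_tstep M) erefl erefl.
apply: tstep_ok hs _ _ _ _; apply: IH; try lia.
by rewrite /trow; lia.
Qed.

(** A halted configuration no longer changes, so the last row shows the result even if the machine
    halts before time [T]. *)
Lemma tableau_out v i : computes_within M w v T -> i < nout -> i < size v ->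
  Wv (outwire i) = nth false v i.
Proof.
move=> [n hn [hh hv]] hi hiv.
have := @tableau_cell T (T + i) (leqnn _) (leq_addr _ _).
have -> : T + i + T < trow by rewrite /trow; lia.
move=> /(_ isT) /(_ (cw M) (ltnSn _)); rewrite /outwire => ->.
rewrite nth_rcons size_onehot ltnn eqxx.
have -> : iter T (@step M) (init M w) = iter n (@step M) (init M w).
  by rewrite -(subnK hn) iterD step_halted.
rewrite -hv in hiv *; move: hiv; rewrite /isone /cellat /= ffunE /output_of.
move: ((iter n (@step M) (init M w)).2 ord0) => t.
have -> : tcell T t (T + i) = nth None (scanned t :: right_of t) i.
  rewrite /tcell ltnNge leq_addr /= -[X in _ == X]addn0 eqn_add2l.
  by case: i {hi} => //= i; congr nth; lia.
move: (scanned t :: right_of t) => l; clear hi.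
elim: l i => [|[[b|s]|] l IH] [|i] //= hi.
exact: IH.
Qed.

End Correct.
End Tableau.

(** * Generating the formula *)

Ltac fpc := repeat first
  [ fp1
  | match goal with h : @FP ?B ?C ?eB ?eC ?g |- @FP ?A _ ?eA _ _ =>
      eapply (FP_comp (A := A) (eA := eA) (B := B) (eB := eB) (C := C) (eC := eC)
        (g := g)); [|exact h] end
  | match goal with h : @FP (?B * ?C) ?D (Enc_prod ?eB ?eC) ?eD (fun p => ?g p.1 p.2)
        |- @FP ?A _ ?eA _ _ =>
      eapply (FP_comp2 (A := A) (eA := eA) (B := B) (eB := eB) (C := C) (eC := eC)
        (D := D) (eD := eD) (h := g)); [exact h| |] end ].

Lemma FP_tableau `{eA : Enc A} M (T nout nin : A -> nat) (pre : A -> bits) :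
  FP T -> FP nout -> FP nin -> FP pre ->
  FP (fun a => tableau M (T a) (nout a) (nin a) (pre a)).
Proof.
move=> hT hnout hnin hpre.
have htr : FP (fun a => trow (T a) (nout a)) by rewrite /trow; fpc.
have hcb : FP (fun p : A * (nat * nat) =>
    cbase M (T p.1) (nout p.1) (nin p.1) p.2.1 p.2.2).
  by rewrite /cbase; fpc.
have hin : FP (fun p : A * nat => inwire (T p.1) (nin p.1) (pre p.1) p.2).
  by rewrite /inwire; fpc.
have hti : FP (fun p : A * nat =>
    tinit M (p.2 == T p.1) (cellsrc (T p.1) (nin p.1) (pre p.1) p.2)).
  (* Templates are constants of the machine, so choosing one is a case distinction among finitely
     many constant functions, according to position and source. *)
  pose sel (p : A * nat) s := if p.2 == T p.1 then tinit M true s else tinit M false s.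
  have hsel s : FP (fun p => sel p s) by rewrite /sel /tgate /tref; fpc.
  apply: (@FP_ext _ _ _ _ (fun p : A * nat =>
    if p.2 < T p.1 then sel p None
    else if p.2 - T p.1 < size (pre p.1) then
      if nth false (pre p.1) (p.2 - T p.1) then sel p (Some (Some true))
      else sel p (Some (Some false))
    else if p.2 - T p.1 < size (pre p.1) + nin p.1 then sel p (Some None) else sel p None)).
    move=> p; rewrite /sel /cellsrc /insrc.
    case: (p.2 < T p.1); first by case: eqP.
    case: (p.2 - T p.1 < size _); first by case: (nth _ _ _); case: eqP.
    by case: (p.2 - T p.1 < _); case: eqP.
  have h1 := hsel None; have h2 := hsel (Some (Some true)).
  have h3 := hsel (Some (Some false)); have h4 := hsel (Some None).
  by repeat (apply: FP_if => //); rewrite /tgate /tref; fpc.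
have hcb' (t p : A * (nat * nat) -> nat) : FP t -> FP p -> FP (fun q =>
    cbase M (T q.1) (nout q.1) (nin q.1) (t q) (p q)).
  move=> ht hp; apply: FP_comp (FP_pair (FP_fst FP_id) (FP_pair ht hp)) hcb.
have hinst (bases : A * (nat * nat) -> seq nat) (tm : A * (nat * nat) -> seq tgate) :
    FP bases -> FP tm -> FP (fun q => [seq inst (bases q) g | g <- tm q]).
  move=> hb htm; apply: (FP_map (g := fun q (g : tgate) => inst (bases q) g)) => //.
  rewrite /tgate /tref /inst /rwire; apply: FP_pair; first by fp.
  have hr (r : A * (nat * nat) * (bits * ((nat * nat) * (nat * nat))) -> nat * nat) :
      FP r -> FP (fun z => nth 0 (bases z.1) (r z).1 + (r z).2).
    move=> h; apply: FP_addn; last exact: FP_snd h.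
    by apply: FP_nth; [exact: FP_comp (FP_fst FP_id) hb|exact: FP_fst h].
  by apply: FP_pair; apply: hr; fp.
have hcg : FP (fun q : A * (nat * nat) =>
    cellgates M (T q.1) (nout q.1) (nin q.1) (pre q.1) q.2.1 q.2.2).
  rewrite /cellgates; apply: FP_if; first by fpc.
    apply: hinst; last first.
      exact: FP_comp (FP_pair (FP_fst FP_id) (FP_snd (FP_snd FP_id))) hti.
    apply: FP_cons; first by apply: hcb'; fpc.
    apply: FP_cons; last exact: FP_const.
    exact: FP_comp (FP_pair (FP_fst FP_id) (FP_snd (FP_snd FP_id))) hin.
  apply: hinst; last exact: FP_const.
  by do 5!(apply: FP_cons; first by apply: hcb'; fpc); exact: FP_const.
rewrite /tableau /gate; apply: FP_flatten.
apply: (FP_map (g := fun a t => flatten [seq cellgates M (T a) (nout a) (nin a) (pre a) t p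
  | p <- iota 0 (trow (T a) (nout a))])); first by fpc.
apply: FP_flatten.
apply: (FP_map (g := fun (q : A * nat) p => cellgates M (T q.1) (nout q.1) (nin q.1)
  (pre q.1) q.2 p)).
  apply: FP_iota0; exact: FP_comp (FP_fst FP_id) htr.
exact: FP_comp (FP_pair (FP_fst (FP_fst FP_id)) (FP_pair (FP_snd (FP_fst FP_id)) (FP_snd FP_id))) hcg.
Qed.

Lemma FP_gadget `{eA : Enc A} (m nin : A -> nat) (gates : A -> seq gate)
    (outs : A -> nat -> nat) :
  FP m -> FP nin -> FP gates -> FP (fun p : A * nat => outs p.1 p.2) ->
  FP (fun a => gadget (m a) (nin a) (gates a) (outs a)).
Proof.
rewrite /gadget /gate => hm hnin hg ho.
have hnw : FP (fun a => nw (nin a) (gates a)) by rewrite /nw /gate; fpc.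
have hwv : FP (fun p : A * (bool * nat) => wvar (m p.1) (nin p.1) (gates p.1) p.2.1 p.2.2).
  by rewrite /wvar; fpc.
have hwv' : forall (E : Type) (eE : Enc E) (a : E -> A) (c : E -> bool) (w : E -> nat),
    FP a -> FP c -> FP w -> FP (fun e => wvar (m (a e)) (nin (a e)) (gates (a e)) (c e) (w e)).
  by move=> E eE a c w ha hc hw; apply: FP_comp (FP_pair ha (FP_pair hc hw)) hwv.
have hn : FP (fun p : A * nat => nth g0 (gates p.1) p.2) by rewrite /g0; fpc.
have hcl : FP (fun p : A * (nat * (bool * (bool * bool))) =>
    gclause (m p.1) (nin p.1) (gates p.1) p.2.1 p.2.2).
  have hn' : FP (fun p : A * (nat * (bool * (bool * bool))) => nth g0 (gates p.1) p.2.1).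
    exact: FP_comp (FP_pair (FP_fst FP_id) (FP_fst (FP_snd FP_id))) hn.
  have hgv : FP (fun p : A * (nat * (bool * (bool * bool))) =>
      gval (nth g0 (gates p.1) p.2.1) p.2.2.2.1 p.2.2.2.2).
    apply: (@FP_ext _ _ _ _ (fun p : A * (nat * (bool * (bool * bool))) =>
      nth false (nth g0 (gates p.1) p.2.1).1
        ((if p.2.2.2.1 then 2 else 0) + (if p.2.2.2.2 then 1 else 0)))).
      by move=> p; rewrite /gval; case: p.2.2.2.1; case: p.2.2.2.2.
    by apply: FP_nthb; [apply: FP_fst; exact: hn'|fpc].
  rewrite /gclause /clause /literal.
  apply: FP_cons; first by apply: FP_pair; [apply: hwv'; fpc; exact: hn'|fpc].
  apply: FP_cons; first by apply: FP_pair; [apply: hwv'; fpc; exact: hn'|fpc].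
  apply: FP_cons; last exact: FP_const.
  by apply: FP_pair; [apply: hwv'; fpc|exact: hgv].
have hall (l : A -> seq nat) (pr : seq (bool * (bool * bool)))
    (g : A * (nat * (bool * (bool * bool))) -> clause) : FP l -> FP g ->
    FP (fun a => [seq g (a, (j, p)) | j <- l a, p <- pr]).
  move=> hl hg'; apply: FP_flatten; apply: (FP_map (g := fun a j =>
    [seq g (a, (j, p)) | p <- pr])) => //.
  apply: (FP_map (g := fun (q : A * nat) p => g (q.1, (q.2, p)))); first exact: FP_const.
  exact: FP_comp (FP_pair (FP_fst (FP_fst FP_id)) (FP_pair (FP_snd (FP_fst FP_id)) (FP_snd FP_id))) hg'.
have hsz : FP (fun a => iota 0 (size (gates a))) by fpc.
apply: FP_cat.
  apply: (hall _ bools3 (fun q => cgclause (m q.1) (nin q.1) (gates q.1) q.2.1 q.2.2)) => //.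
  by rewrite /cgclause /clause /literal; apply: FP_cons; [fpc|exact: hcl].
apply: FP_cat.
  apply: FP_flatten; apply: (FP_map (g := fun a i => [:: jclause (m a) (nin a) (gates a) (outs a) i false;
    jclause (m a) (nin a) (gates a) (outs a) i true; vclause i])); first by fpc.
  rewrite /jclause /vclause /clause /literal.
  have hj c : FP (fun p : A * nat => wvar (m p.1) (nin p.1) (gates p.1) c (outs p.1 p.2)).
    by apply: hwv'; fpc.
  have h1 := hj true; have h2 := hj false.
  by repeat (first [exact: h1 | exact: h2 | fp1]).
apply: FP_cat; last first.
  exact: (hall _ bools3 (fun q => gclause (m q.1) (nin q.1) (gates q.1) q.2.1 q.2.2)).
apply: FP_flatten; apply: (FP_map (g := fun a j =>
  [seq kclause (m a) (nin a) (gates a) (outs a) j p | p <- bools2])); first by fpc.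
apply: (FP_map (g := fun (q : A * nat) p =>
  kclause (m q.1) (nin q.1) (gates q.1) (outs q.1) q.2 p)); first exact: FP_const.
have h1 : FP (fun q : A * nat * (bool * bool) =>
    wvar (m q.1.1) (nin q.1.1) (gates q.1.1) (~~ q.2.1) q.1.2) by apply: hwv'; fpc.
have h2 : FP (fun q : A * nat * (bool * bool) =>
    wvar (m q.1.1) (nin q.1.1) (gates q.1.1) q.2.1 (outs q.1.1 (m q.1.1 + q.1.2))).
  apply: hwv'; [by fpc|by fpc|].
  have h3 : FP (fun q : A * nat * (bool * bool) => (q.1.1, m q.1.1 + q.1.2)) by fpc.
  exact: FP_comp h3 ho.
rewrite /kclause /clause /literal.
by repeat (first [exact: h1 | exact: h2 | fp1]).
Qed.

Lemma FP_encode_cnf : FP encode_cnf.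
Proof.
have hl : FP encode_literal.
  apply: (@FP_ext _ _ _ _ (fun l : nat * bool => nseq (l.1 + l.1) false ++ [:: ~~ l.2; l.2])).
    by move=> l; rewrite /encode_literal addnn.
  by fp.
have hc : FP encode_clause.
  rewrite /encode_clause /clause /literal; apply: FP_catb; last exact: FP_const.
  apply: FP_flattenb; apply: (FP_map (g := fun _ l => encode_literal l)) FP_id _.
  exact: FP_comp (FP_snd FP_id) hl.
rewrite /encode_cnf /cnf /clause /literal.
apply: FP_flattenb; apply: (FP_map (g := fun _ l => encode_clause l)) FP_id _.
exact: FP_comp (FP_snd FP_id) hc.
Qed.

(** * Comparing numbers in binary *)

Lemma nat_of_bits_lt u : nat_of_bits u < 2 ^ size u.
Proof. by elim: u => //= b u IH; rewrite expnS; case: b; lia. Qed.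

(** Complementing the bits of a padded payoff turns minimization into maximization. *)
Lemma nat_of_bits_map_negb u : nat_of_bits (map negb u) + nat_of_bits u = (2 ^ size u).-1.
Proof.
elim: u => //= b u IH; have := nat_of_bits_lt u; rewrite expnS.
by case: b => /=; lia.
Qed.

Lemma nat_of_bits_pad u k : nat_of_bits (u ++ nseq k false) = nat_of_bits u.
Proof. by elim: u => /= [|b u ->] //; elim: k => //= k ->. Qed.

(** Scans from the least significant bit on; every difference overrides the verdict, so the most
    significant one decides. *)
Definition ltbits (n : nat) (u v : bits) : bool :=
  foldl (fun r i => if nth false u i == nth false v i then r else nth false v i)
    false (iota 0 n).

Lemma ltbitsP u v : size u = size v ->
  ltbits (size u) u v = (nat_of_bits u < nat_of_bits v).
Proof.
rewrite /ltbits; elim/last_ind: u v => [|u x IH] v; first by case: v.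
case/lastP: v => [|v y]; rewrite !size_rcons // => -[hs].
rewrite -addn1 iotaD foldl_cat /= add0n !nth_rcons hs ltnn eqxx.
set r := foldl _ _ _; have -> : r = (nat_of_bits u < nat_of_bits v).
  rewrite -IH // hs /r; have : all (fun i => i < size v) (iota 0 (size v)).
    by apply/allP => i; rewrite mem_iota.
  move: (iota 0 _) => l hl.
  have : forall b0, foldl (fun r i => if nth false (rcons u x) i == nth false (rcons v y) i
      then r else nth false (rcons v y) i) b0 l =
    foldl (fun r i => if nth false u i == nth false v i then r else nth false v i) b0 l.
    elim: l hl => //= i l IHl /andP[hi hl] b0.
    by rewrite !nth_rcons hs hi IHl.
  exact.
have := nat_of_bits_lt u; have := nat_of_bits_lt v.
rewrite !nat_of_bits_rcons hs.
by clear r; case: x; case: y => /=; lia.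
Qed.

Lemma first_difference U V : size U = size V ->
  nat_of_bits (rev U) < nat_of_bits (rev V) ->
  exists i, [/\ i < size U, forall j, j < i -> nth false U j = nth false V j,
    ~~ nth false U i & nth false V i].
Proof.
elim: U V => [|x U IH] [|y V] //= [hs]; rewrite !rev_cons !nat_of_bits_rcons !size_rev hs.
have [<-|xy] := eqVneq x y.
  rewrite ltn_add2r => /(IH V hs)[i [hi h1 h2 h3]].
  exists i.+1; split=> //; first by rewrite ltnS -hs.
  by case=> //= j /h1.
move=> h; exists 0; split=> //=.
  by case: x xy h => //; case: y => //=; have := nat_of_bits_lt (rev V); rewrite size_rev; lia.
by case: x xy h => //; case: y => //=; have := nat_of_bits_lt (rev V); rewrite size_rev; lia.
Qed.

(** * Decoding sequences *)

Definition unseq_step (q : bits * seq bits) : bits * seq bits :=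
  if nilp q.1 then q else ((unpair q.1).2, (unpair q.1).1 :: q.2).

(** Every element uses at least one bit, so [size w] rounds suffice. *)
Definition unseq (w : bits) : seq bits := rev (iter (size w) unseq_step (w, [::])).2.

Lemma unseqK ss : unseq (seq_code ss) = ss.
Proof.
rewrite /unseq; suff h n acc : size ss <= n ->
    iter n unseq_step (seq_code ss, acc) = ([::], catrev ss acc).
  rewrite h ?catrevE ?cats0 ?revK //; elim: (ss) => //= s ss' IH.
  by rewrite /seq_code /= -/(seq_code ss') size_cat /self_delim size_cat /=; lia.
elim: n ss acc => [|n IH] [|s ss] acc //= hn.
  by rewrite -iterS iterSr IH.
rewrite -iterS iterSr /unseq_step -/unseq_step /=.
have -> : seq_code (s :: ss) = pair_code s (seq_code ss) by [].
by rewrite unpairK /nilp size_pair_code /= IH.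
Qed.

Lemma FP_unseq : FP unseq.
Proof.
apply: FP_rev; apply: FP_snd.
apply: (FP_iterb (s := fun _ => unseq_step)) FP_id _ _ _.
- have h : FP (fun p : bits * (bits * seq bits) => unpair p.2.1).
    exact: FP_comp (FP_fst (FP_snd FP_id)) FP_unpair.
  by rewrite /unseq_step; apply: FP_if; fp.
- exact: FP_pair FP_id (FP_const _).
polyk (fun n => (6 * n).+1); exists K => w i hi; apply: leq_trans (hK _).
(* An element moved to the accumulator is coded with two bits per bit and a terminator; weighting
   the remaining word by 2 makes the sum grow by at most one per round. *)
suff : 2 * size (iter i unseq_step (w, [::])).1 +
    size (@code (seq bits) (@Enc_seq bits Enc_bits) (iter i unseq_step (w, [::])).2)
    <= 2 * size w + i.
  rewrite size_code_pair; move: (iter i unseq_step _) => q.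
  rewrite -[size (code q.1)]/(size q.1) -[size (code w)]/(size w); lia.
elim: i {hi} => [|i IH] /=; first by rewrite addn0.
move: (iter i _ _) IH => q IH; rewrite /unseq_step; case: (nilp _); first lia.
rewrite /= size_code_cons /code /Enc_bits; have := size_unpair q.1.
by move: IH; rewrite /code /Enc_bits; lia.
Qed.

(** * The reduction *)

Lemma FP_ltbits `{eA : Enc A} (n : A -> nat) (u v : A -> bits) :
  FP n -> FP u -> FP v -> FP (fun a => ltbits (n a) (u a) (v a)).
Proof.
move=> hn hu hv; have hi : FP (fun a => iota 0 (n a)) by fp.
apply: (FP_foldl (f := fun a (r : bool) i => if nth false (u a) i == nth false (v a) i
  then r else nth false (v a) i)) (hi) _ (FP_const false) _.
  by fpc.
exists 1 => a i; rewrite /pb expn1 addn2; exact: leqW.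
Qed.

Section Reduction.
Variable P : local_search.
Variables (r st0 pay h : bits -> bits) (cs ks kp : nat).
Hypothesis r_FP : FP r.
Hypothesis st0_FP : FP st0.
Hypothesis pay_FP : FP pay.
Hypothesis h_FP : FP h.
Hypothesis rP : forall x s, instance P x ->
  (r (pair_code x s) = [:: true] <-> feasible P x s).
Hypothesis st0P : forall x, instance P x -> feasible P x (st0 x).
Hypothesis sizeP : forall x s, instance P x -> feasible P x s ->
  size s <= cs * size x ^ ks + cs.
Hypothesis payP : forall x s, instance P x -> feasible P x s ->
  nat_of_bits (pay (pair_code x s)) = payoff P x s.
Hypothesis size_pay : forall w, size (pay w) <= pb kp (size w).
Hypothesis neighP : forall x s s', instance P x -> feasible P x s -> neighbor P x s s' ->
  feasible P x s'.
Hypothesis hP : forall x s, instance P x -> feasible P x s ->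
  exists2 ss : seq bits, h (pair_code x s) = seq_code ss &
    forall s', s' \in ss <-> neighbor P x s s'.

Definition qsz (x : bits) : nat := cs * size x ^ ks + cs.
(** The length of [rawcode]: a solution takes two bits per bit and one terminator, and the padding
    fills it up to twice the bound [qsz x]. *)
Definition rin (x : bits) : nat := (qsz x + qsz x).+1.
(** The output bound of the payoff algorithm at the largest size of [pair_code x s], so that all
    payoffs for [x] fit in the same number of bits. *)
Definition plen (x : bits) : nat := ((size x + size x + qsz x).+1 + 2) ^ kp.

Definition feas (p : bits * bits) : bool :=
  head false (r (pair_code p.1 p.2)) && nilp (behead (r (pair_code p.1 p.2))).

(* The value of a solution, least significant bit first: infeasible solutions
   have value 0, and the payoff is complemented when it is to be minimized. *)
Definition value (p : bits * bits) : bits :=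
  if feas p then
    [seq nth false (pay (pair_code p.1 p.2)) i == maximize P | i <- iota 0 (plen p.1)]
      ++ [:: true]
  else nseq (plen p.1).+1 false.

Definition nbhd (p : bits * bits) : seq bits := unseq (h (pair_code p.1 p.2)).

Definition succ (p : bits * bits) : bits :=
  if feas p then
    head [::] ([seq s' <- nbhd p | ltbits (plen p.1).+1 (value p) (value (p.1, s'))]
      ++ [:: p.2])
  else st0 p.1.

(* The circuit has a fixed number of inputs: [s] is coded self-delimitingly and
   padded to [rin x] bits. *)
Definition rawcode (x s : bits) : bits :=
  pair_code s (nseq (qsz x + qsz x - (size s + size s)) false).

(** The function turned into a circuit. The value comes first, most significant bit first, as the
    display requires; the next [rin] bits are in the format of the inputs, so that they can be
    copied to the other copy. *)
Definition evalsol (w : bits) : bits :=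
  let p := ((unpair w).1, (unpair (unpair w).2).1) in
  rev (value p) ++ rawcode p.1 (succ p).

(** * Values and successors in polynomial time *)

Lemma FP_qsz : FP qsz.
Proof. by rewrite /qsz; fp. Qed.

Lemma FP_plen : FP plen.
Proof. by have hq := FP_qsz; rewrite /plen; fp. Qed.

Lemma FP_pc : FP (fun p : bits * bits => pair_code p.1 p.2).
Proof. exact: FP_recode. Qed.

Lemma FP_feas : FP feas.
Proof.
have hr : FP (fun p : bits * bits => r (pair_code p.1 p.2)) by exact: FP_comp FP_pc r_FP.
by rewrite /feas; fp.
Qed.

Lemma FP_value : FP value.
Proof.
have hf := FP_feas; have hpl := FP_plen.
have hp : FP (fun p : bits * bits => pay (pair_code p.1 p.2)) by exact: FP_comp FP_pc pay_FP.
have hpl1 : FP (fun p : bits * bits => plen p.1) by fpc.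
rewrite /value; apply: FP_if => //; last by fp.
apply: FP_catb; last exact: FP_const.
apply: (FP_mapb (g := fun (p : bits * bits) i =>
  nth false (pay (pair_code p.1 p.2)) i == maximize P)); first by fp.
apply: FP_eqb; last exact: FP_const.
by apply: FP_nthb; [exact: FP_comp (FP_fst FP_id) hp|fp].
Qed.

Lemma FP_succ : FP succ.
Proof.
have hf := FP_feas; have hv := FP_value.
have hpl1 : FP (fun p : bits * bits => plen p.1).
  exact: FP_comp (FP_fst FP_id) FP_plen.
have hn : FP nbhd by exact: FP_comp (FP_comp FP_pc h_FP) FP_unseq.
rewrite /succ; apply: FP_if => //; last exact: FP_comp (FP_fst FP_id) st0_FP.
apply: FP_head; apply: FP_cat; last by fp.
apply: (FP_filter (g := fun (p : bits * bits) s' =>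
  ltbits (plen p.1).+1 (value p) (value (p.1, s')))) => //.
apply: FP_ltbits.
- by apply: FP_S; exact: FP_comp (FP_fst FP_id) hpl1.
- exact: FP_comp (FP_fst FP_id) hv.
- exact: FP_comp (FP_pair (FP_fst (FP_fst FP_id)) (FP_snd FP_id)) hv.
Qed.

Lemma FP_evalsol : FP evalsol.
Proof.
have hp : FP (fun w => ((unpair w).1, (unpair (unpair w).2).1)).
  apply: FP_pair FP_unpair1 _; exact: FP_comp FP_unpair2 FP_unpair1.
have hev : FP (fun p : bits * bits => rev (value p) ++ rawcode p.1 (succ p)).
  have hv := FP_value; have hs := FP_succ; have hq := FP_qsz.
  apply: FP_catb; first by fp.
  have h3 : FP (fun p : bits * bits => (succ p,
      nseq (qsz p.1 + qsz p.1 - (size (succ p) + size (succ p))) false)) by fpc.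
  exact: FP_comp h3 FP_pc.
exact: FP_comp hp hev.
Qed.

Lemma size_value p : size (value p) = (plen p.1).+1.
Proof.
rewrite /value; case: ifP => _; last by rewrite size_nseq.
by rewrite size_cat size_map size_iota addn1.
Qed.

Lemma size_rawcode x s : rin x <= size (rawcode x s).
Proof. by rewrite size_pair_code size_nseq /rin; lia. Qed.

Lemma size_rawcode_eq x s : size s <= qsz x -> size (rawcode x s) = rin x.
Proof. by move=> hs; rewrite size_pair_code size_nseq /rin; lia. Qed.

Lemma size_evalsol w : (plen (unpair w).1).+1 + rin (unpair w).1 <= size (evalsol w).
Proof. by rewrite /evalsol size_cat size_rev size_value leq_add2l size_rawcode. Qed.

Lemma feasP x s : instance P x -> feas (x, s) <-> feasible P x s.
Proof.
move=> hx; rewrite -(rP _ hx) /feas /=.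
by case: (r _) => [|[] [|b w]].
Qed.

Lemma pay_small x s : size s <= qsz x -> size (pay (pair_code x s)) <= plen x.
Proof.
move=> hs; apply: leq_trans (size_pay _) _; rewrite size_pair_code.
by apply: (@pb_mono kp); lia.
Qed.

(** The summand [2 ^ plen x] is the leading bit [true]; it puts feasible solutions of payoff 0 above
    the infeasible ones too. *)
Lemma value_feas x s : instance P x -> feasible P x s ->
  nat_of_bits (value (x, s)) = 2 ^ plen x +
    (if maximize P then payoff P x s else (2 ^ plen x).-1 - payoff P x s) /\
  payoff P x s < 2 ^ plen x.
Proof.
move=> hx hs; have hf := (feasP s hx).2 hs; rewrite /value hf /= cats1 nat_of_bits_rcons.
set w := pay _; have hw : size w <= plen x by apply/pay_small/sizeP.
rewrite size_map size_iota mul1n addnC; rewrite -(payP hx hs) -/w.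
have e : [seq nth false w i | i <- iota 0 (plen x)] = w ++ nseq (plen x - size w) false.
  apply: (@eq_from_nth _ false).
    by rewrite size_map size_iota size_cat size_nseq subnKC.
  move=> i; rewrite size_map size_iota => hi.
  rewrite (nth_map 0) ?size_iota // nth_iota // nth_cat nth_nseq if_same.
  by case: ltnP => // hiw; rewrite nth_default.
have ew : nat_of_bits [seq nth false w i | i <- iota 0 (plen x)] = nat_of_bits w.
  by rewrite e nat_of_bits_pad.
have lt : nat_of_bits w < 2 ^ plen x.
  by apply: leq_trans (nat_of_bits_lt w) _; rewrite leq_exp2l.
split=> //; congr (_ + _); case: (maximize P).
  by rewrite -ew; congr nat_of_bits; apply: eq_map => i; case: (nth _ _ _).
have := nat_of_bits_map_negb [seq nth false w i | i <- iota 0 (plen x)].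
rewrite -map_comp ew size_map size_iota => <-.
rewrite addnK; congr nat_of_bits; apply: eq_map => i /=; by case: (nth _ _ _).
Qed.

Lemma value_better x s s' : instance P x -> feasible P x s -> feasible P x s' ->
  better P x s s' -> nat_of_bits (value (x, s)) < nat_of_bits (value (x, s')).
Proof.
move=> hx hs hs'; have [-> l1] := value_feas hx hs; have [-> l2] := value_feas hx hs'.
by rewrite /better ltn_add2l; case: (maximize P) => //; lia.
Qed.

(** Needed for every word [s], feasible or not: it guarantees that the successor is short enough to
    fit into the inputs of a copy. *)
Lemma feasible_succ x s : instance P x -> feasible P x (succ (x, s)).
Proof.
move=> hx; rewrite /succ /=; case: ifP => [/(feasP s hx) hs|_]; last exact: st0P.
have [ss hss mem_ss] := hP hx hs.
rewrite /nbhd /= hss unseqK; case e: [seq _ <- _ | _] => [|s' l] //=.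
have : s' \in s' :: l by rewrite mem_head.
by rewrite -e mem_filter => /andP[_ /mem_ss]; apply: neighP.
Qed.

(** An infeasible [s] has value 0, less than that of the starting solution. For a feasible [s], an
    improving neighbour makes the filtered list nonempty, and its head is then a strictly better
    successor. *)
Lemma local_opt_of_succ x s : instance P x ->
  nat_of_bits (value (x, succ (x, s))) <= nat_of_bits (value (x, s)) -> local_opt P x s.
Proof.
move=> hx le; have hfs := feasible_succ s hx.
have hs : feasible P x s.
  apply/(feasP s hx)/negPn/negP => nf; move: le; rewrite {2}/value (negbTE nf).
  have [-> _] := value_feas hx hfs.
  have -> k : nat_of_bits (nseq k false) = 0 by elim: k => //= k ->.
  by rewrite leqn0 addn_eq0 expn_eq0.
split=> // s' fs' ns' bs'.
have lt := value_better hx hs fs' bs'.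
have sz u : size (value (x, u)) = (plen x).+1 by rewrite size_value.
have ltE u : ltbits (plen x).+1 (value (x, s)) (value (x, u)) =
    (nat_of_bits (value (x, s)) < nat_of_bits (value (x, u))).
  by rewrite -ltbitsP !sz.
have [ss hss mem_ss] := hP hx hs.
move: le; rewrite /succ (feasP s hx).2 //= /nbhd /= hss unseqK leqNgt => /negP; apply.
have : s' \in [seq s' <- ss | ltbits (plen x).+1 (value (x, s)) (value (x, s'))].
  by rewrite mem_filter ltE lt; apply/mem_ss.
case e: [seq _ <- _ | _] => [|s1 l] //= _.
have : s1 \in s1 :: l by rewrite mem_head.
by rewrite -e mem_filter ltE => /andP[].
Qed.

(** * The two maps of the reduction *)

Variables (M : machine) (cM kM : nat).
Hypothesis MP : forall w, computes_within M w (evalsol w) (cM * size w ^ kM + cM).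

Definition rm (x : bits) : nat := (plen x).+1.
(** The instance is hardwired: followed by the input wires, this prefix makes up the [pair_code] of
    [x] and the raw solution. *)
Definition rpre (x : bits) : bits := self_delim x.
Definition rT (x : bits) : nat := cM * (size (rpre x) + rin x) ^ kM + cM.
Definition rgates (x : bits) : seq gate := tableau M (rT x) (rm x + rin x) (rin x) (rpre x).
Definition routs (x : bits) : nat -> nat := outwire M (rT x) (rm x + rin x) (rin x).
Definition rcnf (x : bits) : cnf := gadget (rm x) (rin x) (rgates x) (routs x).

Definition redf (x : bits) : bits := encode_cnf (rcnf x).

Definition redg (w : bits) : bits :=
  let x := (unpair w).1 in let a := (unpair w).2 in
  (unpair [seq nth false a (wvar (rm x) (rin x) (rgates x) (head false a) i)
          | i <- iota 0 (rin x)]).1.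

Lemma FP_rin : FP rin.
Proof. by have hq := FP_qsz; rewrite /rin; fp. Qed.

Lemma FP_rm : FP rm.
Proof. by have hq := FP_plen; rewrite /rm; fp. Qed.

Lemma FP_rpre : FP rpre.
Proof.
apply: (@FP_ext _ _ _ _ (fun x => pair_code x [::])).
  by move=> x; rewrite /pair_code cats0.
have hh : FP (fun x : bits => (x, [::] : bits)) by fp.
exact: FP_comp hh FP_pc.
Qed.

Lemma FP_rT : FP rT.
Proof. by have h1 := FP_rin; have h2 := FP_rpre; rewrite /rT; fp. Qed.

Lemma FP_rgates : FP rgates.
Proof.
have h1 := FP_rin; have h2 := FP_rpre; have h3 := FP_rT; have h4 := FP_rm.
by apply: FP_tableau => //; fp.
Qed.

Lemma FP_redf : FP redf.
Proof.
have h1 := FP_rin; have h2 := FP_rpre; have h3 := FP_rT; have h4 := FP_rm.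
have h5 := FP_rgates.
apply: FP_comp (_ : FP rcnf) FP_encode_cnf; apply: FP_gadget => //.
by rewrite /routs /outwire /cbase /trow; fpc.
Qed.

Lemma FP_redg : FP redg.
Proof.
have h1 := FP_rin; have h4 := FP_rm; have h5 := FP_rgates.
have hmap : FP (fun p : bits * bits => [seq nth false p.2 (wvar (rm p.1) (rin p.1)
    (rgates p.1) (head false p.2) i) | i <- iota 0 (rin p.1)]).
  have h6 : FP (fun x => nw (rin x) (rgates x)) by rewrite /nw /gate; fpc.
  apply: (FP_mapb (g := fun (p : bits * bits) i =>
    nth false p.2 (wvar (rm p.1) (rin p.1) (rgates p.1) (head false p.2) i))).
    by fpc.
  by rewrite /wvar; fpc.
exact: FP_comp (FP_comp FP_unpair hmap) FP_unpair1.
Qed.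

Lemma redg_local_opt x a : instance P x ->
  local_opt (kSAT_dFLIP 4 2) (redf x) a -> local_opt P x (redg (pair_code x a)).
Proof.
move=> hx /flip_opt[]; set A := nth false a => opt1 opt2.
have rin_gt0 : 0 < rin x by [].
have nout_gt0 : 0 < rm x + rin x by rewrite addnS.
have wfg := @tableau_wf M (rT x) (rm x + rin x) (rin x) (rpre x) nout_gt0 rin_gt0.
have wfo i : i < rm x + rin x -> routs x i < nw (rin x) (rgates x).
  move=> hi; rewrite /routs /outwire /nw /rgates size_tableau /cbase -addnA ltn_add2l.
  apply: (@leq_trans ((rT x * trow (rT x) (rm x + rin x) + (rT x + i)).+1 * KK M)).
    by rewrite mulSn addnC ltn_add2r /KK ltn_add2l.
  rewrite mulnA leq_mul2r; apply/orP; right; rewrite mulSn addnC -addSn leq_add2r.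
  by rewrite /trow; lia.
set c := A 0.
pose W d w := A (wvar (rm x) (rin x) (rgates x) d w).
have Wc : consistent (rin x) (rgates x) (W c) := active_consistent wfg opt1.
have Wz : consistent (rin x) (rgates x) (W (~~ c)) := inactive_consistent wfg wfo opt1.
have cp j : j < rin x -> W (~~ c) j = W c (routs x (rm x + j)).
  by move=> hj; apply: (copied wfg wfo opt1 hj).
have nb i : i < rm x -> (forall j, j < i -> W c (routs x j) = W (~~ c) (routs x j)) ->
    ~~ W c (routs x i) -> ~~ W (~~ c) (routs x i).
  by move=> hi; apply: (no_better wfg wfo opt1 opt2 hi).
(* The input word of copy [d]. For the active copy it may be anything; [unpair] still extracts some
   word from it, which [evalsol] then treats as a possibly infeasible solution. *)
pose raw d := [seq W d i | i <- iota 0 (rin x)].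
have out d i : consistent (rin x) (rgates x) (W d) -> i < rm x + rin x ->
    W d (routs x i) = nth false (evalsol (pair_code x (raw d))) i.
  move=> hd hi; apply: (tableau_out (M := M) (T := rT x) (nout := rm x + rin x)
    (nin := rin x) (pre := rpre x)) => //; last first.
    apply: leq_trans (size_evalsol _); rewrite unpairK; exact: hi.
  have := MP (pair_code x (raw d)); rewrite {3}/pair_code size_cat size_map size_iota.
  exact.
pose sol d := (unpair (raw d)).1.
have ev d : evalsol (pair_code x (raw d)) =
    rev (value (x, sol d)) ++ rawcode x (succ (x, sol d)).
  by rewrite /evalsol unpairK.
have -> : redg (pair_code x a) = sol c by rewrite /redg unpairK /= -nth0.
apply: local_opt_of_succ => //.
have sz d : size (rev (value (x, sol d))) = rm x by rewrite size_rev size_value.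
(* Here the lengths match exactly: the successor is feasible, hence within the size bound, and its
   padded code fills the [rin x] copied wires. *)
have rawz : raw (~~ c) = rawcode x (succ (x, sol c)).
  apply: (@eq_from_nth _ false).
    rewrite size_map size_iota size_rawcode_eq //.
    by apply: sizeP => //; apply: feasible_succ.
  move=> i; rewrite size_map size_iota => hi.
  rewrite (nth_map 0) ?size_iota // nth_iota // add0n cp // out ?ltn_add2l //.
  by rewrite ev nth_cat sz ltnNge leq_addr /= addKn.
have solz : sol (~~ c) = succ (x, sol c) by rewrite /sol rawz unpairK.
rewrite -solz leqNgt; apply/negP => lt.
have [||i [hi heq h0 h1]] := @first_difference (rev (value (x, sol c))) (rev (value (x, sol (~~ c)))).
- by rewrite !sz.
- by rewrite !revK.
rewrite sz in hi.
have val d j : consistent (rin x) (rgates x) (W d) -> j < rm x ->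
    W d (routs x j) = nth false (rev (value (x, sol d))) j.
  by move=> hd hj; rewrite out ?ltn_addr // ev nth_cat sz hj.
suff : ~~ W (~~ c) (routs x i) by rewrite val // h1.
apply: nb => // [j hj|]; last by rewrite val.
by rewrite !val ?heq // (ltn_trans hj).
Qed.

End Reduction.

Theorem theorem1 : PLS_complete (kSAT_dFLIP 4 2).
Proof.
split; first exact: kSAT_2FLIP_in_PLS.
move=> P [_ [cs [ks sizeP]] [r /FP_polytime rF rP] [st0 /FP_polytime sF st0P]
  [pay /FP_polytime pF payP] neighP [h /FP_polytime hF hP]].
have [kp size_pay] := FP_size pF.
(* The function [evalsol] is composed from the algorithms of [P] as a stack program and only then
   compiled; the tableau is that of the compiled machine. *)
have [M [cM [kM MP]]] := polytime_FP (FP_evalsol P cs ks kp rF sF pF hF).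
exists (redf cs ks kp M cM kM), (redg cs ks kp M cM kM); split.
- exact/polytime_FP/FP_redf.
- exact/polytime_FP/FP_redg.
move=> x hx; split; last by move=> s; apply: (redg_local_opt rP st0P sizeP payP size_pay neighP hP MP).
by exists (rcnf cs ks kp M cM kM x) => // C; apply: size_gadget.
Qed.
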